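(* Let the setting, data and algorithm be as described in the context, and run the algorithm with $\lambda=1$, $\eta_h=1$ for all $h\in[H]$, and $\sigma_r=1$. Define, for $h\in[H]$, $$C_{h,2}=\sum_{i=h}^H\frac{H-i+1}{\sqrt{2\iota_i}},\qquad C_{h,3}=\frac{(H-h+1)^2}{2},\qquad C_{h,4}=\big(\|\Lambda_h\|\,\|\Lambda_h^{-1}\|\big)^{1/2},$$ $$C_3=\max\Big\{\max_{h\in[H]}\frac{C_{h,3}C_{h,2}^2}{8\iota_h^2},\ \frac{H^4}{\kappa^2},\ \frac{H^2}{\kappa^2}\cdot\max_{h\in[H]}\frac{C_{h,3}}{2}\cdot\max_{h\in[H]}\frac{C_{h,3}}{\iota_h}\Big\},$$ $$C_4=\sum_{h=1}^H\sqrt{C_{h,4}\,C_{h,2}\,\frac{(H-h+1)d}{4\iota_h}\log\Big(\frac{dH^2K}{\kappa\delta}\Big)}\;\|v_h^\pi\|_{\Lambda_h^{-1}}.$$ There is a universal (problem-independent) constant $C>0$ such that for every $\delta\in(0,1)$, if $$K\ge C\cdot C_3\cdot d^2\Big[\log\Big(\frac{dH^2K}{\kappa\delta}\Big)\Big]^2,$$ then with probability at least $1-\delta$ the output $\hat v_1^\pi$ of the algorithm satisfies $$|v_1^\pi-\hat v_1^\pi|\le C\Big[\sum_{h=1}^H\|v_h^\pi\|_{\Lambda_h^{-1}}\Big]\sqrt{\frac{\log(16H/\delta)}{K}}+C\cdot C_4\cdot\log\Big(\frac{16H}{\delta}\Big)\Big(\frac{1}{K^{3/4}}+\frac1K\B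ig).$$
   Context: Setting (linear MDP). A time-inhomogeneous episodic MDP has state space $\mathcal S$, action space $\mathcal A$, horizon $H$, transition kernels $P_h(\cdot\mid s,a)$ and mean reward functions $r_h:\mathcal S\times\mathcal A\to[0,1]$, $h\in[H]$. There is a known feature map $\phi:\mathcal S\times\mathcal A\to\mathbb R^d$ with $\|\phi(s,a)\|_2\le1$, and for each $h$ there are $\gamma_h\in\mathbb R^d$ with $\|\gamma_h\|_2\le1$ and a $d$-vector $\mu_h$ of signed measures on $\mathcal S$ with $P_h(\cdot\mid s,a)=\langle\phi(s,a),\mu_h(\cdot)\rangle$ and $r_h(s,a)=\langle\phi(s,a),\gamma_h\rangle$; moreover $\|\int_{\mathcal S}f\,d\mu_h\|_2\le\sqrt d$ for every measurable $f$ with $\sup|f|\le1$. When action $a$ is taken in state $s$ at stage $h$, the observed reward is $r_h(s,a)+\epsilon$, where the noise $\epsilon$ is zero-mean, independent of everything else, $|\epsilon|\le1$ and $r_h(s,a)+\epsilon\le1$ a.s. For a function $V$ on $\mathcal S$, $[P_hV](s,a)=\int V(s')P_h(ds'\mid s,a)$ and $[\mathbb V_hV](s,a)=[P_hV^2](s,a)-([P_hV](s,a))^2$. A (target) policy $\pi=(\pi_h)_{h\in[H]}$ gives distributions $\pi_h(\cdot\mid s)$ on $\mathcal A$; $Q_h^\pi(s,a)=\mathbb E_\pi[\sum_{i=h}^H r_i(s_i,a_i)\mid s_h=s,a_h=a]$, $V_h^\pi(s)=\int Q_h^\pi(s,a)\pi_h(da\mid s)$, $V_{H+1}^\pi\equiv0$,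 and $\phi_h^\pi(s)=\int\phi(s,a)\pi_h(da\mid s)$. Given an initial distribution $\xi_1$, the goal is $v_1^\pi=\mathbb E_{s\sim\xi_1}[V_1^\pi(s)]$. A behavior policy $\bar\pi$ induces, from $s_1\sim\xi_1$, the occupancy measure $\nu_h$ of $(s_h,a_h)$; write $\mathbb E_{\bar\pi,h}[f]=\int f\,d\nu_h$; analogously $\mathbb E_{\pi,h}$ for the target policy, and $v_h^\pi=\mathbb E_{\pi,h}[\phi(s_h,a_h)]$. Let $\Sigma_h=\mathbb E_{\bar\pi,h}[\phi\phi^\top]$, $\kappa_h=\lambda_{\min}(\Sigma_h)$, $\kappa=\min_h\kappa_h$, and assume $\kappa>0$. For parameters $\eta_h>0$, $\sigma_r\ge0$ define $\sigma_h(s,a)=\sqrt{\max\{\eta_h,[\mathbb V_hV_{h+1}^\pi](s,a)\}+\sigma_r^2}$, $\Lambda_h=\mathbb E_{\bar\pi,h}[\sigma_h(s,a)^{-2}\phi(s,a)\phi(s,a)^\top]$, $\iota_h=\lambda_{\min}(\Lambda_h)$; $\|x\|_M=\sqrt{x^\top Mx}$. Data (stage sampling). Two datasets $\mathcal D=\{\mathcal D_h\}_{h\in[H]}$ and $\check{\mathcal D}=\{\check{\mathcal D}_h\}_{h\in[H]}$, $\mathcal D_h=\{(s_{k,h},a_{k,h},r_{k,h},s'_{k,h})\}_{k\in[K]}$, where for each $k$ independently $(s_{k,h},a_{k,h})\sim\nu_h$, $s'_{k,h}\sim P_h(\cdot\mid s_{k,h},a_{k,h})$, and $r_{k,h}=r_h(s_{k,h},a_{k,h})+\epsilon_{k,h}$;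 the $\mathcal D_h$ are independent across $h$; $\check{\mathcal D}$ has the same structure (entries $\check s_{k,h},\check a_{k,h},\check r_{k,h},\check s'_{k,h}$) and is independent of $\mathcal D$. Write $\phi_{k,h}=\phi(s_{k,h},a_{k,h})$, $\check\phi_{k,h}=\phi(\check s_{k,h},\check a_{k,h})$. Algorithm (variance-aware weighted fitted Q-iteration) with parameters $\lambda>0$, $\eta_h$, $\sigma_r$: set $\hat V_{H+1}\equiv0$; for $h=H,H-1,\dots,1$: $\hat\Sigma_h=\sum_k\check\phi_{k,h}\check\phi_{k,h}^\top+\lambda I_d$; $\hat\beta_h=\hat\Sigma_h^{-1}\sum_k\check\phi_{k,h}\hat V_{h+1}(\check s'_{k,h})^2$; $\hat\theta_h=\hat\Sigma_h^{-1}\sum_k\check\phi_{k,h}\hat V_{h+1}(\check s'_{k,h})$; $\hat\sigma_h(s,a)=\sqrt{\max\{\eta_h,\ [\langle\phi(s,a),\hat\beta_h\rangle]_{[0,(H-h+1)^2]}-([\langle\phi(s,a),\hat\theta_h\rangle]_{[0,H-h+1]})^2\}+\sigma_r^2}$, where $[x]_{[a,b]}$ denotes clipping of $x$ to $[a,b]$; $\hat\sigma_{k,h}=\hat\sigma_h(s_{k,h},a_{k,h})$; $\hat\Lambda_h=\sum_k\phi_{k,h}\phi_{k,h}^\top/\hat\sigma_{k,h}^2+\lambda I_d$; $\hat w_h=\hat\Lambda_h^{-1}\sum_k\phi_{k,h}(r_{k,h}+\hat V_{h+1}(s'_{k,h}))/\hat\sigma_{k,h}^2$; $\hat V_h(s)=\langle\phi_h^\pi(s),\hat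 w_h\rangle$. Output $\hat v_1^\pi=\int\hat V_1\,d\xi_1$. *)

(* Defs.v *)
From HB Require Import structures.
From mathcomp Require Import all_boot all_order all_algebra.
From mathcomp Require Import all_classical all_reals all_analysis.

Set Implicit Arguments.
Unset Strict Implicit.
Unset Printing Implicit Defensive.

Import Order.TTheory GRing.Theory Num.Theory.
Import numFieldNormedType.Exports.

Local Open Scope classical_set_scope.
Local Open Scope ring_scope.

Section LinAlg.
Variables (R : realType) (d : nat).

Definition dotv (x y : 'cV[R]_d) : R := \sum_(i < d) x i 0 * y i 0.

Definition vnorm (x : 'cV[R]_d) : R := Num.sqrt (dotv x x).

Definition Mnorm (M : 'M[R]_d) (x : 'cV[R]_d) : R :=
  Num.sqrt ((x^T *m M *m x) 0 0).

Definition opnorm (M : 'M[R]_d) : R :=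
  sup [set vnorm (M *m x) | x in [set x : 'cV[R]_d | vnorm x <= 1]].

Definition lambda_min (M : 'M[R]_d) : R :=
  inf [set a : R | eigenvalue M a].

End LinAlg.

Definition clip (R : realType) (a b x : R) : R := Num.min (Num.max x a) b.

Definition max_stage (R : realType) (H : nat) (f : nat -> R) : R :=
  sup [set f h | h in [set h : nat | (1 <= h <= H)%N]].
Definition min_stage (R : realType) (H : nat) (f : nat -> R) : R :=
  inf [set f h | h in [set h : nat | (1 <= h <= H)%N]].

Definition mutual_indep (R : realType) d (Omega : measurableType d)
    (Pr : probability Omega R) (I : finType) d' (T : measurableType d')
    (Y : I -> Omega -> T) : Prop :=
  forall B : I -> set T, (forall i, measurable (B i)) ->
    fine (Pr (\bigcap_(i in [set: I]) (Y i @^-1` B i))) =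
    \prod_(i : I) fine (Pr (Y i @^-1` B i)).

Definition with_prob_at_least (R : realType) d (Omega : measurableType d)
    (Pr : probability Omega R) (p : R) (E : set Omega) : Prop :=
  exists F : set Omega, [/\ measurable F, F `<=` E & (p%:E <= Pr F)%E].

(* The MDP objects.  Stages are natural numbers h = 1, ..., H.              *)
Section MDP.
Variables (R : realType) (dS dA : measure_display).
Variables (S : measurableType dS) (A : measurableType dA).
Variables (d H : nat).
Variable phi : S * A -> 'cV[R]_d.
Variable P : nat -> R.-pker (S * A) ~> S.

Definition PV (h : nat) (V : S -> R) (sa : S * A) : R :=
  Rintegral (P h sa) setT V.

Definition VarV (h : nat) (V : S -> R) (sa : S * A) : R :=
  PV h (fun s => V s ^+ 2) sa - (PV h V sa) ^+ 2.

Definition phi_pol (pol : nat -> R.-pker S ~> A) (h : nat) (s : S) : 'cV[R]_d :=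
  \col_i Rintegral (pol h s) setT (fun a => phi (s, a) i 0).

(* Q/V functions of a policy, by backward (Bellman) recursion.
   [Vpol r pol n] is V_h^pi with n = H - h + 1 remaining stages, so that
   Vpol r pol 0 = V_{H+1}^pi = 0 and Vpol r pol H = V_1^pi. *)
Fixpoint Vpol (r : nat -> S * A -> R) (pol : nat -> R.-pker S ~> A) (n : nat)
    : S -> R :=
  match n with
  | 0 => fun _ => 0
  | n'.+1 =>
      let h := (H - n')%N in
      let Vnext := Vpol r pol n' in
      fun s => Rintegral (pol h s) setT (fun a => r h (s, a) + PV h Vnext (s, a))
  end.

Definition Vpi r pol (h : nat) : S -> R := Vpol r pol (H.+1 - h)%N.

Definition is_occupancy (xi1 : probability S R) (pol : nat -> R.-pker S ~> A)
    (nu : nat -> {measure set (S * A) -> \bar R}) : Prop :=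
  (forall B, measurable B ->
     nu 1%N B = (\int[xi1]_s pol 1%N s [set a | B (s, a)])%E) /\
  (forall h, (1 <= h < H)%N -> forall B, measurable B ->
     nu h.+1 B =
     (\int[nu h]_sa \int[P h sa]_s' pol h.+1 s' [set a | B (s', a)])%E).

Definition Sigma_mat (nu : nat -> {measure set (S * A) -> \bar R}) (h : nat)
    : 'M[R]_d :=
  \matrix_(i, j) Rintegral (nu h) setT (fun sa => phi sa i 0 * phi sa j 0).

Definition Lambda_mat (nu : nat -> {measure set (S * A) -> \bar R})
    (sigma : nat -> S * A -> R) (h : nat) : 'M[R]_d :=
  \matrix_(i, j) Rintegral (nu h) setT
     (fun sa => (sigma h sa) ^-2 * phi sa i 0 * phi sa j 0).

Definition vpi_vec (nupi : nat -> {measure set (S * A) -> \bar R}) (h : nat)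
    : 'cV[R]_d :=
  \col_i Rintegral (nupi h) setT (fun sa => phi sa i 0).

Definition sigma_fun r pol (eta : nat -> R) (sr : R) (h : nat) (sa : S * A) : R :=
  Num.sqrt (Num.max (eta h) (VarV h (Vpi r pol h.+1) sa) + sr ^+ 2).

(* A dataset is  D h k = ((s_{k,h}, a_{k,h}), r_{k,h}, s'_{k,h}).           *)
Variable K : nat.
Definition dataset := nat -> 'I_K -> ((S * A) * R * S)%type.

Section Alg.
Variables (lam : R) (eta : nat -> R) (sr : R) (pol : nat -> R.-pker S ~> A).
Variables (D Dc : dataset).

Definition fqi_w (h : nat) (Vn : S -> R) : 'cV[R]_d :=
  let phic k := phi (Dc h k).1.1 in
  let sc' k := (Dc h k).2 in
  let Sigh : 'M[R]_d := \sum_(k < K) (phic k *m (phic k)^T) + lam%:M in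
  let betah := invmx Sigh *m \sum_(k < K) ((Vn (sc' k)) ^+ 2 *: phic k) in
  let thetah := invmx Sigh *m \sum_(k < K) (Vn (sc' k) *: phic k) in
  let Hh : R := (H - h).+1%:R in
  let sighat sa := Num.sqrt (Num.max (eta h)
        (clip 0 (Hh ^+ 2) (dotv (phi sa) betah)
         - (clip 0 Hh (dotv (phi sa) thetah)) ^+ 2) + sr ^+ 2) in
  let phik k := phi (D h k).1.1 in
  let sigk k := sighat (D h k).1.1 in
  let rk k := (D h k).1.2 in
  let sk' k := (D h k).2 in
  let Lamh : 'M[R]_d :=
    \sum_(k < K) ((sigk k) ^-2 *: (phik k *m (phik k)^T)) + lam%:M in
  invmx Lamh *m \sum_(k < K) (((rk k + Vn (sk' k)) / (sigk k) ^+ 2) *: phik k).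

(* hat V_h with n = H - h + 1 remaining stages *)
Fixpoint fqi_V (n : nat) : S -> R :=
  match n with
  | 0 => fun _ => 0
  | n'.+1 =>
      let h := (H - n')%N in
      let w := fqi_w h (fqi_V n') in
      fun s => dotv (phi_pol pol h s) w
  end.

Definition fqi_output (xi1 : probability S R) : R :=
  Rintegral xi1 setT (fqi_V H).

End Alg.
End MDP.

(* Main.v *)
(* Every stage is estimated from fresh samples: given the data of the stages after
   h, the estimate of V_{h+1} is a fixed function, so that neither coverings nor
   matrix concentration are needed.  Entrywise exponential moment bounds show,
   off an event of probability at most delta, that the empirical second moment
   matrices dominate half of their means and that the noise vectors have
   coordinates of order sqrt (K log (d H / delta)).

   By backward induction the values are then estimated at stage h within
   (H + 1 - h) / H, hence within 1.  This crude accuracy makes the estimated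
   variances comparable, up to constant factors, with the true ones: the weighted
   Gram matrix dominates (K / 8) Lambda_h.  The error of the output is exactly
   sum_h <v_h, gamma_h + mu_h Vhat_{h+1} - what_h>; along the fixed direction v_h
   the noise is a martingale sum of conditional variance at most
   16 |v_h|^2 / K, for the norm of Lambda_h^-1, which gives the leading term.

   With K = 1 the assumption on K forces H = 1, and there the regularisation
   alone bounds the error. *)

Require Import Defs.
From HB Require Import structures.
From mathcomp Require Import all_boot all_order all_algebra.
From mathcomp Require Import all_classical all_reals all_analysis.
From mathcomp Require Import measurable_realfun.
From mathcomp Require Import ring lra.
Import Order.TTheory GRing.Theory Num.Theory.
Import numFieldNormedType.Exports.
Local Open Scope classical_set_scope.
Local Open Scope ring_scope.

Set Implicit Arguments.
Unset Strict Implicit.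
Unset Printing Implicit Defensive.

(** * Linear algebra *)

(** The noise of a stage enters the error along [v] with weights that contain the inverse Gram
    matrix of all its state-action pairs, so no ordering of the samples makes them predictable. They
    are however determined by those pairs, the check data and the later stages; redrawing one sample
    at a time with its pair kept takes the place of a filtration.

    Exponential moments need summands bounded on every sample path, while values and weights are
    bounded only on the good event; both are clipped, and the clipping is inactive on that event.

    Entrywise deviations cost a factor d in quadratic forms, which the d^2 in the sample size pays.
    The constant is 160^2 = 16 * 40^2: an error of 1/H per stage requires 40 = 8 (2 + 3), with 8
    from the Gram lower bound, 2 from the regularisation and 3 from the deviations, and 16 is lost
    in bounding H^4 by iota_h^2 times the last entry of [C3]. The remainder, of order sqrt d (H - h
    + 1) |v| L' / (K sqrt iota_h), fits under [C4] because C_{h,4} >= 1 and C_{h,2} >= H - h + 1. *)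

Lemma eq_ler (R : numDomainType) (x y : R) : x = y -> x <= y.
Proof. by move=> ->. Qed.

Section LinearAlgebra.
Variables (R : realType) (d : nat).
Implicit Types (x y v : 'cV[R]_d) (M N : 'M[R]_d).

Lemma dotvE x y : dotv x y = (x^T *m y) 0 0.
Proof. by rewrite mxE; apply: eq_bigr => i _; rewrite mxE. Qed.

Lemma dotvC x y : dotv x y = dotv y x.
Proof. by apply: eq_bigr => i _; rewrite mulrC. Qed.

Lemma dotvDr x y v : dotv x (y + v) = dotv x y + dotv x v.
Proof. by rewrite !dotvE mulmxDr mxE. Qed.

Lemma dotvDl x y v : dotv (x + y) v = dotv x v + dotv y v.
Proof. by rewrite dotvC dotvDr !(dotvC v). Qed.

Lemma dotvZr a x y : dotv x (a *: y) = a * dotv x y.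
Proof. by rewrite !dotvE -scalemxAr mxE. Qed.

Lemma dotvZl a x y : dotv (a *: x) y = a * dotv x y.
Proof. by rewrite dotvC dotvZr dotvC. Qed.

Lemma dotvNr x y : dotv x (- y) = - dotv x y.
Proof. by rewrite -scaleN1r dotvZr mulN1r. Qed.

Lemma dotvBr x y v : dotv x (y - v) = dotv x y - dotv x v.
Proof. by rewrite dotvDr dotvNr. Qed.

Lemma dotv0r x : dotv x 0 = 0.
Proof. by rewrite -(scale0r 0) dotvZr mul0r. Qed.

Lemma dotv_sumr (I : Type) (r : seq I) (F : I -> 'cV[R]_d) x :
  dotv x (\sum_(k <- r) F k) = \sum_(k <- r) dotv x (F k).
Proof.
by elim/big_rec2: _ => [|k a b _ <-]; rewrite ?dotv0r // dotvDr.
Qed.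

Lemma dotv_mulmx x y M : dotv x (M *m y) = dotv (M^T *m x) y.
Proof. by rewrite !dotvE trmx_mul trmxK mulmxA. Qed.

Lemma dotv_ge0 x : 0 <= dotv x x.
Proof. by apply: sumr_ge0 => i _; rewrite -expr2 sqr_ge0. Qed.

Lemma dotv_eq0 x : (dotv x x == 0) = (x == 0).
Proof.
apply/idP/eqP => [|->]; last by rewrite dotv0r.
rewrite psumr_eq0 => [/allP h|i _]; last by rewrite -expr2 sqr_ge0.
apply/matrixP => i j; rewrite ord1 mxE.
by have := h i; rewrite mem_index_enum mulf_eq0 orbb => /(_ isT)/eqP.
Qed.

Lemma vnorm_ge0 x : 0 <= vnorm x. Proof. exact: sqrtr_ge0. Qed.

Lemma sqr_vnorm x : vnorm x ^+ 2 = dotv x x.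
Proof. by rewrite sqr_sqrtr // dotv_ge0. Qed.

Lemma vnormZ a x : vnorm (a *: x) = `|a| * vnorm x.
Proof. by rewrite /vnorm dotvZl dotvZr mulrA -expr2 sqrtrM ?sqr_ge0 // sqrtr_sqr. Qed.

Definition psd M := M^T = M /\ forall x, 0 <= dotv x (M *m x).

Lemma psd_sym M x y : psd M -> dotv x (M *m y) = dotv y (M *m x).
Proof. by case=> sM _; rewrite dotv_mulmx sM dotvC. Qed.

(** The form is nonnegative along the line [x + t *: y]; its value at the minimiser [- b / a] gives
    the claim. *)
Lemma psd_cauchy_schwarz M x y : psd M ->
  dotv x (M *m y) ^+ 2 <= dotv x (M *m x) * dotv y (M *m y).
Proof.
move=> pM; have [sM p0] := pM.
set a := dotv y (M *m y); set b := dotv x (M *m y); set c := dotv x (M *m x).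
have q t : 0 <= c + t * b *+ 2 + t ^+ 2 * a.
  have := p0 (x + t *: y); rewrite mulmxDr -scalemxAr !dotvDr !dotvDl !dotvZr !dotvZl.
  by rewrite (psd_sym y x pM) -/a -/b -/c; congr (_ <= _); ring.
have a0 : 0 <= a by exact: p0.
have [a00|an0] := eqVneq a 0.
  rewrite a00 mulr0; have [->|bn0] := eqVneq b 0; first by rewrite expr0n.
  (* For a = 0 the form is affine in t, and this t gives it the value - c - 2 < 0. *)
  have := q (- (c + 1) / b); rewrite a00 mulr0 addr0 divfK //; have := p0 x; rewrite -/c.
  by move=> ? ?; lra.
have ap : 0 < a by rewrite lt_neqAle eq_sym an0.
have := q (- b / a).
have -> : c + - b / a * b *+ 2 + (- b / a) ^+ 2 * a = (c * a - b ^+ 2) / a by field.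
by rewrite pmulr_lge0 ?invr_gt0 // subr_ge0.
Qed.

Lemma psd1 : psd 1%:M.
Proof. by split=> [|x]; rewrite ?trmx1 // mul1mx dotv_ge0. Qed.

Lemma cauchy_schwarz x y : dotv x y ^+ 2 <= dotv x x * dotv y y.
Proof. by have := psd_cauchy_schwarz x y psd1; rewrite !mul1mx. Qed.

Lemma ler_norm_dotv x y : `|dotv x y| <= vnorm x * vnorm y.
Proof.
rewrite -ler_sqr ?nnegrE ?mulr_ge0 ?vnorm_ge0 //.
by rewrite real_normK ?num_real // exprMn !sqr_vnorm cauchy_schwarz.
Qed.

Lemma ler_coord_vnorm x i : `|x i 0| <= vnorm x.
Proof.
rewrite -ler_sqr ?nnegrE ?vnorm_ge0 // real_normK ?num_real // sqr_vnorm.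
rewrite /dotv (bigD1 i) //= -expr2 lerDl.
by apply: sumr_ge0 => j _; rewrite -expr2 sqr_ge0.
Qed.

Lemma vnorm_le x c : 0 <= c -> dotv x x <= c ^+ 2 -> vnorm x <= c.
Proof. by move=> c0 h; rewrite -ler_sqr ?nnegrE ?vnorm_ge0 // sqr_vnorm. Qed.

Lemma vnormD x y : vnorm (x + y) <= vnorm x + vnorm y.
Proof.
apply: vnorm_le; first by rewrite addr_ge0 ?vnorm_ge0.
rewrite dotvDl !dotvDr sqrrD !sqr_vnorm (dotvC y x).
have := ler_norm_dotv x y; have := ler_norm (dotv x y); rewrite mulr2n; lra.
Qed.

Lemma vnorm_coord x c : 0 <= c -> (forall i, `|x i 0| <= c) ->
  vnorm x <= Num.sqrt d%:R * c.
Proof.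
move=> c0 h; apply: vnorm_le; first by rewrite mulr_ge0 ?sqrtr_ge0.
rewrite exprMn sqr_sqrtr // /dotv.
apply: (@le_trans _ _ (\sum_(i < d) c ^+ 2)).
  apply: ler_sum => i _; rewrite -expr2 -real_normK ?num_real //.
  by rewrite ler_sqr ?nnegrE.
by rewrite sumr_const card_ord mulr_natl.
Qed.

Definition frob M := Num.sqrt (\sum_i \sum_j M i j ^+ 2).

Lemma frob_ge0 M : 0 <= frob M. Proof. exact: sqrtr_ge0. Qed.

Lemma vnorm_mulmx_frob M x : vnorm (M *m x) <= frob M * vnorm x.
Proof.
apply: vnorm_le; first by rewrite mulr_ge0 ?sqrtr_ge0.
rewrite exprMn sqr_vnorm sqr_sqrtr; last by apply: sumr_ge0=> i _; apply: sumr_ge0 => j _; rewrite sqr_ge0.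
rewrite mulr_suml; apply: ler_sum => i _.
have := cauchy_schwarz (row i M)^T x.
rewrite -expr2 (_ : dotv _ x = (M *m x) i 0); last first.
  by rewrite mxE; apply: eq_bigr => j _; rewrite !mxE.
move=> /le_trans; apply; rewrite ler_wpM2r ?dotv_ge0 //.
by apply: ler_sum => j _; rewrite !mxE expr2.
Qed.

(** Each |x_i x_j| is at most (x_i^2 + x_j^2) / 2, and summation gives every square the coefficient
    d. For d = 0 the sign of [e] is unknown, but both sides vanish. *)
Lemma quad_form_entries M x e : (forall i j, `|M i j| <= e) ->
  `|dotv x (M *m x)| <= e * d%:R * dotv x x.
Proof.
case: (posnP d) => [d0 _|d0 h].
  have z (w : 'cV[R]_d) : dotv w (M *m w) = 0.
    by rewrite /dotv big1 // => -[i hi]; exfalso; rewrite d0 in hi.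
  rewrite z normr0 /dotv big1 ?mulr0 // => -[i hi]; exfalso; by rewrite d0 in hi.
have e0 : 0 <= e by apply: le_trans (h (Ordinal d0) (Ordinal d0)).
have h1 : `|dotv x (M *m x)| <= \sum_i \sum_j e * ((x i 0 ^+ 2 + x j 0 ^+ 2) / 2).
  apply: le_trans (ler_norm_sum _ _ _) _; apply: ler_sum => i _.
  rewrite mxE mulr_sumr; apply: le_trans (ler_norm_sum _ _ _) _.
  apply: ler_sum => j _; rewrite mulrCA normrM ler_pM // normrM.
  rewrite -(real_normK (num_real (x i 0))) -(real_normK (num_real (x j 0))).
  have := sqr_ge0 (`|x i 0| - `|x j 0|); rewrite sqrrB mulr2n; lra.
apply: le_trans h1 _; apply: eq_ler.
have -> : \sum_i \sum_j e * ((x i 0 ^+ 2 + x j 0 ^+ 2) / 2) =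
  \sum_(i < d) (e / 2 * d%:R * x i 0 ^+ 2 + e / 2 * dotv x x).
  apply: eq_bigr => i _; rewrite -mulr_sumr -mulr_suml big_split /= sumr_const card_ord.
  by rewrite /dotv (eq_bigr (fun j => x j 0 ^+ 2)) // -mulr_natr; ring.
rewrite big_split /= -mulr_sumr sumr_const card_ord -[X in _ + X]mulr_natr.
have -> : \sum_(i < d) x i 0 ^+ 2 = dotv x x by apply: eq_bigr => j _; rewrite expr2.
by field.
Qed.

Lemma quad_scalar a x : dotv x (a%:M *m x) = a * dotv x x.
Proof. by rewrite mul_scalar_mx dotvZr. Qed.

Lemma posdef_unitmx M c : 0 < c ->
  (forall x, c * dotv x x <= dotv x (M *m x)) -> M \in unitmx.
Proof.
move=> c0 h; rewrite unitmxE unitfE; apply/negP => /det0P[v vn0 vM].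
have := h v^T.
have -> : dotv v^T (M *m v^T) = 0.
  by rewrite dotvE trmxK mulmxA vM mul0mx mxE.
rewrite pmulr_rle0 // => h0.
have : dotv v^T v^T == 0 by rewrite eq_le h0 dotv_ge0.
by rewrite dotv_eq0 -trmx0 (inj_eq trmx_inj) (negbTE vn0).
Qed.

Lemma invmx_sym M : M^T = M -> (invmx M)^T = invmx M.
Proof. by move=> sM; rewrite trmx_inv sM. Qed.

(** With y = M x, Cauchy-Schwarz in the form of M for y and x bounds |y|^2 by a multiple of <x, M
    x>, and inverting M bounds |x| by a multiple of |y|. The added 1 keeps the constant positive.
    Read backwards, a psd matrix that is not coercive is singular, which yields an eigenvalue
    without compactness. *)
Lemma psd_unit_coercive M : psd M -> M \in unitmx ->
  exists2 c, 0 < c & forall x, c * dotv x x <= dotv x (M *m x).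
Proof.
move=> pM uM; have [sM p0] := pM.
exists ((1 + frob (invmx M)) ^+ 2 * (1 + frob M))^-1.
  by rewrite invr_gt0 mulr_gt0 ?exprn_gt0 // ltr_pwDl // frob_ge0.
move=> x; have F0 := frob_ge0 (invmx M); have G0 := frob_ge0 M.
rewrite mulrC ler_pdivrMr ?mulr_gt0 ?exprn_gt0 ?ltr_pwDl //.
set y := M *m x; have xy : x = invmx M *m y by rewrite mulKmx.
have h1 : dotv x x <= (1 + frob (invmx M)) ^+ 2 * dotv y y.
  rewrite -!sqr_vnorm -exprMn ler_sqr ?nnegrE ?mulr_ge0 ?vnorm_ge0 ?addr_ge0 //.
  rewrite {1}xy (le_trans (vnorm_mulmx_frob _ _)) // ler_wpM2r ?vnorm_ge0 //.
  by rewrite lerDr.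
have h2 : dotv y y <= dotv x y * (1 + frob M).
  have [->|yn0] := eqVneq y 0; first by rewrite !dotv0r mul0r.
  have yp : 0 < dotv y y by rewrite lt_neqAle dotv_ge0 eq_sym dotv_eq0 yn0.
  have := psd_cauchy_schwarz y x pM; rewrite -/y => /le_trans h.
  have : dotv y y ^+ 2 <= dotv y y * (1 + frob M) * dotv x y.
    apply: h; rewrite ler_wpM2r //.
    apply: le_trans (ler_norm _) _; apply: le_trans (ler_norm_dotv _ _) _.
    rewrite -sqr_vnorm expr2 -mulrA ler_wpM2l ?vnorm_ge0 //.
    apply: le_trans (vnorm_mulmx_frob _ _) _.
    by rewrite mulrC ler_wpM2l ?vnorm_ge0 // lerDr.
  by rewrite expr2 -mulrA ler_pM2l // mulrC.
apply: le_trans h1 _.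
by rewrite [leRHS]mulrCA ler_wpM2l ?sqr_ge0.
Qed.

Lemma exists_unit_vector : (0 < d)%N -> exists e : 'cV[R]_d, dotv e e = 1.
Proof.
move=> d0; exists (delta_mx (Ordinal d0) 0); rewrite /dotv (bigD1 (Ordinal d0)) //= big1.
  by rewrite !mxE !eqxx mulr1 addr0.
by move=> i /negbTE ni; rewrite !mxE ni mul0r.
Qed.

(** The infimum [rho] of the Rayleigh quotient makes M - rho I psd; were it invertible, it would be
    coercive and [rho] could be raised. So [rho] is itself an eigenvalue, and no eigenvalue lies
    below it. *)
Lemma lambda_minP M : M^T = M -> (0 < d)%N ->
  (forall x, lambda_min M * dotv x x <= dotv x (M *m x)) /\
  (forall c, (forall x, c * dotv x x <= dotv x (M *m x)) -> c <= lambda_min M).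
Proof.
move=> sM d0.
pose E : set R := [set dotv x (M *m x) | x in [set x | dotv x x = 1]].
have [e0 e01] := exists_unit_vector d0.
have lbE : lbound E (- frob M).
  move=> _ [x x1 <-]; rewrite lerNl; apply: le_trans (ler_norm _) _.
  rewrite normrN; apply: le_trans (ler_norm_dotv _ _) _.
  have v1 : vnorm x = 1 by rewrite /vnorm x1 sqrtr1.
  by rewrite v1 mul1r; have := vnorm_mulmx_frob M x; rewrite v1 mulr1.
have hE : has_inf E.
  split; last by exists (- frob M).
  by exists (dotv e0 (M *m e0)); exists e0.
pose rho := inf E.
have rayleigh x : rho * dotv x x <= dotv x (M *m x).
  have [->|xn0] := eqVneq x 0; first by rewrite mulmx0 !dotv0r mulr0.
  have xp : 0 < dotv x x by rewrite lt_neqAle dotv_ge0 eq_sym dotv_eq0 xn0.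
  rewrite -ler_pdivlMr //; apply: inf_lbound; first by case: hE.
  exists ((vnorm x)^-1 *: x).
    by rewrite /= dotvZl dotvZr mulrA -expr2 exprVn sqr_vnorm mulVf // gt_eqF.
  by rewrite -scalemxAr dotvZl dotvZr mulrA -expr2 exprVn sqr_vnorm mulrC.
have psdN : psd (M - rho%:M).
  split=> [|x]; first by rewrite linearB /= tr_scalar_mx sM.
  by rewrite mulmxBl dotvBr quad_scalar subr_ge0.
have sing : (M - rho%:M) \notin unitmx.
  apply/negP => /(psd_unit_coercive psdN)[c c0 hc].
  have : rho + c <= rho.
    apply: lb_le_inf; first by case: hE.
    move=> _ [x x1 <-]; have := hc x.
    by rewrite mulmxBl dotvBr quad_scalar x1 !mulr1; lra.
  lra.
have evrho : eigenvalue M rho.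
  move: sing; rewrite unitmxE unitfE negbK => /det0P[v vn0 vM].
  apply/eigenvalueP; exists v => //; apply/eqP; rewrite -subr_eq0.
  by rewrite -mul_mx_scalar -mulmxBr vM.
have evge a : eigenvalue M a -> rho <= a.
  move=> /eigenvalueP[v va vn0].
  have := rayleigh v^T.
  have vp : 0 < dotv v^T v^T.
    by rewrite lt_neqAle dotv_ge0 eq_sym dotv_eq0 -trmx0 (inj_eq trmx_inj) vn0.
  rewrite (_ : dotv v^T (M *m v^T) = a * dotv v^T v^T) ?ler_pM2r //.
  by rewrite !dotvE trmxK mulmxA va -scalemxAl mxE.
have lmE : lambda_min M = rho.
  apply/eqP; rewrite eq_le; apply/andP; split.
    by apply: inf_lbound => //; exists rho => a; exact: evge.
  by apply: lb_le_inf => [|a]; [exists rho | exact: evge].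
rewrite lmE; split=> [//|c hc]; apply: lb_le_inf; first by case: hE.
by move=> _ [x x1 <-]; have := hc x; rewrite x1 mulr1.
Qed.

Lemma sqr_Mnorm M x : psd M -> Mnorm M x ^+ 2 = dotv x (M *m x).
Proof. by case=> _ p0; rewrite /Mnorm -mulmxA -dotvE sqr_sqrtr. Qed.

Lemma Mnorm_ge0 M x : 0 <= Mnorm M x. Proof. exact: sqrtr_ge0. Qed.

Lemma psd_invmx M c : 0 < c -> M^T = M ->
  (forall x, c * dotv x x <= dotv x (M *m x)) -> psd (invmx M).
Proof.
move=> c0 sM h; have uM := posdef_unitmx c0 h.
split; first exact: invmx_sym.
move=> x; set y := invmx M *m x; have -> : x = M *m y by rewrite mulKVmx.
by rewrite dotvC (le_trans _ (h y)) // mulr_ge0 ?dotv_ge0 // ltW.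
Qed.

Lemma ler_dotv_Mnorm M x y : psd M ->
  `|dotv x (M *m y)| <= Mnorm M x * Mnorm M y.
Proof.
move=> pM; rewrite -ler_sqr ?nnegrE ?mulr_ge0 ?Mnorm_ge0 //.
by rewrite real_normK ?num_real // exprMn !sqr_Mnorm // psd_cauchy_schwarz.
Qed.

(** Inversion reverses the order of positive definite matrices. With y = M^-1 x and z = N^-1 x,
    Cauchy-Schwarz in N gives <x,y>^2 <= <x,z> <y, N y> <= <x,z> <x,y> / a, and <x,y> cancels. *)
Lemma Mnorm_inv_le M N a c x : 0 < a -> 0 < c ->
  M^T = M -> N^T = N ->
  (forall x, c * dotv x x <= dotv x (N *m x)) ->
  (forall x, a * dotv x (N *m x) <= dotv x (M *m x)) ->
  Mnorm (invmx M) x <= Mnorm (invmx N) x / Num.sqrt a.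
Proof.
move=> a0 c0 sM sN hN hM.
have hM' y : (a * c) * dotv y y <= dotv y (M *m y).
  by apply: le_trans (hM y); rewrite -mulrA ler_pM2l.
have ac0 : 0 < a * c by rewrite mulr_gt0.
have uM := posdef_unitmx ac0 hM'; have uN := posdef_unitmx c0 hN.
have pM := psd_invmx ac0 sM hM'; have pN := psd_invmx c0 sN hN.
have pN' : psd N by split=> // y; rewrite (le_trans _ (hN y)) // mulr_ge0 ?dotv_ge0 ?ltW.
have sa : 0 < Num.sqrt a by rewrite sqrtr_gt0.
rewrite -ler_sqr ?nnegrE ?divr_ge0 ?Mnorm_ge0 ?sqrtr_ge0 //.
rewrite exprMn exprVn (sqr_sqrtr (ltW a0)) !sqr_Mnorm // ler_pdivlMr //.
set y := invmx M *m x; set z := invmx N *m x.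
have xy : dotv x y = dotv y (M *m y) by rewrite mulKVmx // dotvC.
have [y0|yn0] := eqVneq y 0.
  by rewrite y0 dotv0r mul0r; case: pN => _; apply.
have yp : 0 < dotv y y by rewrite lt_neqAle dotv_ge0 eq_sym dotv_eq0 yn0.
have xyp : 0 < dotv x y by rewrite xy (lt_le_trans _ (hM' y)) // mulr_gt0.
have zy : dotv z (N *m y) = dotv x y.
  by rewrite (psd_sym _ _ pN') mulKVmx // dotvC.
have := psd_cauchy_schwarz z y pN'; rewrite zy.
have -> : dotv z (N *m z) = dotv x z by rewrite mulKVmx // dotvC.
move=> h; rewrite -(ler_pM2r xyp).
have xz0 : 0 <= dotv x z by case: pN => _; apply.
have h2 := hM y; rewrite -xy in h2.
have h3 := ler_wpM2l xz0 h2.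
rewrite mulrAC -expr2; apply: le_trans (ler_wpM2r (ltW a0) h) _.
by apply: le_trans h3; rewrite -mulrA (mulrC _ a).
Qed.

Lemma Mnorm_inv_vnorm M c x : 0 < c -> M^T = M ->
  (forall x, c * dotv x x <= dotv x (M *m x)) ->
  Mnorm (invmx M) x <= vnorm x / Num.sqrt c.
Proof.
move=> c0 sM h.
have := @Mnorm_inv_le M 1%:M c 1 x c0 ltr01 sM (trmx1 _ _).
rewrite invmx1 {2}/Mnorm mulmx1 -dotvE; apply.
  by move=> y; rewrite mul1r mul1mx.
by move=> y; rewrite mul1mx.
Qed.

(** Converts the Euclidean estimate of the case K = 1 into the norm of the final bound. *)
Lemma Mnorm_inv_ge_vnorm M c x : 0 < c -> M^T = M ->
  (forall x, c * dotv x x <= dotv x (M *m x)) ->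
  (forall x, dotv x (M *m x) <= dotv x x) ->
  vnorm x <= Mnorm (invmx M) x.
Proof.
move=> c0 sM h h1.
have := @Mnorm_inv_le 1%:M M 1 c x ltr01 c0 (trmx1 _ _) sM h.
rewrite invmx1 {1}/Mnorm mulmx1 -dotvE sqrtr1 divr1; apply.
by move=> y; rewrite mul1r mul1mx.
Qed.

Lemma vnorm_mulmx_opnorm M x : vnorm (M *m x) <= opnorm M * vnorm x.
Proof.
have [->|xn0] := eqVneq x 0.
  by rewrite mulmx0 /vnorm dotv0r sqrtr0 mulr0.
have vp : 0 < vnorm x.
  by rewrite sqrtr_gt0 lt_neqAle dotv_ge0 eq_sym dotv_eq0 xn0.
have -> : vnorm (M *m x) = vnorm (M *m ((vnorm x)^-1 *: x)) * vnorm x.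
  by rewrite -scalemxAr vnormZ ger0_norm ?invr_ge0 ?vnorm_ge0 // mulrAC mulVf ?mul1r // gt_eqF.
rewrite ler_pM2r //; apply: ub_le_sup.
  exists (frob M) => _ [y y1 <-]; apply: le_trans (vnorm_mulmx_frob _ _) _.
  by rewrite ler_piMr ?frob_ge0.
exists ((vnorm x)^-1 *: x) => //=.
by rewrite vnormZ ger0_norm ?invr_ge0 ?vnorm_ge0 // mulVf // gt_eqF.
Qed.

(** Both operator bounds are applied to e = M (M^-1 e). This is what gives C_{h,4} >= 1. *)
Lemma opnorm_condition M : (0 < d)%N -> M \in unitmx ->
  1 <= opnorm M * opnorm (invmx M).
Proof.
move=> d0 uM.
have [e e1] := exists_unit_vector d0.
have vp : 0 < vnorm e by rewrite /vnorm e1 sqrtr1.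
have h2 := vnorm_mulmx_opnorm M (invmx M *m e).
have h3 := vnorm_mulmx_opnorm (invmx M) e.
rewrite mulKVmx // in h2.
have o0 : 0 <= opnorm M.
  have h4 := vnorm_mulmx_opnorm M e.
  by rewrite -(pmulr_lge0 _ vp) (le_trans _ h4) ?vnorm_ge0.
rewrite -(ler_pM2r vp) mul1r; apply: le_trans h2 _.
by rewrite -mulrA ler_wpM2l.
Qed.

Lemma quad_outer v x : dotv x ((v *m v^T) *m x) = dotv v x ^+ 2.
Proof.
rewrite -mulmxA dotvE mulmxA mxE big_ord1 -!dotvE expr2.
by congr (_ * _); exact: dotvC.
Qed.

End LinearAlgebra.

(** * Kernels, mixtures and independent arrays *)

Section Mixtures.
Local Open Scope ereal_scope.

Section pushforward.
Context d1 d2 (X : measurableType d1) (Y : measurableType d2) (R : realType).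
Variables (m : {measure set X -> \bar R}) (f : X -> Y).
Hypothesis mf : measurable_fun setT f.

Lemma exists_pushforward :
  exists m' : {measure set Y -> \bar R}, forall B, m' B = m (f @^-1` B).
Proof. by eexists (pushforward m f : {measure set Y -> \bar R}). Unshelve. exact: mf. Qed.

End pushforward.

Section constant_kernel.
Context d (X : measurableType d) (R : realType).
Variables (m : {measure set X -> \bar R}).
Hypothesis m1 : m setT = 1.

(** A measure as a kernel from a point, so that mixtures become compositions of kernels. *)
Definition constk (_ : unit) : {measure set X -> \bar R} := m.

Let mconstk U : measurable U -> measurable_fun [set: unit] (constk ^~ U).
Proof. by move=> _; exact: measurable_cst. Qed.

HB.instance Definition _ := isKernel.Build _ _ _ _ _ constk mconstk.

Let constk1 u : constk u setT = 1. Proof. exact: m1. Qed.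

HB.instance Definition _ := Kernel_isProbability.Build _ _ _ _ _ constk constk1.

Definition pconstk : R.-pker unit ~> X := constk.

End constant_kernel.

Section reindexed_kernel.
Context d1 d2 d3 (W : measurableType d1) (X : measurableType d2)
  (Y : measurableType d3) (R : realType).
Variables (k : R.-pker X ~> Y) (g : W -> X).
Hypothesis mg : measurable_fun [set: W] g.

Definition reindexk (w : W) : {measure set Y -> \bar R} := k (g w).

Let mreindexk U : measurable U -> measurable_fun [set: W] (reindexk ^~ U).
Proof. by move=> mU; exact: measurableT_comp (measurable_kernel k _ mU) mg. Qed.

HB.instance Definition _ := isKernel.Build _ _ _ _ _ reindexk mreindexk.

Let reindexk1 w : reindexk w setT = 1. Proof. exact: prob_kernel. Qed.

HB.instance Definition _ :=
  Kernel_isProbability.Build _ _ _ _ _ reindexk reindexk1.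

Definition preindexk : R.-pker W ~> Y := reindexk.

End reindexed_kernel.

Section graph_kernel.
Context d1 d2 d3 (W : measurableType d1)
  (V : measurableType d2) (Y : measurableType d3) (R : realType).
Variables (k : R.-pker W ~> Y) (f : W -> V).
Hypothesis mf : measurable_fun [set: W] f.

Let mpair w : measurable_fun [set: Y] (fun y : Y => (f w, y)).
Proof. by apply/measurable_fun_pairP; split; [exact: measurable_cst|exact: measurable_id]. Qed.

(** Law of the pair ([f w], y) with y drawn from [k w]: the input is kept as a coordinate, which
    later builds a full sample from its state-action pair. *)
Definition graphk (w : W) : {measure set (V * Y) -> \bar R}.
Proof. refine (pushforward (k w) (fun y : Y => (f w, y)) : {measure set (V * Y) -> \bar R}). exact: mpair. Defined.

Lemma graphkE w B : graphk w B = k w (xsection B (f w)).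
Proof. by rewrite /graphk /pushforward /=; congr (k _ _); apply/seteqP; split=> y /=; rewrite /xsection /= inE. Qed.

Let mgraphk U : measurable U -> measurable_fun [set: W] (graphk ^~ U).
Proof.
move=> mU; have mfst : measurable_fun [set: W * Y] (fun z => (f z.1, z.2)).
  by apply/measurable_fun_pairP; split; [exact: measurableT_comp mf measurable_fst|exact: measurable_snd].
have mU' : measurable ((fun z : W * Y => (f z.1, z.2)) @^-1` U).
  by rewrite -[X in measurable X]setTI; exact: mfst.
rewrite (_ : (fun w => _) = fun w => k w (xsection ((fun z : W * Y => (f z.1, z.2)) @^-1` U) w)).
  by apply: measurable_fun_xsection_finite_kernel; rewrite inE.
apply/funext => w; rewrite graphkE; congr (k _ _).
Qed.

HB.instance Definition _ := isKernel.Build _ _ _ _ _ graphk mgraphk.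

Let graphk1 w : graphk w setT = 1.
Proof.
rewrite graphkE -(@prob_kernel _ _ _ _ _ k w); congr (k w _).
by apply/seteqP; split=> y //= _; rewrite /xsection /= inE.
Qed.

HB.instance Definition _ :=
  Kernel_isProbability.Build _ _ _ _ _ graphk graphk1.

Definition pgraphk : R.-pker W ~> (V * Y)%type := graphk.

Lemma integral_pgraphk w (F : V * Y -> \bar R) : measurable_fun setT F ->
  (forall z, 0 <= F z) -> \int[pgraphk w]_z F z = \int[k w]_y F (f w, y).
Proof.
move=> mF F0; rewrite /pgraphk /= /graphk /=.
by rewrite ge0_integral_pushforward.
Qed.

End graph_kernel.

Section composed_kernel.
Context d1 d2 d3 (X : measurableType d1) (Y : measurableType d2)
  (Z : measurableType d3) (R : realType).
Variables (k1 : R.-pker X ~> Y) (k2 : R.-pker Y ~> Z).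

Let k2' : R.-pker (X * Y)%type ~> Z := preindexk k2 (@measurable_snd _ _ X Y).

Definition compk : X -> {measure set Z -> \bar R} := mkcomp k1 k2'.

Let mcompk U : measurable U -> measurable_fun [set: X] (compk ^~ U).
Proof. by move=> mU; exact: measurable_fun_mkcomp_sfinite. Qed.

HB.instance Definition _ := isKernel.Build _ _ _ _ _ compk mcompk.

Let compk1 x : compk x setT = 1.
Proof.
rewrite /compk /= /kcomp (eq_integral (cst 1)); last by move=> y _; rewrite prob_kernel.
by rewrite integral_cst // mul1e prob_kernel.
Qed.

HB.instance Definition _ :=
  Kernel_isProbability.Build _ _ _ _ _ compk compk1.

Definition pcompk : R.-pker X ~> Z := compk.

Lemma integral_pcompk x (F : Z -> \bar R) : measurable_fun setT F ->
  (forall z, 0 <= F z) -> \int[pcompk x]_z F z = \int[k1 x]_y \int[k2 y]_z F z.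
Proof. by move=> mF F0; rewrite integral_kcomp. Qed.

End composed_kernel.

Section mixture.
Context d1 d2 (X : measurableType d1) (Y : measurableType d2) (R : realType).
Variables (mu : {measure set X -> \bar R}) (k : R.-pker X ~> Y).
Hypothesis mu1 : mu setT = 1.

Let k2 : R.-pker (unit * X) ~> Y := preindexk k (@measurable_snd _ _ unit X).

Lemma exists_mixture :
  exists m : {measure set Y -> \bar R}, (forall B, m B = \int[mu]_x k x B) /\
  (forall F : Y -> \bar R, measurable_fun setT F -> (forall y, 0 <= F y) ->
    \int[m]_y F y = \int[mu]_x \int[k x]_y F y).
Proof.
exists (kcomp (pconstk mu1) k2 tt); split=> [//|F mF F0].
by rewrite integral_kcomp.
Qed.

Lemma integral_mixture (m : {measure set Y -> \bar R}) (F : Y -> \bar R) :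
  (forall B, measurable B -> m B = \int[mu]_x k x B) ->
  measurable_fun setT F -> (forall y, 0 <= F y) ->
  \int[m]_y F y = \int[mu]_x \int[k x]_y F y.
Proof.
move=> mE mF F0; have [m' [m'E m'F]] := exists_mixture.
rewrite -m'F //; apply: eq_measure_integral => B mB _.
by rewrite mE // m'E.
Qed.

End mixture.

End Mixtures.

Lemma eq_measure_rectangle d1 d2 (X : measurableType d1) (Y : measurableType d2)
    (R : realType) (m m' : {measure set (X * Y) -> \bar R}) :
  (m setT < +oo)%E ->
  (forall A B, measurable A -> measurable B -> m (A `*` B) = m' (A `*` B)) ->
  forall U, measurable U -> m U = m' U.
Proof.
move=> m1 mm' U mU.
apply: (@measure_unique _ R _ [set A `*` B | A in measurable & B in measurable] (fun=> setT)) => //.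
- by rewrite measurable_prod_measurableType.
- move=> _ _ [A mA [B mB <-]] [A' mA' [B' mB' <-]].
  by rewrite -setXI; exists (A `&` A'); [exact: measurableI|exists (B `&` B') => //; exact: measurableI].
- by move=> _; exists setT => //; exists setT => //; rewrite setXTT.
- by apply/seteqP; split=> // x _; exists 0%N.
- by move=> _ [A mA [B mB <-]]; exact: mm'.
Qed.

Section Arrays.
Context d (T : measurableType d) (I : finType).

(** Boxes generate the product sigma-algebra and form a pi-system, so a law on arrays is determined
    by its values on them. *)
Definition boxes : set (set (I -> T)) :=
  [set U | exists2 B : I -> set T, (forall i, measurable (B i)) &
                                   U = [set x | forall i, B i (x i)]].

Definition arrays : measurableType _ := g_sigma_algebraType boxes.

Definition upd (x : I -> T) (t : I) (z : T) : I -> T :=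
  fun s => if s == t then z else x s.

Lemma boxes_setI : setI_closed boxes.
Proof.
move=> _ _ [B mB ->] [B' mB' ->]; exists (fun i => B i `&` B' i).
  by move=> i; exact: measurableI.
apply/seteqP; split=> x /=; first by move=> [h h'] i; split.
by move=> h; split=> i; case: (h i).
Qed.

Lemma boxes_setT : boxes setT.
Proof. by exists (fun=> setT) => //; apply/seteqP; split. Qed.

Lemma measurable_coord (i : I) : measurable_fun [set: arrays] (fun x : arrays => x i : T).
Proof.
move=> _ B mB; rewrite setTI; apply: sub_sigma_algebra.
exists (fun j => if j == i then B else setT) => [j|]; first by case: ifP.
apply/seteqP; split=> x /= => [h j|/(_ i)]; last by rewrite eqxx.
by case: eqP => [->|].
Qed.

Lemma measurable_arrays d' (Z : measurableType d') (Y : Z -> I -> T) :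
  (forall i, measurable_fun [set: Z] (Y ^~ i)) -> measurable_fun [set: Z] (Y : Z -> arrays).
Proof.
move=> mY; apply: (@measurability _ _ _ arrays _ _ boxes) => // _ [_ [B mB ->] <-].
rewrite setTI (_ : _ @^-1` _ = \bigcap_(i in [set: I]) (Y ^~ i @^-1` B i)).
  apply: fin_bigcap_measurable => [|i _]; first exact: finite_finset.
  by rewrite -[X in measurable X]setTI; exact: mY.
by apply/seteqP; split=> x /= h i; [move=> _; exact: h|exact: (h i Logic.I)].
Qed.

Lemma measurable_upd d' (Z : measurableType d') (Y : Z -> I -> T) (g : Z -> T) t :
  (forall i, measurable_fun [set: Z] (Y ^~ i)) -> measurable_fun [set: Z] g ->
  measurable_fun [set: Z] ((fun z => upd (Y z) t (g z)) : Z -> arrays).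
Proof.
move=> mY mg; apply: measurable_arrays => i; rewrite /upd.
by case: eqP.
Qed.

End Arrays.
Arguments arrays {d} T I.

Section Independence.
Local Open Scope ereal_scope.
Context d dO (T : measurableType d) (Omega : measurableType dO) (I : finType) (R : realType).
Variables (Pr : probability Omega R) (X : I -> Omega -> T).
Hypothesis mX : forall i, measurable_fun [set: Omega] (X i).
Hypothesis indX : mutual_indep Pr X.

Let sample (w : Omega) : arrays T I := X ^~ w.

Let msample : measurable_fun [set: Omega] sample.
Proof. exact: measurable_arrays. Qed.

Let resample t (ww : Omega * Omega) : arrays T I :=
  upd (sample ww.1) t (X t ww.2).

Let mresample t : measurable_fun [set: Omega * Omega] (resample t).
Proof.
apply: measurable_upd => [i|]; last exact: measurableT_comp (mX t) measurable_snd.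
exact: measurableT_comp (mX i) measurable_fst.
Qed.

Let mpre i B : measurable B -> measurable (X i @^-1` B).
Proof. by move=> mB; rewrite -[X in measurable X]setTI; exact: mX. Qed.

Let mbig (B : I -> set T) : (forall i, measurable (B i)) ->
  measurable (\bigcap_(i in [set: I]) (X i @^-1` B i)).
Proof.
move=> mB; apply: fin_bigcap_measurable => [|i _]; first exact: finite_finset.
exact: mpre.
Qed.

Let finP (U : set Omega) : measurable U -> Pr U = (fine (Pr U))%:E.
Proof. by move=> mU; rewrite fineK // fin_num_measure. Qed.

(** Redrawing one coordinate from an independent copy leaves the joint law unchanged: by
    independence both laws agree on boxes. *)
Lemma integral_resample t (F : arrays T I -> \bar R) :
  measurable_fun [set: arrays T I] F -> (forall x, 0 <= F x) ->
  \int[Pr]_w F (sample w) = \int[Pr]_w \int[Pr]_w' F (upd (sample w) t (X t w')).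
Proof.
move=> mF F0.
have [m1 m1E] := exists_pushforward Pr msample.
have [m2 m2E] := exists_pushforward (Pr \x Pr) (mresample t).
transitivity (\int[m1]_x F x).
  transitivity (\int[pushforward Pr sample]_x F x); first by rewrite ge0_integral_pushforward.
  by apply: eq_measure_integral => A mA _; rewrite m1E.
transitivity (\int[m2]_x F x).
  apply: eq_measure_integral => A mA _.
  apply: (@measure_unique _ R (arrays T I) (@boxes _ T I) (fun=> setT)) => //.
  - exact: boxes_setI.
  - by move=> _; exact: boxes_setT.
  - by apply/seteqP; split=> // x _; exists 0%N.
  - move=> _ [B mB ->]; rewrite m1E m2E.
    have -> : sample @^-1` [set x | forall i, B i (x i)] =
        \bigcap_(i in [set: I]) (X i @^-1` B i).
      by apply/seteqP; split=> w /= h i; [move=> _; exact: h|exact: (h i Logic.I)].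
    (* Independence is stated for all indices at once; the full set at t yields the joint
       probability of the other coordinates. *)
    pose B' i := if i == t then setT else B i.
    have mB' i : measurable (B' i) by rewrite /B'; case: ifP.
    have -> : resample t @^-1` [set x | forall i, B i (x i)] =
        (\bigcap_(i in [set: I]) (X i @^-1` B' i)) `*` (X t @^-1` B t).
      apply/seteqP; split=> -[w w'] /=; rewrite /resample /upd /B' /=.
        by move=> h; split=> [i _|]; [have := h i; rewrite /preimage /=; case: ifP | have := h t; rewrite eqxx].
      by move=> [h h'] i; have := h i Logic.I; case: eqP => [->|].
    have key : Pr (\bigcap_(i in [set: I]) (X i @^-1` B i)) =
        Pr (\bigcap_(i in [set: I]) (X i @^-1` B' i)) * Pr (X t @^-1` B t).
      rewrite (finP (mbig mB)) (finP (mbig mB')) (finP (mpre _ (mB t))) !indX //.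
      rewrite -EFinM (bigD1 t) //= [in RHS](bigD1 t) //= [in RHS]mulrAC; congr (_%:E).
      rewrite /B' eqxx preimage_setT probability_setT mul1r; congr (_ * _)%R.
      by apply: eq_bigr => i /negbTE ->.
    by apply: etrans key _; apply/esym/product_measure1E; [exact: mbig|exact: mpre].
  - by move=> _; rewrite m1E preimage_setT; apply: (le_lt_trans (probability_le1 Pr measurableT)); exact: ltry.
transitivity (\int[pushforward (Pr \x Pr) (resample t)]_x F x).
  by apply: eq_measure_integral => A mA _; rewrite m2E.
rewrite ge0_integral_pushforward // preimage_setT fubini_tonelli1 //.
  exact: measurableT_comp.
by move=> x; exact: F0.
Qed.

(* [y t] may depend on the samples other than [t] only through [rho]; integrating
   the samples out one at a time, a conditional exponential moment bound at each
   of them suffices, without any filtration. *)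
Section tail.
Variables (rhoT : Type) (rho : T -> rhoT).
Variable y : I -> arrays T I -> R.
Hypothesis my : forall t, measurable_fun setT (y t).
Variable J : {pred I}.
Hypothesis y_pred : forall s t x z z', s \in J -> t \in J -> s != t -> rho z = rho z' ->
  y s (upd x t z) = y s (upd x t z').
Hypothesis y_mgf : forall t x (G : T -> \bar R), t \in J -> measurable_fun setT G ->
  (forall z, 0 <= G z) -> (forall z z', rho z = rho z' -> G z = G z') ->
  \int[Pr]_w ((expR (y t (upd x t (X t w))))%:E * G (X t w)) <= \int[Pr]_w G (X t w).

Lemma integral_exp_sum (ts : seq I) : uniq ts -> {subset ts <= J} ->
  \int[Pr]_w (expR (\sum_(t <- ts) y t (sample w)))%:E <= 1.
Proof.
elim: ts => [_ _|t ts IH /= /andP[tts uts] tsJ].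
  under eq_integral do rewrite big_nil expR0.
  by rewrite integral_cst // mul1e probability_le1.
have mS us : measurable_fun [set: arrays T I] (fun x => (expR (\sum_(s <- us) y s x))%:E).
  apply/measurable_EFinP; apply: measurableT_comp => //.
  by apply: measurable_sum => s; exact: my.
have tsJ' : {subset ts <= J} by move=> s sts; apply: tsJ; rewrite in_cons sts orbT.
apply: le_trans (IH uts tsJ').
(* Both sides are resampled at t: the sum over [ts] becomes a function G of the redrawn sample that
   depends on it only through [rho], as [y_mgf] requires. *)
rewrite (integral_resample t (mS (t :: ts))); last by move=> x; rewrite lee_fin expR_ge0.
rewrite (integral_resample t (mS ts)); last by move=> x; rewrite lee_fin expR_ge0.
have mR us : measurable_fun [set: Omega * Omega]
    (fun ww => (expR (\sum_(s <- us) y s (upd (sample ww.1) t (X t ww.2))))%:E).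
  exact: measurableT_comp (mS us) (mresample t).
apply: ge0_le_integral => //.
- by move=> w _; apply: integral_ge0 => w' _; rewrite lee_fin expR_ge0.
- by apply: (measurable_fun_fubini_tonelli_F _ (mR (t :: ts))) => ww; rewrite lee_fin expR_ge0.
- by apply: (measurable_fun_fubini_tonelli_F _ (mR ts)) => ww; rewrite lee_fin expR_ge0.
- move=> w _.
  under eq_integral do rewrite big_cons expRD EFinM.
  apply: (@y_mgf t (sample w) (fun z => (expR (\sum_(s <- ts) y s (upd (sample w) t z)))%:E)).
  + by apply: tsJ; rewrite mem_head.
  + apply: (measurableT_comp (mS ts)); apply: measurable_upd => //.
  + by move=> z; rewrite lee_fin expR_ge0.
  + move=> z z' zz'; congr ((expR _)%:E); rewrite !big_seq; apply: eq_bigr => s sts.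
    by apply: y_pred => //; [exact: tsJ'|by apply: tsJ; rewrite mem_head|apply: contraNneq tts => <-].
Qed.

(** Markov's inequality for the exponential; the scale parameter is already part of y. *)
Lemma exp_sum_tail (ts : seq I) (l : R) : uniq ts -> {subset ts <= J} ->
  Pr [set w | (l <= \sum_(t <- ts) y t (sample w))%R] <= (expR (- l))%:E.
Proof.
move=> uts tsJ; set U := [set w | _].
have mS : measurable_fun [set: Omega] (fun w => \sum_(t <- ts) y t (sample w))%R.
  by apply: measurable_sum => s; exact: measurableT_comp (my s) msample.
have mU : measurable U.
  rewrite -[U]setTI; rewrite /U -[X in _ `&` X]/((fun w => \sum_(t <- ts) y t (sample w))%R @^-1` [set r | (l <= r)%R]).
  by rewrite -set_itvcy; exact: mS.
have mE : measurable_fun [set: Omega] (fun w => (expR (\sum_(t <- ts) y t (sample w)))%:E).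
  by apply/measurable_EFinP; exact: measurableT_comp.
have h : (expR l)%:E * Pr U <= 1.
  apply: le_trans (integral_exp_sum uts tsJ).
  rewrite -integral_cst //; apply: (@le_trans _ _ (\int[Pr]_(w in U) (expR (\sum_(t <- ts) y t (sample w)))%:E)).
    apply: ge0_le_integral => //.
    + by move=> w _; rewrite lee_fin expR_ge0.
    + exact: measurable_funTS.
    + by move=> w; rewrite /U /= => hw; rewrite lee_fin ler_expR.
  by apply: ge0_subset_integral => // w _; rewrite lee_fin expR_ge0.
rewrite expRN -[leRHS]mule1 -lee_pdivrMl.
  by rewrite invrK.
by rewrite invr_gt0 expR_gt0.
Qed.

End tail.
End Independence.

(** * Bounded measurable functions and exponential moments *)

Section BoundedMeasurable.
Context d (X : measurableType d) (R : realType).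
Implicit Types f g : X -> R.

Definition bmf f := measurable_fun setT f /\ exists M, forall x, `|f x| <= M.

Lemma bmf_cst c : bmf (fun=> c).
Proof. by split=> //; exists `|c|. Qed.

Lemma bmfD f g : bmf f -> bmf g -> bmf (fun x => f x + g x).
Proof.
move=> [mf [M hM]] [mg [N hN]]; split; first exact: measurable_funD.
by exists (M + N) => x; rewrite (le_trans (ler_normD _ _)) // lerD.
Qed.

Lemma bmfM f g : bmf f -> bmf g -> bmf (fun x => f x * g x).
Proof.
move=> [mf [M hM]] [mg [N hN]]; split; first exact: measurable_funM.
by exists (M * N) => x; rewrite normrM ler_pM.
Qed.

Lemma bmfZ c f : bmf f -> bmf (fun x => c * f x).
Proof. by move=> hf; apply: bmfM => //; exact: bmf_cst. Qed.

Lemma bmfB f g : bmf f -> bmf g -> bmf (fun x => f x - g x).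
Proof.
move=> [mf [M hM]] [mg [N hN]]; split; first exact: measurable_funB.
by exists (M + N) => x; rewrite (le_trans (ler_normB _ _)) // lerD.
Qed.

Lemma bmfX f n : bmf f -> bmf (fun x => f x ^+ n).
Proof.
move=> bf; elim: n => [|n IH]; first by under eq_fun do rewrite expr0; exact: bmf_cst.
by under eq_fun do rewrite exprS; exact: bmfM.
Qed.

Lemma bmf_sum (I : Type) (r : seq I) (F : I -> X -> R) :
  (forall i, bmf (F i)) -> bmf (fun x => \sum_(i <- r) F i x).
Proof.
move=> h; elim: r => [|i r IH]; first by under eq_fun do rewrite big_nil; exact: bmf_cst.
by under eq_fun do rewrite big_cons; exact: bmfD.
Qed.

Variable m : {measure set X -> \bar R}.

Lemma bmf_integrable_fin f : (m setT < +oo)%E -> bmf f -> m.-integrable setT (EFin \o f).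
Proof.
move=> mfin [mf [M hM]]; apply/integrableP; split; first exact/measurable_EFinP.
apply: (@le_lt_trans _ _ (\int[m]_x (cst M%:E x))%E).
  apply: ge0_le_integral => //=.
  - by apply/measurable_EFinP; exact: measurableT_comp.
  - by move=> x _; rewrite lee_fin.
have mE : m setT = (fine (m setT))%:E by rewrite fineK // ge0_fin_numE.
by rewrite integral_cst //= mE -EFinM ltry.
Qed.

Hypothesis m1 : m setT = 1%E.

Lemma bmf_integrable f : bmf f -> m.-integrable setT (EFin \o f).
Proof. by apply: bmf_integrable_fin; rewrite m1 ltry. Qed.

Lemma bmf_integralE f : bmf f -> (\int[m]_x (f x)%:E)%E = (Rintegral m setT f)%:E.
Proof. by move=> bf; rewrite /Rintegral fineK // integrable_fin_num //; exact: bmf_integrable. Qed.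

Lemma Rintegral_const c : Rintegral m setT (fun=> c) = c.
Proof. by rewrite Rintegral_cst // m1 mulr1. Qed.

Lemma bmf_RintegralD f g : bmf f -> bmf g ->
  Rintegral m setT (fun x => f x + g x) = Rintegral m setT f + Rintegral m setT g.
Proof. by move=> bf bg; rewrite RintegralD //; exact: bmf_integrable. Qed.

Lemma bmf_RintegralB f g : bmf f -> bmf g ->
  Rintegral m setT (fun x => f x - g x) = Rintegral m setT f - Rintegral m setT g.
Proof. by move=> bf bg; rewrite RintegralB //; exact: bmf_integrable. Qed.

Lemma bmf_RintegralZ c f : bmf f ->
  Rintegral m setT (fun x => c * f x) = c * Rintegral m setT f.
Proof. by move=> bf; rewrite RintegralZl //; exact: bmf_integrable. Qed.

Lemma bmf_Rintegral_sum (I : Type) (r : seq I) (F : I -> X -> R) :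
  (forall i, bmf (F i)) ->
  Rintegral m setT (fun x => \sum_(i <- r) F i x) = \sum_(i <- r) Rintegral m setT (F i).
Proof.
move=> h; elim: r => [|i r IH].
  by under eq_Rintegral do rewrite big_nil; rewrite Rintegral_const big_nil.
under eq_Rintegral do rewrite big_cons.
by rewrite bmf_RintegralD ?IH ?big_cons //; exact: bmf_sum.
Qed.

Lemma bmf_le_Rintegral f g : bmf f -> bmf g -> (forall x, f x <= g x) ->
  Rintegral m setT f <= Rintegral m setT g.
Proof. by move=> bf bg h; apply: le_Rintegral => //; exact: bmf_integrable. Qed.

Lemma bmf_Rintegral_bounds f a b : bmf f -> (forall x, a <= f x <= b) ->
  a <= Rintegral m setT f <= b.
Proof.
move=> bf h; rewrite -{1}(Rintegral_const a) -{1}(Rintegral_const b).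
by apply/andP; split; apply: bmf_le_Rintegral => //; try exact: bmf_cst;
  move=> x; case/andP: (h x).
Qed.

Lemma bmf_norm_Rintegral f M : bmf f -> (forall x, `|f x| <= M) ->
  `|Rintegral m setT f| <= M.
Proof.
by move=> bf h; rewrite ler_norml; apply: bmf_Rintegral_bounds => // x; rewrite -ler_norml.
Qed.

Lemma Rintegral_variance f a : bmf f ->
  Rintegral m setT (fun x => (f x - a) ^+ 2) =
  Rintegral m setT (fun x => f x ^+ 2) - 2 * a * Rintegral m setT f + a ^+ 2.
Proof.
move=> bf; have b1 : bmf (fun x => (- (2 * a)) * f x) by exact: bmfZ.
have b2 : bmf (fun x => f x ^+ 2) by exact: bmfX.
have b3 : bmf (fun x => f x ^+ 2 + (- (2 * a)) * f x) by exact: bmfD.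
rewrite (_ : (fun x => (f x - a) ^+ 2) =
  (fun x => f x ^+ 2 + (- (2 * a)) * f x + a ^+ 2)); last by apply/funext => x; ring.
rewrite bmf_RintegralD //; last exact: bmf_cst.
by rewrite bmf_RintegralD // bmf_RintegralZ // Rintegral_const mulNr.
Qed.

Lemma sqr_Rintegral_le f : bmf f ->
  Rintegral m setT f ^+ 2 <= Rintegral m setT (fun x => f x ^+ 2).
Proof.
move=> bf; have : 0 <= Rintegral m setT (fun x => (f x - Rintegral m setT f) ^+ 2).
  by apply: Rintegral_ge0 => x _; rewrite sqr_ge0.
by rewrite Rintegral_variance //; lra.
Qed.

End BoundedMeasurable.

Section MGF.
Context d (X : measurableType d) (R : realType).
Variable m : {measure set X -> \bar R}.
Hypothesis m1 : m setT = 1%E.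

(* [exp (- x / 2) >= 1 - x / 2], squared and inverted. *)
Lemma expR_le_quadratic (x : R) : x <= 1 -> expR x <= 1 + x + 2 * x ^+ 2.
Proof.
move=> x1.
have h1 : (1 - x / 2) ^+ 2 <= expR (- x).
  have -> : - x = - (x / 2) * 2%:R by field.
  rewrite expRM_natr ler_sqr ?nnegrE ?expR_ge0 //; first by exact: expR_ge1Dx.
  lra.
have p : 0 < (1 - x / 2) ^+ 2 by rewrite exprn_gt0 //; lra.
rewrite -[expR x]invrK -expRN; apply: le_trans (_ : ((1 - x / 2) ^+ 2)^-1 <= _).
  by rewrite lef_pV2 // posrE expR_gt0.
rewrite -[leLHS]mul1r ler_pdivrMr //.
have : 0 <= x ^+ 2 * ((1 - x) * (5 / 2 - x)) by rewrite mulr_ge0 ?sqr_ge0 ?mulr_ge0 //; lra.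
lra.
Qed.

(** Integrating the quadratic bound leaves 1 + 2 v, which is at most exp (2 v). *)
Lemma mgf_bounded (Y : X -> R) (v : R) : measurable_fun setT Y ->
  (forall x, `|Y x| <= 1) -> Rintegral m setT Y = 0 ->
  Rintegral m setT (fun x => Y x ^+ 2) <= v ->
  (\int[m]_x (expR (Y x))%:E <= (expR (2 * v))%:E)%E.
Proof.
move=> mY Y1 Y0 Yv; have bY : bmf Y by split=> //; exists 1.
have bY2 := bmfX 2 bY.
have bq : bmf (fun x => 1 + Y x + 2 * Y x ^+ 2).
  by apply: bmfD; [apply: bmfD => //; exact: bmf_cst|exact: bmfZ].
apply: (@le_trans _ _ (\int[m]_x (1 + Y x + 2 * Y x ^+ 2)%:E)%E).
  apply: ge0_le_integral => //.
  - by apply/measurable_EFinP; exact: measurableT_comp.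
  - by apply/measurable_EFinP; case: bq.
  - by move=> x _; rewrite lee_fin expR_le_quadratic // (le_trans (ler_norm _)).
rewrite (bmf_integralE m1 bq) lee_fin.
rewrite bmf_RintegralD //; [|by apply: bmfD => //; exact: bmf_cst|exact: bmfZ].
rewrite bmf_RintegralD //; last exact: bmf_cst.
rewrite Rintegral_const // Y0 addr0 bmf_RintegralZ //.
by apply: le_trans (expR_ge1Dx _); rewrite lerD2l ler_pM2l.
Qed.

End MGF.

Lemma integral_mass1 d (X : measurableType d) (R : realType)
  (m : {measure set X -> \bar R}) (c : \bar R) : m setT = 1%E -> (\int[m]_x c = c)%E.
Proof. by move=> m1; rewrite integral_cst // m1 mule1. Qed.

(** * The law of one sample and its conditional exponential moments *)

Section SampleLaw.
Local Open Scope ereal_scope.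
Context dO dW dS (Omega : measurableType dO) (W : measurableType dW)
  (S : measurableType dS) (R : realType).
Variables (Pr : probability Omega R) (nu : {measure set W -> \bar R})
  (noise : probability R R) (P : R.-pker W ~> S) (Z : Omega -> (W * R) * S).
Hypothesis mZ : measurable_fun setT Z.
Hypothesis lawZ : forall B1 Be B2, measurable B1 -> measurable Be -> measurable B2 ->
  Pr (Z @^-1` [set z | B1 z.1.1 /\ Be z.1.2 /\ B2 z.2]) =
  (\int[nu]_(w in B1) P w B2) * noise Be.

(** Take the three sets full in the law of a sample: the mass of [nu] is read off the data. *)
Lemma law_mass1 : nu setT = 1.
Proof.
have := lawZ measurableT measurableT measurableT.
rewrite (_ : _ @^-1` _ = setT); last by apply/seteqP; split.
have -> : \int[nu]_w P w setT = nu setT.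
  by under eq_integral do rewrite prob_kernel; rewrite integral_cst // mul1e.
by rewrite !probability_setT mule1.
Qed.

Let knoise : R.-pker W ~> (W * R)%type :=
  pgraphk (preindexk (pconstk (probability_setT noise)) (@measurable_cst _ _ W _ setT tt))
          (@measurable_id _ W setT).

Let kstate : R.-pker (W * R)%type ~> ((W * R) * S)%type :=
  pgraphk (preindexk P (@measurable_fst _ _ W R)) (@measurable_id _ _ setT).

(** Conditional law of a sample given its state-action pair: noise and next state are drawn
    independently, and the pair is carried along. *)
Definition fiber : R.-pker W ~> ((W * R) * S)%type := pcompk knoise kstate.

Lemma integral_fiber w (F : (W * R) * S -> \bar R) : measurable_fun setT F ->
  (forall z, 0 <= F z) ->
  \int[fiber w]_z F z = \int[noise]_e \int[P w]_s F ((w, e), s).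
Proof.
move=> mF F0; rewrite integral_pcompk //.
rewrite integral_pgraphk //; last by move=> z; exact: integral_ge0.
  by apply: eq_integral => e _; rewrite integral_pgraphk.
apply: measurable_fun_integral_kernel => // U mU; exact: measurable_kernel.
Qed.

(** The product formula is known on boxes only. Uniqueness on rectangles is applied twice, first to
    split off the next state, then the noise. *)
Lemma law_fiber U : measurable U -> Pr (Z @^-1` U) = \int[nu]_w fiber w U.
Proof.
have [m1 m1E] := exists_pushforward Pr mZ.
have [m2 [m2E _]] := exists_mixture fiber law_mass1.
have fiberE w B1 Be B2 : measurable B1 -> measurable Be -> measurable B2 ->
    fiber w ((B1 `*` Be) `*` B2) = (\1_B1 w)%:E * (noise Be * P w B2).
  move=> mB1 mBe mB2; have mB := measurableX (measurableX mB1 mBe) mB2.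
  rewrite -[X in fiber w X](setIT _) -integral_indic // integral_fiber //; last first.
    by apply/measurable_EFinP; exact: measurable_indic.
  transitivity (\int[noise]_e (((\1_B1 w)%:E * P w B2) * (\1_Be e)%:E)).
    apply: eq_integral => e _.
    transitivity (\int[P w]_s ((\1_B1 w * \1_Be e)%:E * (\1_B2 s)%:E)).
      by apply: eq_integral => s _; rewrite -EFinM !indicE !in_setX /= -!natrM !mulnb.
    rewrite ge0_integralZl_EFin //; last by apply/measurable_EFinP; exact: measurable_indic.
    by rewrite integral_indic // setIT EFinM -!muleA; congr (_ * _); rewrite muleC.
  rewrite ge0_integralZl //.
    by rewrite integral_indic // setIT -muleA; congr (_ * _); rewrite muleC.
  by apply/measurable_EFinP; exact: measurable_indic.
suff h U' : measurable U' -> m1 U' = m2 U' by move=> mU; rewrite -m1E -m2E; exact: h.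
move: U'; apply: eq_measure_rectangle => [|A B2 mA mB2].
  by rewrite m1E preimage_setT; apply: (le_lt_trans (probability_le1 Pr measurableT)); exact: ltry.
have mTB := measurableX (@measurableT _ (W * R)%type) mB2.
(* For fixed B2, the measure of A x B2 as a function of A is a measure on pairs and noises, to which
   the rectangle argument applies again. *)
have [n1 n1E] := exists_pushforward (mrestr m1 mTB) (@measurable_fst _ _ (W * R)%type S).
have [n2 n2E] := exists_pushforward (mrestr m2 mTB) (@measurable_fst _ _ (W * R)%type S).
have restrE (m : set ((W * R) * S) -> \bar R) A' : mrestr m mTB (fst @^-1` A') = m (A' `*` B2).
  by rewrite /mrestr; congr (m _); apply/seteqP; split=> -[x s] /=; [move=> [? []]|move=> []].
have n1B A' : n1 A' = m1 (A' `*` B2) by rewrite n1E; exact: restrE.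
have n2B A' : n2 A' = m2 (A' `*` B2) by rewrite n2E; exact: restrE.
suff h A' : measurable A' -> n1 A' = n2 A' by rewrite -n1B -n2B; exact: h.
move: A' {A mA}; apply: eq_measure_rectangle => [|B1 Be mB1 mBe].
  rewrite n1B m1E; apply: (le_lt_trans (probability_le1 Pr _)); last exact: ltry.
  by rewrite -[X in measurable X]setTI; apply: mZ.
rewrite n1B n2B m1E m2E.
transitivity (Pr (Z @^-1` [set z | B1 z.1.1 /\ Be z.1.2 /\ B2 z.2])).
  by congr (Pr _); apply/seteqP; split=> w /=; [move=> [[? ?] ?]|move=> [? [? ?]]].
rewrite lawZ //; under [in RHS]eq_integral do rewrite fiberE //.
rewrite integral_mkcond muleC -ge0_integralZl //; last 2 first.
- by apply/(measurable_restrictT _ mB1).1/measurable_funTS; exact: measurable_kernel.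
- by move=> w _; rewrite patchE; case: ifP.
apply: eq_integral => w _; rewrite patchE indicE muleCA; congr (_ * _).
by case: ifP => _; rewrite ?mul1e ?mul0e.
Qed.

Lemma integral_law (F : (W * R) * S -> \bar R) : measurable_fun setT F ->
  (forall z, 0 <= F z) -> \int[Pr]_o F (Z o) = \int[nu]_w \int[fiber w]_z F z.
Proof.
move=> mF F0; have [m1 m1E] := exists_pushforward Pr mZ.
transitivity (\int[m1]_z F z).
  transitivity (\int[pushforward Pr Z]_x F x); first by rewrite ge0_integral_pushforward.
  by apply: eq_measure_integral => A mA _; rewrite m1E.
apply: integral_mixture => //; first exact: law_mass1.
by move=> B mB; rewrite m1E; exact: law_fiber.
Qed.

(** G is constant on the fibre over a state-action pair, so it leaves the inner integrals, and what
    remains there is at most 1. *)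
Lemma law_mgf (y : (W * R) * S -> R) (G : (W * R) * S -> \bar R) :
  measurable_fun setT y -> measurable_fun setT G -> (forall z, 0 <= G z) ->
  (forall w e s e' s', G ((w, e), s) = G ((w, e'), s')) ->
  (forall w, \int[noise]_e \int[P w]_s (expR (y ((w, e), s)))%:E <= 1) ->
  \int[Pr]_o ((expR (y (Z o)))%:E * G (Z o)) <= \int[Pr]_o G (Z o).
Proof.
move=> my mG G0 Gw h.
have mE : measurable_fun setT (fun z => (expR (y z))%:E).
  by apply/measurable_EFinP; exact: measurableT_comp.
have E0 z : 0 <= (expR (y z))%:E by rewrite lee_fin expR_ge0.
rewrite (integral_law (F := fun z => (expR (y z))%:E * G z)); last 2 first.
- exact: emeasurable_funM.
- by move=> z; exact: mule_ge0.
rewrite (integral_law mG) //.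
have mfib F : measurable_fun setT F -> (forall z, 0 <= F z) ->
    measurable_fun setT (fun w => \int[fiber w]_z F z).
  by move=> mF F0; apply: measurable_fun_integral_kernel => // U mU; exact: measurable_kernel.
apply: ge0_le_integral => //.
- by move=> w _; apply: integral_ge0 => z _; exact: mule_ge0.
- by apply: mfib; [exact: emeasurable_funM|move=> z; exact: mule_ge0].
- exact: mfib.
move=> w _; set g := G ((w, point), point).
have -> : \int[fiber w]_z G z = g.
  rewrite integral_fiber //.
  under eq_integral => e _.
    under eq_integral do rewrite (Gw _ _ _ point point) -/g.
    rewrite (integral_mass1 _ (@prob_kernel _ _ _ _ _ P w)); over.
  exact: (integral_mass1 _ (probability_setT noise)).
rewrite integral_fiber; last 2 first.
- exact: emeasurable_funM.
- by move=> z; exact: mule_ge0.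
have mEw e : measurable_fun setT (fun s : S => (expR (y ((w, e), s)))%:E).
  have mpair : measurable_fun setT (fun s : S => ((w, e), s)).
    by apply/measurable_fun_pairP; split; [exact: measurable_cst|exact: measurable_id].
  exact: (measurableT_comp mE mpair).
under eq_integral => e _.
  under eq_integral do rewrite (Gw _ _ _ point point) -/g muleC.
  rewrite ge0_integralZl //; last exact: G0.
  over.
rewrite /= ge0_integralZl //; first by rewrite -[leRHS]mule1 lee_wpmul2l // G0.
- have mswap : measurable_fun setT (fun es : R * S => ((w, es.1), es.2)).
    apply/measurable_fun_pairP; split; last exact: measurable_snd.
    by apply/measurable_fun_pairP; split; [exact: measurable_cst|exact: measurable_fst].
  apply: (measurable_fun_integral_finite_kernel
    (fun es : R * S => (expR (y ((w, es.1), es.2)))%:E)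
    (preindexk P (@measurable_cst _ _ R W setT w))).
    by move=> z; rewrite lee_fin expR_ge0.
  exact: (measurableT_comp mE mswap).
- by move=> e _; exact: integral_ge0.
- exact: G0.
Qed.

End SampleLaw.

(** * Clipping *)

Section Clip.
Variable R : realType.
Implicit Types a b x y : R.

Lemma clip_id a b x : a <= x <= b -> clip a b x = x.
Proof. by move=> /andP[ax xb]; rewrite /clip max_l // min_l. Qed.

Lemma clip_bounds a b x : a <= b -> a <= clip a b x <= b.
Proof. by move=> ab; rewrite /clip le_min ge_min le_max lexx orbT ab lexx orbT. Qed.

Lemma clip_lipschitz a b x y : `|clip a b x - clip a b y| <= `|x - y|.
Proof.
have h u v : `|Num.max u a - Num.max v a| <= `|u - v|.
  rewrite /Num.max; case: (ltP u a) => ua; case: (ltP v a) => va //.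
  - by rewrite subrr normr0.
  - by rewrite !ler0_norm; lra.
  - by rewrite !ger0_norm; lra.
have g u v : `|Num.min u b - Num.min v b| <= `|u - v|.
  rewrite /Num.min; case: (ltP u b) => ua; case: (ltP v b) => va //.
  - by rewrite !ler0_norm; lra.
  - by rewrite !ger0_norm; lra.
  - by rewrite subrr normr0.
exact: le_trans (g _ _) (h _ _).
Qed.

Lemma measurable_clip d (T : measurableType d) a b (f : T -> R) :
  measurable_fun setT f -> measurable_fun setT (fun x : T => clip a b (f x)).
Proof. by move=> mf; apply: measurable_minr => //; exact: measurable_maxr. Qed.

Lemma norm_clip a b x c : a <= b -> - c <= a -> b <= c -> `|clip a b x| <= c.
Proof.
move=> ab ca bc; have /andP[h1 h2] := clip_bounds x ab.
by rewrite ler_norml (le_trans ca h1) (le_trans h2 bc).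
Qed.

End Clip.

Lemma measurable_norm_gt1 (R : realType) : measurable [set e : R | 1 < `|e|].
Proof.
rewrite (_ : [set _ | _] = (fun e : R => `|e|) @^-1` `]1, +oo[); last first.
  by apply/seteqP; split=> e /=; rewrite in_itv /= andbT.
by rewrite -[X in measurable X]setTI; exact: normr_measurable.
Qed.

(** * Exponential moments of the noise and of the transitions *)

Section NoiseMGF.
Context dS (S : measurableType dS) (R : realType).
Variables (noise : probability R R).
Hypothesis noise_mean : (\int[noise]_e e%:E = 0)%E.
Hypothesis noise_bounded : noise [set e | 1 < `|e|] = 0%E.

(** The noise is bounded by 1 only almost surely; its clipped version is bounded everywhere and has
    the same integrals. *)
Let T1 (e : R) := clip (-1) 1 e.

Let mT1 : measurable_fun setT T1.
Proof. exact: measurable_clip. Qed.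

Let aeT1 (f : R -> \bar R) : ae_eq noise setT f (fun e => f (T1 e)).
Proof.
exists [set e | 1 < `|e|]; split => //.
  exact: measurable_norm_gt1.
move=> e /= h; rewrite ltNge; apply/negP => e1; apply: h => _.
by rewrite /T1 clip_id // -ler_norml.
Qed.

Lemma noise_mgf (b : R) : `|b| <= 1 ->
  (\int[noise]_e (expR (b * e))%:E <= (expR (2 * b ^+ 2))%:E)%E.
Proof.
move=> b1.
have mb : measurable_fun setT (fun e : R => b * T1 e) by exact: measurable_funM.
have T1b e : `|T1 e| <= 1 by apply: norm_clip; lra.
have Tb e : `|b * T1 e| <= `|b| by rewrite normrM ler_piMr.
have bT : bmf T1 by split=> //; exists 1.
have -> : (\int[noise]_e (expR (b * e))%:E = \int[noise]_e (expR (b * T1 e))%:E)%E.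
  apply: (ae_eq_integral (fun e => (expR (b * T1 e))%:E)) => //.
  - by apply/measurable_EFinP; apply: measurableT_comp => //; exact: measurable_funM.
  - by apply/measurable_EFinP; apply: measurableT_comp.
apply: mgf_bounded => //; first exact: probability_setT.
- by move=> e; rewrite (le_trans (Tb e)).
- rewrite bmf_RintegralZ //; last exact: probability_setT.
  have -> : Rintegral noise setT T1 = 0.
    rewrite /Rintegral (_ : \int[noise]_e (T1 e)%:E = 0)%E // -noise_mean; apply/esym.
    apply: (ae_eq_integral (fun e => (T1 e)%:E)) => //.
    exact/measurable_EFinP.
  by rewrite mulr0.
- have /andP[//] : 0 <= Rintegral noise setT (fun x => (b * T1 x) ^+ 2) <= b ^+ 2.
  apply: bmf_Rintegral_bounds; first exact: probability_setT.
    by apply/bmfX/bmfZ.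
  by move=> e; rewrite sqr_ge0 /= -(real_normK (num_real b)) -(real_normK (num_real (b * _))) ler_sqr ?nnegrE.
Qed.

Lemma centered_mgf (p : {measure set S -> \bar R}) (f : S -> R) (a v : R) :
  p setT = 1%E -> bmf f -> (forall s, `|a * (f s - Rintegral p setT f)| <= 1) ->
  Rintegral p setT (fun s => f s ^+ 2) - Rintegral p setT f ^+ 2 <= v ->
  (\int[p]_s (expR (a * (f s - Rintegral p setT f)))%:E <= (expR (2 * (a ^+ 2 * v)))%:E)%E.
Proof.
move=> p1 bf h hv; set mu := Rintegral p setT f in h hv *.
have bfm : bmf (fun s => f s - mu) by apply: bmfB => //; exact: bmf_cst.
apply: mgf_bounded => //; first by case: (bmfZ a bfm).
  by rewrite bmf_RintegralZ // bmf_RintegralB // ?Rintegral_const // ?subrr ?mulr0 //; exact: bmf_cst.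
under eq_Rintegral do rewrite exprMn.
rewrite bmf_RintegralZ //; last exact: bmfX.
rewrite ler_wpM2l ?sqr_ge0 // Rintegral_variance // -/mu.
by rewrite (le_trans _ hv) //; lra.
Qed.

(** Noise and next state are independent, so their exponential moments multiply, and the subtracted
    term pays for both. The factor c is later 0 or 1: the value 0 switches the reward noise off for
    the moment regressions. *)
Lemma sample_mgf (p : {measure set S -> \bar R}) (f : S -> R) (a c v : R) :
  p setT = 1%E -> bmf f -> (forall s, `|a * (f s - Rintegral p setT f)| <= 1) ->
  `|a * c| <= 1 ->
  Rintegral p setT (fun s => f s ^+ 2) - Rintegral p setT f ^+ 2 <= v ->
  (\int[noise]_e \int[p]_s
    (expR (a * (c * e + (f s - Rintegral p setT f)) - 2 * (a ^+ 2 * (c ^+ 2 + v))))%:E <= 1)%E.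
Proof.
move=> p1 bf h hc hv; set mu := Rintegral p setT f in h hv *.
have mfs : measurable_fun setT (fun s => (expR (a * (f s - mu)))%:E).
  apply/measurable_EFinP; apply: measurableT_comp => //.
  by apply: measurable_funM => //; apply: measurable_funB => //; case: bf.
have mne : measurable_fun setT (fun e : R => (expR (a * c * e))%:E).
  by apply/measurable_EFinP; apply: measurableT_comp => //; exact: measurable_funM.
apply: (@le_trans _ _ (\int[noise]_e ((expR (- (2 * (a * c) ^+ 2)))%:E * (expR (a * c * e))%:E))%E).
  apply: ge0_le_integral => //.
  - by move=> e _; apply: integral_ge0 => s _; rewrite lee_fin expR_ge0.
  - rewrite (_ : (fun e => _) = (fun e : R => (expR (a * c * e))%:E *
      ((expR (- (2 * (a ^+ 2 * (c ^+ 2 + v)))))%:E * \int[p]_s (expR (a * (f s - mu)))%:E))%E).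
      by apply: emeasurable_funM => //; exact: measurable_cst.
    apply/funext => e; rewrite muleA -EFinM -expRD -ge0_integralZl_EFin ?expR_ge0 //.
    apply: eq_integral => s _; rewrite -EFinM -expRD; congr ((expR _)%:E); ring.
  - by apply: emeasurable_funM => //; exact: measurable_cst.
  - move=> e _.
    rewrite (_ : (\int[p]_s _ = (expR (a * c * e - 2 * (a ^+ 2 * (c ^+ 2 + v))))%:E *
      \int[p]_s (expR (a * (f s - mu)))%:E)%E); last first.
      rewrite -ge0_integralZl_EFin ?expR_ge0 //.
      apply: eq_integral => s _; rewrite -EFinM -expRD; congr ((expR _)%:E); ring.
    apply: le_trans (lee_wpmul2l _ (centered_mgf p1 bf h hv)) _; first by rewrite lee_fin expR_ge0.
    by rewrite -!EFinM -!expRD lee_fin ler_expR; lra.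
rewrite ge0_integralZl_EFin ?expR_ge0 //.
apply: le_trans (lee_wpmul2l _ (noise_mgf hc)) _; first by rewrite lee_fin expR_ge0.
by rewrite -EFinM -expRD addNr expR0.
Qed.

End NoiseMGF.

(** * Linear MDPs *)

Section SignedCombinations.
Context d (X : measurableType d) (R : realType) (J : finType).

Lemma exists_lincomb (c : J -> R) (ms : J -> {finite_measure set X -> \bar R}) :
  (forall j, 0 <= c j) ->
  exists n : {measure set X -> \bar R},
    (forall B, measurable B -> n B = (\sum_j c j * fine (ms j B))%:E) /\
    (forall f, bmf f -> (forall x, 0 <= f x) ->
      (\int[n]_x (f x)%:E)%E = (\sum_j c j * Rintegral (ms j) setT f)%:E).
Proof.
move=> c0; elim: (index_enum J) => [|j r [n [nE nI]]].
  exists mzero; split=> [B mB|f bf f0]; first by rewrite big_nil.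
  by rewrite big_nil integral_measure_zero.
exists (measure_add (mscale (NngNum (c0 j)) (ms j)) n); split=> [B mB|f bf f0].
  apply: etrans (measure_addE _ _ _) _; rewrite nE // big_cons EFinD EFinM fineK //.
  exact: fin_num_measure.
have mf : measurable_fun setT (fun x => (f x)%:E) by apply/measurable_EFinP; case: bf.
rewrite ge0_integral_measure_add //; last by move=> x _; rewrite lee_fin.
rewrite ge0_integral_mscale //; last by move=> x _; rewrite lee_fin.
rewrite nI // big_cons EFinD EFinM /Rintegral fineK //.
apply: integrable_fin_num => //; apply: bmf_integrable_fin => //.
by rewrite ltey_eq fin_num_measure.
Qed.

(** Splitting c into positive and negative parts turns the signed identity into an equality of
    positive measures, p + n2 + n3 = n1 + n4, which can be integrated. A bounded f is reduced to a
    nonnegative one by adding its bound. *)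
Lemma Rintegral_signed (p : {measure set X -> \bar R}) (c : J -> R)
    (mp mm : J -> {finite_measure set X -> \bar R}) (f : X -> R) :
  p setT = 1%E ->
  (forall B, measurable B -> p B = (\sum_j c j * (fine (mp j B) - fine (mm j B)))%:E) ->
  bmf f ->
  Rintegral p setT f = \sum_j c j * (Rintegral (mp j) setT f - Rintegral (mm j) setT f).
Proof.
move=> p1 pE bf.
have ge0case g : bmf g -> (forall x, 0 <= g x) ->
    Rintegral p setT g = \sum_j c j * (Rintegral (mp j) setT g - Rintegral (mm j) setT g).
  move=> bg g0.
  have mg : measurable_fun setT (fun x => (g x)%:E) by apply/measurable_EFinP; case: bg.
  have cp j : 0 <= Num.max (c j) 0 by rewrite le_max lexx orbT.
  have cm j : 0 <= Num.max (- c j) 0 by rewrite le_max lexx orbT.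
  have cE j : c j = Num.max (c j) 0 - Num.max (- c j) 0.
    by rewrite /Num.max; case: ltP => ?; case: ltP => ?; lra.
  have [n1 [n1E n1I]] := exists_lincomb mp cp.
  have [n2 [n2E n2I]] := exists_lincomb mm cp.
  have [n3 [n3E n3I]] := exists_lincomb mp cm.
  have [n4 [n4E n4I]] := exists_lincomb mm cm.
  have : (\int[measure_add p (measure_add n2 n3)]_x (g x)%:E =
          \int[measure_add n1 n4]_x (g x)%:E)%E.
    apply: eq_measure_integral => B mB _ /=.
    apply: etrans (measure_addE _ _ _) _; apply/esym/(etrans (measure_addE _ _ _))/esym.
    rewrite [X in (_ + X)%E](measure_addE n2 n3 B).
    rewrite pE // n1E // n2E // n3E // n4E // -!EFinD; congr (_%:E).
    rewrite -!big_split /=; apply: eq_bigr => j _; rewrite {1}(cE j); ring.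
  have g0' x : setT x -> (0 <= (g x)%:E)%E by rewrite lee_fin.
  rewrite !ge0_integral_measure_add // n1I // n2I // n3I // n4I //.
  rewrite bmf_integralE // -!EFinD => -[] h.
  rewrite -!big_split /= in h; rewrite (canRL (addrK _) h) -sumrB.
  apply: eq_bigr => j _; have := cE j; set u := Num.max _ _; set v := Num.max _ _ => ->; ring.
have [mf [M hM]] := bf.
have bc := @bmf_cst _ X R M.
have b1 : bmf (fun x => f x + M) by exact: bmfD.
have M0 : 0 <= M by apply: le_trans (hM point).
have h1 := ge0case _ b1 (fun x => _); have h2 := ge0case _ bc (fun=> M0).
have fM0 x : 0 <= f x + M by have := hM x; rewrite ler_norml; lra.
have {}h1 := h1 fM0.
rewrite (_ : Rintegral p setT f = Rintegral p setT (fun x => f x + M) - Rintegral p setT (fun=> M)); last first.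
  by rewrite bmf_RintegralD //; ring.
rewrite h1 h2 -sumrB; apply: eq_bigr => j _; rewrite -mulrBr; congr (_ * _).
have fin (m : {finite_measure set X -> \bar R}) : Rintegral m setT (fun x => f x + M) =
    Rintegral m setT f + Rintegral m setT (fun=> M).
  have mfin : (m setT < +oo)%E by rewrite ltey_eq fin_num_measure.
  by rewrite RintegralD //; apply: bmf_integrable_fin.
rewrite !fin; ring.
Qed.

End SignedCombinations.

(** * Disintegration of integrals of bounded functions *)

Section Disintegration.
Context d1 d2 (X : measurableType d1) (Y : measurableType d2) (R : realType).

(** Tonelli-type identities concern nonnegative functions; a bounded function is shifted by its
    bound, and the constant is removed afterwards. *)
Let shift (f : Y -> R) M : (forall y, `|f y| <= M) -> forall y, 0 <= f y + M.
Proof. by move=> h y; have := h y; rewrite ler_norml; lra. Qed.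

Lemma bmf_kernel (k : R.-pker X ~> Y) f : bmf f -> bmf (fun x => Rintegral (k x) setT f).
Proof.
move=> bf; have [mf [M hM]] := bf; have bc := @bmf_cst _ Y R M.
have p1 x : k x setT = 1%E by exact: prob_kernel.
split; last by exists M => x; apply: (bmf_norm_Rintegral (p1 x)).
have h : measurable_fun setT (fun x => (\int[k x]_y (f y + M)%:E)%E).
  apply: measurable_fun_integral_kernel => [U mU|z|]; first exact: measurable_kernel.
    by rewrite lee_fin shift.
  by apply/measurable_EFinP; case: (bmfD bf bc).
rewrite (_ : (fun x => _) = (fun x => fine (\int[k x]_y (f y + M)%:E)%E - M)).
  apply: measurable_funB => //; exact: measurableT_comp.
apply/funext => x; rewrite -[fine _]/(Rintegral (k x) setT (fun y => f y + M)).
by rewrite (bmf_RintegralD (p1 x) bf bc) (Rintegral_const (p1 x)) addrK.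
Qed.

Lemma Rintegral_disintegrate (m : {measure set Y -> \bar R}) (mu : {measure set X -> \bar R})
    (k : R.-pker X ~> Y) f :
  m setT = 1%E -> mu setT = 1%E ->
  (forall F : Y -> \bar R, measurable_fun setT F -> (forall y, 0 <= F y)%E ->
     (\int[m]_y F y = \int[mu]_x \int[k x]_y F y)%E) ->
  bmf f -> Rintegral m setT f = Rintegral mu setT (fun x => Rintegral (k x) setT f).
Proof.
move=> m1 mu1 h bf; have [mf [M hM]] := bf; have bc := @bmf_cst _ Y R M.
have p1 x : k x setT = 1%E by exact: prob_kernel.
have bfM := bmfD bf bc.
have bkf := bmf_kernel k bf.
have := h (fun y => (f y + M)%:E).
rewrite (bmf_integralE m1 bfM) (bmf_RintegralD m1 bf bc) (Rintegral_const m1).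
under eq_integral do rewrite (bmf_integralE (p1 _) bfM) (bmf_RintegralD (p1 _) bf bc) (Rintegral_const (p1 _)).
rewrite (bmf_integralE mu1); last by apply: bmfD => //; exact: bmf_cst.
rewrite (bmf_RintegralD mu1) ?(Rintegral_const mu1) //; last exact: bmf_cst.
move=> H; apply: (@addIr _ M); apply: EFin_inj; apply: H; first by apply/measurable_EFinP; case: bfM.
by move=> y; rewrite lee_fin shift.
Qed.

Lemma Rintegral_transfer (m : {measure set Y -> \bar R}) (mu : {measure set X -> \bar R})
    (g : X -> Y) f :
  measurable_fun setT g -> m setT = 1%E -> mu setT = 1%E ->
  (forall F : Y -> \bar R, measurable_fun setT F -> (forall y, 0 <= F y)%E ->
     (\int[m]_y F y = \int[mu]_x F (g x))%E) ->
  bmf f -> Rintegral m setT f = Rintegral mu setT (fun x => f (g x)).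
Proof.
move=> mg m1 mu1 h bf; have [mf [M hM]] := bf; have bc := @bmf_cst _ Y R M.
have bfM := bmfD bf bc.
have bfg : bmf (fun x => f (g x)) by split; [exact: measurableT_comp|exists M].
have := h (fun y => (f y + M)%:E).
rewrite (bmf_integralE m1 bfM) (bmf_RintegralD m1 bf bc) (Rintegral_const m1).
rewrite (bmf_integralE mu1); last by apply: bmfD => //; exact: bmf_cst.
rewrite (bmf_RintegralD mu1) ?(Rintegral_const mu1) //; last exact: bmf_cst.
move=> H; apply: (@addIr _ M); apply: EFin_inj; apply: H; first by apply/measurable_EFinP; case: bfM.
by move=> y; rewrite lee_fin shift.
Qed.

End Disintegration.

Section LinearMDP.
Variables (R : realType) (dS dA : measure_display).
Variables (S : measurableType dS) (A : measurableType dA).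
Variables (d H : nat).
Variables (phi : S * A -> 'cV[R]_d) (gam : nat -> 'cV[R]_d).
Variable P : nat -> R.-pker (S * A)%type ~> S.
Variables (mup mum : nat -> 'I_d -> {finite_measure set S -> \bar R}).
Variable pi : nat -> R.-pker S ~> A.

Record linear_mdp : Prop := LinearMDP {
  measurable_phi : forall i, measurable_fun setT (fun sa => phi sa i 0);
  vnorm_phi_le1 : forall sa, vnorm (phi sa) <= 1;
  vnorm_gam_le1 : forall h, (1 <= h <= H)%N -> vnorm (gam h) <= 1;
  reward_01 : forall h, (1 <= h <= H)%N -> forall sa, 0 <= dotv (phi sa) (gam h) <= 1;
  signed_transition : forall h, (1 <= h <= H)%N -> forall sa B, measurable B ->
    P h sa B = (\sum_(j < d) phi sa j 0 * (fine (mup h j B) - fine (mum h j B)))%:E;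
  signed_mu_le : forall h, (1 <= h <= H)%N ->
    forall f : S -> R, measurable_fun setT f -> (forall s, `|f s| <= 1) ->
      Num.sqrt (\sum_(j < d)
        (Rintegral (mup h j) setT f - Rintegral (mum h j) setT f) ^+ 2) <= Num.sqrt d%:R
}.

Hypothesis mdp : linear_mdp.

Let mphi := measurable_phi mdp.
Let phi_le1 := vnorm_phi_le1 mdp.
Let reward_bounds := reward_01 mdp.
Let transitionE := signed_transition mdp.
Let mu_le := signed_mu_le mdp.

Let r h sa := dotv (phi sa) (gam h).

(** The vector integral of f against the signed measures mu_h: these are the coefficients of P_h f
    in the features. *)
Definition muV (h : nat) (f : S -> R) : 'cV[R]_d :=
  \col_j (Rintegral (mup h j) setT f - Rintegral (mum h j) setT f).

Lemma fin_integrable (m : {finite_measure set S -> \bar R}) (f : S -> R) :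
  bmf f -> m.-integrable setT (EFin \o f).
Proof. by apply: bmf_integrable_fin; rewrite ltey_eq fin_num_measure. Qed.

Lemma muVB h (f g : S -> R) : bmf f -> bmf g ->
  muV h (fun s => f s - g s) = muV h f - muV h g.
Proof.
move=> bf bg; apply/matrixP => i j; rewrite !mxE !RintegralB //; try exact: fin_integrable.
ring.
Qed.

Lemma muV0 h : muV h (fun=> 0) = 0.
Proof. by apply/matrixP => i j; rewrite !mxE /Rintegral !integral0 subr0. Qed.

Lemma muVZ h c (f : S -> R) : bmf f -> muV h (fun s => c * f s) = c *: muV h f.
Proof.
move=> bf; apply/matrixP => i j; rewrite !mxE !RintegralZl //; try exact: fin_integrable.
ring.
Qed.

Lemma vnorm_muV h (f : S -> R) M : (1 <= h <= H)%N -> 0 < M ->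
  measurable_fun setT f -> (forall s, `|f s| <= M) ->
  vnorm (muV h f) <= Num.sqrt d%:R * M.
Proof.
move=> hH M0 mf fM; have bf : bmf f by split=> //; exists M.
have bg : bmf (fun s => M^-1 * f s) by exact: bmfZ.
rewrite (_ : muV h f = M *: muV h (fun s => M^-1 * f s)); last first.
  by rewrite muVZ // scalerA divff ?gt_eqF // scale1r.
rewrite vnormZ gtr0_norm // mulrC ler_pM2r //.
have := mu_le hH (f := fun s => M^-1 * f s) bg.1.
rewrite (_ : Num.sqrt _ = vnorm (muV h (fun s => M^-1 * f s))); last first.
  by congr Num.sqrt; apply: eq_bigr => j _; rewrite !mxE expr2.
apply=> s; rewrite normrM gtr0_norm ?invr_gt0 // mulrC ler_pdivrMr // mul1r.
exact: fM.
Qed.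

Lemma PV_dotv h f sa : (1 <= h <= H)%N -> bmf f -> PV P h f sa = dotv (phi sa) (muV h f).
Proof.
move=> hH bf; rewrite /PV (Rintegral_signed (prob_kernel sa) (transitionE hH sa) bf).
by apply: eq_bigr => j _; rewrite mxE.
Qed.

Lemma bmf_dotv_phi x : bmf (fun sa => dotv (phi sa) x).
Proof.
split; last first.
  exists (vnorm x) => sa; apply: le_trans (ler_norm_dotv _ _) _.
  by rewrite ler_piMl ?vnorm_ge0.
by apply: measurable_sum => i; apply: measurable_funM.
Qed.

Definition polk h : R.-pker S ~> (S * A)%type := pgraphk (pi h) (@measurable_id _ S setT).

Lemma Rintegral_polk h s (f : S * A -> R) : bmf f ->
  Rintegral (polk h s) setT f = Rintegral (pi h s) setT (fun a => f (s, a)).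
Proof.
move=> bf; apply: Rintegral_transfer => //; try exact: prob_kernel.
by move=> F mF F0; rewrite integral_pgraphk.
Qed.

Lemma bmf_phi i : bmf (fun sa => phi sa i 0).
Proof.
split; first exact: mphi.
by exists 1 => sa; apply: le_trans (phi_le1 sa); exact: ler_coord_vnorm.
Qed.

Lemma dotv_phi_pol h s x :
  dotv (phi_pol phi pi h s) x = Rintegral (polk h s) setT (fun sa => dotv (phi sa) x).
Proof.
have p1 := @prob_kernel _ _ _ _ _ (polk h) s.
rewrite /dotv bmf_Rintegral_sum //; last first.
  by move=> i; apply: bmfM; [exact: bmf_phi|exact: bmf_cst].
apply: eq_bigr => i _; rewrite mxE.
under [in RHS]eq_Rintegral do rewrite mulrC.
rewrite bmf_RintegralZ //; last exact: bmf_phi.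
by rewrite mulrC Rintegral_polk //; exact: bmf_phi.
Qed.

Lemma bmf_dotv_pol h x : bmf (fun s => dotv (phi_pol phi pi h s) x).
Proof.
under eq_fun do rewrite dotv_phi_pol.
by apply: bmf_kernel; exact: bmf_dotv_phi.
Qed.

Lemma dotv_pol_bounds h s x a b : (forall sa, a <= dotv (phi sa) x <= b) ->
  a <= dotv (phi_pol phi pi h s) x <= b.
Proof.
move=> hab; rewrite dotv_phi_pol; apply: bmf_Rintegral_bounds => //.
  exact: prob_kernel.
exact: bmf_dotv_phi.
Qed.

Lemma Vpi_last : Vpi H P r pi H.+1 = fun=> 0.
Proof. by rewrite /Vpi subnn. Qed.

Lemma Vpi_step h : (1 <= h <= H)%N -> bmf (Vpi H P r pi h.+1) ->
  Vpi H P r pi h = fun s => dotv (phi_pol phi pi h s) (gam h + muV h (Vpi H P r pi h.+1)).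
Proof.
move=> hH bV; have [h1 hH'] := andP hH.
rewrite {1}/Vpi subSn //= subKn // -[Vpol _ _ _ _ (H - h)]/(Vpi H P r pi h.+1).
apply/funext => s; rewrite dotv_phi_pol Rintegral_polk; last exact: bmf_dotv_phi.
by apply: eq_Rintegral => a _; rewrite PV_dotv // dotvDr.
Qed.

Lemma Vpi_bounds h : (1 <= h <= H.+1)%N ->
  bmf (Vpi H P r pi h) /\ forall s, 0 <= Vpi H P r pi h s <= (H.+1 - h)%:R.
Proof.
move=> /andP[h1 hH].
(* Induction on the number of remaining stages, for all h at once. *)
elim: {h}(H.+1 - h)%N {-2}h (erefl (H.+1 - h)%N) h1 hH => [|n IH] h hn h1 hH.
  have -> : h = H.+1 by apply/eqP; rewrite eqn_leq hH -subn_eq0 hn.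
  by rewrite Vpi_last; split=> [|s]; [exact: bmf_cst|rewrite lexx ler0n].
have hH' : (h <= H)%N by rewrite -ltnS -subn_gt0 hn.
have hn' : (H.+1 - h.+1 = n)%N by rewrite subnS hn.
have [bV hV] := IH h.+1 hn' isT hH'.
have hh : (1 <= h <= H)%N by rewrite h1.
rewrite (Vpi_step hh bV); split; first exact: bmf_dotv_pol.
move=> s; apply: dotv_pol_bounds => sa; rewrite dotvDr -PV_dotv //.
have /andP[r0 r1] := reward_bounds hh sa.
have /andP[p0 p1] := bmf_Rintegral_bounds (@prob_kernel _ _ _ _ _ (P h) sa) bV hV.
by rewrite hn' in p1; rewrite hn -natr1 addr_ge0 //= addrC lerD.
Qed.

(** * Error propagation through the Bellman recursion *)

Section Errors.
Variables (Vhat : nat -> S -> R) (what : nat -> 'cV[R]_d).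
Hypothesis Vhat_last : Vhat H.+1 = fun=> 0.
Hypothesis Vhat_step : forall h, (1 <= h <= H)%N ->
  Vhat h = fun s => dotv (phi_pol phi pi h s) (what h).

(** Error of one regression against its own target, the Bellman update of the current [Vhat] rather
    than of the true value. The error inherited from later stages is carried separately, by the
    transition. *)
Definition werr h := gam h + muV h (Vhat h.+1) - what h.

Let Delta h s := Vpi H P r pi h s - Vhat h s.

Lemma bmf_Vhat h : (1 <= h <= H.+1)%N -> bmf (Vhat h).
Proof.
move=> /andP[h1]; rewrite leq_eqVlt => /orP[/eqP->|hH].
  by rewrite Vhat_last; exact: bmf_cst.
by rewrite Vhat_step ?h1 //; exact: bmf_dotv_pol.
Qed.

Lemma bmf_Delta h : (1 <= h <= H.+1)%N -> bmf (Delta h).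
Proof. by move=> hH; apply: bmfB; [have [] := Vpi_bounds hH|exact: bmf_Vhat]. Qed.

Let next h : (1 <= h <= H)%N -> (1 <= h.+1 <= H.+1)%N.
Proof. by case/andP. Qed.

Lemma Delta_step h : (1 <= h <= H)%N ->
  Delta h = fun s => dotv (phi_pol phi pi h s) (werr h + muV h (Delta h.+1)).
Proof.
move=> hH; have [bV _] := Vpi_bounds (next hH); have bVh := bmf_Vhat (next hH).
apply/funext => s; rewrite /Delta Vpi_step // Vhat_step // muVB // /werr -dotvBr.
by congr (dotv _ _); apply/matrixP => i j; rewrite !mxE; ring.
Qed.

Lemma Delta_sup h b e : (1 <= h <= H)%N ->
  (forall sa, `|dotv (phi sa) (werr h)| <= b) -> (forall s, `|Delta h.+1 s| <= e) ->
  forall s, `|Delta h s| <= b + e.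
Proof.
move=> hH hb he s; rewrite Delta_step // ler_norml; apply: dotv_pol_bounds => sa.
have bD := bmf_Delta (next hH).
rewrite dotvDr -PV_dotv // -ler_norml (le_trans (ler_normD _ _)) // lerD //.
exact: (bmf_norm_Rintegral (prob_kernel sa)).
Qed.

Variables (xi1 : probability S R) (nupi : nat -> {measure set (S * A) -> \bar R}).
Hypothesis occ : is_occupancy H P xi1 pi nupi.

Lemma nupi_mass1 h : (1 <= h <= H)%N -> nupi h setT = 1%E.
Proof.
case: h => // h; elim: h => [|h IH] hH.
  rewrite occ.1 // (eq_integral (fun=> 1%E)); last by move=> s _; exact: prob_kernel.
  exact: (integral_mass1 _ (probability_setT xi1)).
rewrite occ.2 // (eq_integral (fun=> 1%E)).
  by apply: integral_mass1; apply: IH; exact: ltnW.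
move=> sa _; rewrite (eq_integral (fun=> 1%E)); last by move=> s _; exact: prob_kernel.
exact: (integral_mass1 _ (prob_kernel sa)).
Qed.

Lemma dotv_vpi h x : (1 <= h <= H)%N ->
  dotv (vpi_vec phi nupi h) x = Rintegral (nupi h) setT (fun sa => dotv (phi sa) x).
Proof.
move=> hH; have m1 := nupi_mass1 hH.
rewrite /dotv bmf_Rintegral_sum //; last first.
  by move=> i; apply: bmfM; [exact: bmf_phi|exact: bmf_cst].
apply: eq_bigr => i _; rewrite mxE.
under [in RHS]eq_Rintegral do rewrite mulrC.
by rewrite bmf_RintegralZ 1?mulrC //; exact: bmf_phi.
Qed.

Lemma dotv_vpi1 x : (0 < H)%N ->
  dotv (vpi_vec phi nupi 1) x = Rintegral xi1 setT (fun s => dotv (phi_pol phi pi 1 s) x).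
Proof.
move=> H0; rewrite dotv_vpi //.
rewrite (@Rintegral_disintegrate _ _ _ _ _ _ xi1 (polk 1)) //; last first.
- exact: bmf_dotv_phi.
- move=> F mF F0; apply: integral_mixture => //; first exact: probability_setT.
  by move=> B mB; rewrite occ.1.
- exact: probability_setT.
- by apply: nupi_mass1; rewrite H0.
by apply: eq_Rintegral => s _; rewrite dotv_phi_pol.
Qed.

Lemma dotv_vpi_step h x : (1 <= h < H)%N ->
  dotv (vpi_vec phi nupi h.+1) x =
  Rintegral (nupi h) setT (PV P h (fun s => dotv (phi_pol phi pi h.+1 s) x)).
Proof.
move=> hH; have [h1 hH'] := andP hH.
have n1 := nupi_mass1 (h := h); have n2 := nupi_mass1 (h := h.+1).
rewrite dotv_vpi //.
rewrite (@Rintegral_disintegrate _ _ _ _ _ _ (nupi h) (pcompk (P h) (polk h.+1))) //; last first.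
- exact: bmf_dotv_phi.
- move=> F mF F0; apply: integral_mixture => //; first by apply: n1; rewrite h1 ltnW.
  by move=> B mB; rewrite occ.2.
- by apply: n1; rewrite h1 ltnW.
- exact: n2.
apply: eq_Rintegral => sa _; rewrite /PV.
rewrite (@Rintegral_disintegrate _ _ _ _ _ _ (P h sa) (polk h.+1)) //; last first.
- exact: bmf_dotv_phi.
- by move=> F mF F0; rewrite integral_pcompk.
- exact: prob_kernel.
- exact: prob_kernel.
by apply: eq_Rintegral => s _; rewrite dotv_phi_pol.
Qed.

(** By linearity <v_k, mu_k Delta_{k+1}> is the mean of P_k Delta_{k+1} under the target occupancy,
    and the flow equation of the occupancy rewrites it with v_{k+1}. Unrolling leaves one residual
    per stage, without any inequality. *)
Lemma value_error : (0 < H)%N ->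
  Rintegral xi1 setT (Vpi H P r pi 1) - Rintegral xi1 setT (Vhat 1) =
  \sum_(1 <= h < H.+1) dotv (vpi_vec phi nupi h) (werr h).
Proof.
move=> H0.
have D1 : (1 <= 1 <= H.+1)%N by [].
rewrite -(bmf_RintegralB (probability_setT xi1)); [|by have [] := Vpi_bounds D1|exact: bmf_Vhat].
rewrite -[fun s => _]/(Delta 1) Delta_step ?H0 // -dotv_vpi1 //.
suff h n k : (n + k = H)%N -> (0 < k)%N ->
   dotv (vpi_vec phi nupi k) (werr k + muV k (Delta k.+1)) =
   \sum_(k <= h < H.+1) dotv (vpi_vec phi nupi h) (werr h).
  by apply: (h H.-1) => //; rewrite addn1 prednK.
elim: n k => [|n IH] k nk k0.
  rewrite add0n in nk; rewrite nk big_nat1 dotvDr.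
  rewrite (_ : Delta H.+1 = fun=> 0); last by apply/funext => s; rewrite /Delta Vpi_last Vhat_last subr0.
  by rewrite muV0 dotv0r addr0.
have kH : (k < H)%N by rewrite -nk addSn ltnS leq_addl.
have kH' : (1 <= k <= H)%N by rewrite k0 ltnW.
rewrite big_ltn ?ltnS ?(ltnW kH) // -IH //; last by rewrite addnS.
rewrite dotvDr; congr (_ + _).
rewrite dotv_vpi // dotv_vpi_step ?k0 //; apply: eq_Rintegral => sa _.
rewrite -PV_dotv //; last exact: bmf_Delta (next kH').
by rewrite -Delta_step // kH.
Qed.

End Errors.
End LinearMDP.

(** * Ridge regression *)

Section Ridge.
Variables (R : realType) (d K : nat).
Variables (f : 'I_K -> 'cV[R]_d) (c : 'I_K -> R).

Definition gram : 'M[R]_d := \sum_(k < K) (c k *: (f k *m (f k)^T)) + 1%:M.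

Lemma gram_sym : gram^T = gram.
Proof.
rewrite /gram linearD /= trmx1 linear_sum /=; congr (_ + _); apply: eq_bigr => k _.
by rewrite linearZ /= trmx_mul trmxK.
Qed.

Lemma gram_quad x : dotv x (gram *m x) = \sum_(k < K) c k * dotv (f k) x ^+ 2 + dotv x x.
Proof.
rewrite mulmxDl mul1mx dotvDr mulmx_suml dotv_sumr; congr (_ + _).
by apply: eq_bigr => k _; rewrite -scalemxAl dotvZr quad_outer.
Qed.

Hypothesis c0 : forall k, 0 <= c k.

Lemma gram_ge1 x : 1 * dotv x x <= dotv x (gram *m x).
Proof.
rewrite gram_quad mul1r lerDr; apply: sumr_ge0 => k _.
by rewrite mulr_ge0 ?sqr_ge0.
Qed.

Lemma gram_unit : gram \in unitmx.
Proof. exact: posdef_unitmx ltr01 gram_ge1. Qed.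

Lemma psd_invgram : psd (invmx gram).
Proof. exact: psd_invmx ltr01 gram_sym gram_ge1. Qed.

(** Writing [th] as G^-1 (G th) separates the regularisation bias, the lone [th], from the
    residuals. *)
Lemma ridge_error (y : 'I_K -> R) th :
  th - invmx gram *m \sum_(k < K) ((c k * y k) *: f k) =
  invmx gram *m (th - \sum_(k < K) ((c k * (y k - dotv (f k) th)) *: f k)).
Proof.
have e : gram *m th = th + \sum_(k < K) ((c k * dotv (f k) th) *: f k).
  rewrite mulmxDl mul1mx addrC mulmx_suml; congr (_ + _); apply: eq_bigr => k _.
  rewrite -scalemxAl -mulmxA (mx11_scalar ((f k)^T *m th)) -dotvE.
  by rewrite mul_mx_scalar scalerA.
rewrite -[in LHS](mulKmx gram_unit th) -mulmxBr e; congr (_ *m _).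
rewrite -addrA; congr (_ + _); rewrite -sumrB -sumrN; apply: eq_bigr => k _.
by apply/matrixP => i j; rewrite !mxE; ring.
Qed.

(* With [m] the coercivity constant of the regularised Gram matrix, each
   coordinate of the noise costs at most [e], hence the factor [sqrt d]. *)
Lemma ridge_pointwise (y : 'I_K -> R) th x m e a : 0 < m -> 0 <= e ->
  (forall z, m * dotv z z <= dotv z (gram *m z)) ->
  (forall i, `|\sum_(k < K) c k * (y k - dotv (f k) th) * f k i 0| <= e) ->
  vnorm x <= 1 -> vnorm th <= a ->
  `|dotv x (th - invmx gram *m \sum_(k < K) ((c k * y k) *: f k))| <=
    (a + Num.sqrt d%:R * e) / m.
Proof.
move=> m0 e0 hm he x1 tha; rewrite ridge_error.
have pI := psd_invgram.
apply: le_trans (ler_dotv_Mnorm _ _ pI) _.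
have b z := Mnorm_inv_vnorm z m0 gram_sym hm.
have sm : 0 < Num.sqrt m by rewrite sqrtr_gt0.
set z := th - _.
have zb : vnorm z <= a + Num.sqrt d%:R * e.
  rewrite /z -scaleN1r; apply: le_trans (vnormD _ _) _.
  rewrite vnormZ normrN1 mul1r lerD //; apply: vnorm_coord => // i.
  rewrite summxE; apply: le_trans (he i); apply: eq_ler.
  by congr `|_|; apply: eq_bigr => k _; rewrite mxE.
apply: (@le_trans _ _ ((1 / Num.sqrt m) * ((a + Num.sqrt d%:R * e) / Num.sqrt m))).
  apply: ler_pM; rewrite ?Mnorm_ge0 //.
    by apply: le_trans (b x) _; rewrite ler_pM2r ?invr_gt0.
  by apply: le_trans (b z) _; rewrite ler_pM2r ?invr_gt0.
rewrite -{3}(sqr_sqrtr (ltW m0)); apply: eq_ler.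
by field; rewrite gt_eqF.
Qed.

(** Only the regularisation term is estimated; the noise stays a scalar sum, so that its variance
    along x can be exploited. *)
Lemma ridge_direction (y : 'I_K -> R) th x :
  `|dotv x (th - invmx gram *m \sum_(k < K) ((c k * y k) *: f k))| <=
    Mnorm (invmx gram) x * Mnorm (invmx gram) th +
    `|\sum_(k < K) dotv x (invmx gram *m f k) * c k * (y k - dotv (f k) th)|.
Proof.
rewrite ridge_error mulmxBr dotvBr (le_trans (ler_normB _ _)) // lerD //.
  exact: ler_dotv_Mnorm psd_invgram.
rewrite mulmx_sumr dotv_sumr; apply: eq_ler.
by congr `|_|; apply: eq_bigr => k _; rewrite -scalemxAr dotvZr; ring.
Qed.

(** With z = G^-1 x the left side is <z, (G - I) z>. It will control the conditional variance of the
    noise along x. *)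
Lemma sum_sqr_leverage x :
  \sum_(k < K) c k * dotv x (invmx gram *m f k) ^+ 2 <= Mnorm (invmx gram) x ^+ 2.
Proof.
rewrite (sqr_Mnorm _ psd_invgram); set z := invmx gram *m x.
have -> : dotv x z = dotv z (gram *m z) by rewrite mulKVmx ?gram_unit // dotvC.
rewrite gram_quad -[leLHS]addr0 lerD ?dotv_ge0 //.
apply: ler_sum => k _; rewrite ler_wpM2l //.
by rewrite (psd_sym _ _ psd_invgram) -/z.
Qed.

End Ridge.

Section EmpiricalCovariance.
Variables (R : realType) (d K : nat).
Variables (f : 'I_K -> 'cV[R]_d) (c : 'I_K -> R) (Q : 'M[R]_d).

(** An entrywise error e moves the quadratic form by at most e d |x|^2, which is at most half of K
    <x, Q x>. *)
Lemma empirical_lower (e q : R) x :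
  (forall i j, `|\sum_(k < K) c k * f k i 0 * f k j 0 - K%:R * Q i j| <= e) ->
  (forall z, q * dotv z z <= dotv z (Q *m z)) ->
  e * d%:R <= K%:R * q / 2 ->
  K%:R / 2 * dotv x (Q *m x) <= \sum_(k < K) c k * dotv (f k) x ^+ 2.
Proof.
move=> he hq hK.
pose M := \sum_(k < K) (c k *: (f k *m (f k)^T)) - K%:R *: Q.
have hM i j : `|M i j| <= e.
  have := he i j; rewrite !mxE summxE; congr (`| _ - _ | <= _).
  by apply: eq_bigr => k _; rewrite !mxE big_ord1 !mxE mulrA.
have := quad_form_entries x hM.
have -> : dotv x (M *m x) = \sum_(k < K) c k * dotv (f k) x ^+ 2 - K%:R * dotv x (Q *m x).
  rewrite mulmxBl dotvBr mulmx_suml dotv_sumr -scalemxAl dotvZr; congr (_ - _).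
  by apply: eq_bigr => k _; rewrite -scalemxAl dotvZr quad_outer.
rewrite ler_norml => /andP[h _].
have h1 := ler_wpM2r (dotv_ge0 x) hK.
have h2 : 0 <= K%:R / 2 * (dotv x (Q *m x) - q * dotv x x).
  by rewrite mulr_ge0 ?divr_ge0 ?subr_ge0.
lra.
Qed.

End EmpiricalCovariance.

(** * One stage of the algorithm *)

(** Inversion is discontinuous at 0, but x^-1 = x exp (- ln (x^2)) holds there too, and its right
    side is built from measurable maps. *)
Lemma measurable_invr d (T : measurableType d) (R : realType) (f : T -> R) :
  measurable_fun setT f -> measurable_fun setT (fun x => (f x)^-1).
Proof.
move=> mf; rewrite (_ : (fun x => _) = (fun x => f x * expR (- ln (f x ^+ 2)))).
  apply: measurable_funM => //; apply: measurableT_comp => //.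
  apply: measurableT_comp => //; apply: measurableT_comp => //.
  exact: measurable_funX.
apply/funext => x; have [->|fx0] := eqVneq (f x) 0; first by rewrite invr0 mul0r.
rewrite expRN lnK; last by rewrite posrE lt_neqAle sqr_ge0 eq_sym sqrf_eq0 fx0.
by rewrite expr2 invfM mulrA divff // mul1r.
Qed.

Section Variance.
Context d (X : measurableType d) (R : realType).
Variable p : {measure set X -> \bar R}.
Hypothesis p1 : p setT = 1%E.
Implicit Types f g : X -> R.

Definition var f := Rintegral p setT (fun x => f x ^+ 2) - Rintegral p setT f ^+ 2.

Lemma var_ge0 f : bmf f -> 0 <= var f.
Proof. by move=> bf; rewrite subr_ge0 sqr_Rintegral_le. Qed.

Lemma var_le_sqr f a : bmf f -> var f <= Rintegral p setT (fun x => (f x - a) ^+ 2).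
Proof.
move=> bf; rewrite Rintegral_variance // /var.
have := sqr_ge0 (Rintegral p setT f - a); rewrite sqrrB mulr2n; lra.
Qed.

Lemma var_le_bound f M : bmf f -> (forall x, `|f x| <= M) -> var f <= M ^+ 2.
Proof.
move=> bf hM; apply: le_trans (var_le_sqr 0 bf) _.
have /andP[//] : 0 <= Rintegral p setT (fun x => (f x - 0) ^+ 2) <= M ^+ 2.
apply: bmf_Rintegral_bounds => //; first by apply/bmfX/bmfB => //; exact: bmf_cst.
move=> x; rewrite subr0 sqr_ge0 /= -(real_normK (num_real (f x))) ler_sqr ?nnegrE //.
exact: le_trans (hM x).
Qed.

(** Centre f at the mean of g, which can only increase its second moment, and use (u + w)^2 <= 2 u^2
    + 2 w^2. *)
Lemma var_perturb f g : bmf f -> bmf g -> (forall x, `|f x - g x| <= 1) ->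
  var f <= 2 * var g + 2.
Proof.
move=> bf bg hfg; set a := Rintegral p setT g.
apply: le_trans (var_le_sqr a bf) _.
have bga : bmf (fun x => (g x - a) ^+ 2) by apply/bmfX/bmfB => //; exact: bmf_cst.
have bfa : bmf (fun x => (f x - a) ^+ 2) by apply/bmfX/bmfB => //; exact: bmf_cst.
have b2 : bmf (fun x => 2 * (g x - a) ^+ 2 + 2).
  by apply: bmfD; [exact: bmfZ|exact: bmf_cst].
apply: (@le_trans _ _ (Rintegral p setT (fun x => 2 * (g x - a) ^+ 2 + 2))).
  apply: bmf_le_Rintegral => // x.
  have h1 : (f x - g x) ^+ 2 <= 1.
    by rewrite -(real_normK (num_real _)) expr_le1.
  have := sqr_ge0 ((f x - g x) - (g x - a)); lra.
rewrite bmf_RintegralD //; [|exact: bmfZ|exact: bmf_cst].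
rewrite Rintegral_const // bmf_RintegralZ // Rintegral_variance // -/a /var -/a.
by rewrite lerD2r ler_pM2l //; lra.
Qed.

End Variance.

Section VarianceEstimate.
Variable R : realType.
(** The budget 2 splits into 1/3 for the second moment, 2/3 for the squared mean, since squaring is
    2 N-Lipschitz on [0, N], and 1 for a negative p1: estimated values may go down to -1, while the
    algorithm clips at 0. *)
Lemma variance_estimate (b th p1 p2 N : R) : 1 <= N ->
  0 <= p2 <= N ^+ 2 -> -1 <= p1 <= N -> `|b - p2| <= 1 / 3 -> `|th - p1| <= 1 / (3 * N) ->
  `|(clip 0 (N ^+ 2) b - clip 0 N th ^+ 2) - (p2 - p1 ^+ 2)| <= 2.
Proof.
move=> N1 hp2 hp1 hb hth; have N0 : 0 < N by lra.
have h1 : `|clip 0 (N ^+ 2) b - p2| <= 1 / 3.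
  by rewrite -{1}(clip_id hp2); apply: le_trans (clip_lipschitz _ _ _ _) hb.
have h2 : `|clip 0 N th - clip 0 N p1| <= 1 / (3 * N).
  exact: le_trans (clip_lipschitz _ _ _ _) hth.
have /andP[c0 cN] := clip_bounds th (ltW N0).
have /andP[e0 eN] := clip_bounds p1 (ltW N0).
set c := clip 0 N th in h2 c0 cN *; set e := clip 0 N p1 in h2 e0 eN.
have h3 : `|c ^+ 2 - e ^+ 2| <= 2 / 3.
  rewrite subr_sqr normrM (ger0_norm (addr_ge0 c0 e0)).
  apply: (@le_trans _ _ (1 / (3 * N) * (2 * N))).
    by apply: ler_pM; rewrite ?normr_ge0 ?addr_ge0 //; lra.
  by apply: eq_ler; field; rewrite gt_eqF.
have h4 : `|e ^+ 2 - p1 ^+ 2| <= 1.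
  have /andP[a1 a2] := hp1; have [p10|p10] := lerP 0 p1.
    by rewrite /e clip_id ?p10 ?a2 // subrr normr0.
  have -> : e = 0 by rewrite /e /clip max_r ?min_l // ltW.
  rewrite expr0n sub0r normrN normrX expr_le1 // ler0_norm; lra.
move: h1 h3 h4; rewrite !ler_norml => /andP[? ?] /andP[? ?] /andP[? ?]; lra.
Qed.

(* Both comparisons between estimated and true conditional variances are
   multiplicative, so constant accuracy of [est] suffices. *)
Lemma variance_sandwich (est vV vpi : R) : `|est - vV| <= 2 -> 0 <= vV -> vV <= 2 * vpi + 2 ->
  1 + vV <= 2 * (Num.max 1 est + 1) /\ Num.max 1 est + 1 <= 4 * (Num.max 1 vpi + 1).
Proof.
rewrite ler_norml => /andP[a b] c e.
have h1 : 1 <= Num.max 1 est by rewrite le_max lexx.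
have h2 : est <= Num.max 1 est by rewrite le_max lexx orbT.
have h3 : 1 <= Num.max 1 vpi by rewrite le_max lexx.
have h4 : vpi <= Num.max 1 vpi by rewrite le_max lexx orbT.
split; first lra.
have : Num.max 1 est <= 4 * Num.max 1 vpi + 3 by rewrite ge_max; apply/andP; split; lra.
lra.
Qed.

End VarianceEstimate.

Section Stage.
Variables (R : realType) (dS dA : measure_display).
Variables (S : measurableType dS) (A : measurableType dA).
Variables (d H : nat).
Variables (phi : S * A -> 'cV[R]_d) (gam : nat -> 'cV[R]_d).
Variable P : nat -> R.-pker (S * A)%type ~> S.
Variables (mup mum : nat -> 'I_d -> {finite_measure set S -> \bar R}).
Variable pi : nat -> R.-pker S ~> A.
Variable K : nat.
Let r h sa := dotv (phi sa) (gam h).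
Local Notation sample := ((S * A) * R * S)%type.

Section definitions.
Variables (h : nat) (V : S -> R) (zD zC : 'I_K -> sample).
Let N : R := (H - h).+1%:R.

Definition phiD k := phi (zD k).1.1.
Definition phiC k := phi (zC k).1.1.

(** p = 1 estimates the mean and p = 2 the second moment; the unit weights make both instances of
    weighted ridge regression. *)
Definition moment_hat p : 'cV[R]_d :=
  invmx (gram phiC (fun=> 1)) *m \sum_(k < K) ((1 * V (zC k).2 ^+ p) *: phiC k).

Definition sig2 (sa : S * A) : R :=
  Num.max 1 (clip 0 (N ^+ 2) (dotv (phi sa) (moment_hat 2))
             - clip 0 N (dotv (phi sa) (moment_hat 1)) ^+ 2) + 1.

Definition wt k : R := (sig2 (zD k).1.1)^-1.

Definition w_hat : 'cV[R]_d :=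
  invmx (gram phiD wt) *m
    \sum_(k < K) ((wt k * (r h (zD k).1.1 + (zD k).1.2 + V (zD k).2)) *: phiD k).

Definition xi k : R := (zD k).1.2 + (V (zD k).2 - PV P h V (zD k).1.1).

(* The weight of the [k]-th noise term in the error along the direction [v]. *)
Definition lev (v : 'cV[R]_d) k : R := dotv v (invmx (gram phiD wt) *m phiD k) * wt k.

Lemma sig2_ge2 sa : 2 <= sig2 sa.
Proof.
have h1 : 1 <= Num.max 1 (clip 0 (N ^+ 2) (dotv (phi sa) (moment_hat 2))
             - clip 0 N (dotv (phi sa) (moment_hat 1)) ^+ 2) by rewrite le_max lexx.
by rewrite /sig2; lra.
Qed.

Lemma wt_bounds k : 0 <= wt k <= 1 / 2.
Proof.
have h2 := sig2_ge2 (zD k).1.1.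
have h0 : 0 < sig2 (zD k).1.1 by lra.
rewrite /wt invr_ge0 ltW //= mul1r lef_pV2 ?posrE //; lra.
Qed.

End definitions.

Lemma fqi_wE (D Dc : dataset R S A K) h V (zD zC : 'I_K -> sample) :
  (forall k, D h k = ((zD k).1.1, r h (zD k).1.1 + (zD k).1.2, (zD k).2)) ->
  (forall k, Dc h k = ((zC k).1.1, r h (zC k).1.1 + (zC k).1.2, (zC k).2)) ->
  fqi_w H phi 1 (fun=> 1) 1 D Dc h V = w_hat h V zD zC.
Proof.
move=> DE DcE; rewrite /fqi_w.
have e1 : \sum_(k < K) (phi (Dc h k).1.1 *m (phi (Dc h k).1.1)^T) + 1%:M = gram (phiC zC) (fun=> 1).
  by rewrite /gram; congr (_ + _); apply: eq_bigr => k _; rewrite scale1r DcE.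
have e2 p : \sum_(k < K) (V (Dc h k).2 ^+ p *: phi (Dc h k).1.1) =
    \sum_(k < K) ((1 * V (zC k).2 ^+ p) *: phiC zC k).
  by apply: eq_bigr => k _; rewrite mul1r DcE.
have e2' : \sum_(k < K) (V (Dc h k).2 *: phi (Dc h k).1.1) =
    \sum_(k < K) ((1 * V (zC k).2 ^+ 1) *: phiC zC k).
  by rewrite -e2; apply: eq_bigr => k _; rewrite expr1.
rewrite e1 e2 e2' -/(moment_hat V zC 2) -/(moment_hat V zC 1).
have e3 k : Num.sqrt (Num.max 1
    (clip 0 ((H - h).+1%:R ^+ 2) (dotv (phi (D h k).1.1) (moment_hat V zC 2)) -
     clip 0 (H - h).+1%:R (dotv (phi (D h k).1.1) (moment_hat V zC 1)) ^+ 2) + 1 ^+ 2) ^+ 2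
    = sig2 h V zC (zD k).1.1.
  rewrite sqr_sqrtr ?DE ?expr1n //=.
  by rewrite (le_trans _ (sig2_ge2 h V zC (zD k).1.1)).
rewrite /w_hat /gram; congr (invmx (_ + _) *m _); apply: eq_bigr => k _.
  by rewrite e3 DE.
by rewrite e3 DE /= mulrC.
Qed.

Section analysis.
Hypothesis mdp : linear_mdp H phi gam P mup mum.
Variable nu : nat -> {measure set (S * A) -> \bar R}.
Variable h : nat.
Hypothesis hH : (1 <= h <= H)%N.
Hypothesis nu1 : nu h setT = 1%E.
Hypothesis d0 : (0 < d)%N.
Let N : R := (H - h).+1%:R.
Let Vstar := Vpi H P r pi.
Let sigma := sigma_fun H P r pi (fun=> 1) 1.
Let Lam := Lambda_mat phi nu sigma h.
Let Sig := Sigma_mat phi nu h.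
Let iota := lambda_min Lam.
Let kappa := lambda_min Sig.

Let N1 : 1 <= N. Proof. by rewrite /N ler1n. Qed.

Let hH' : (1 <= h.+1 <= H.+1)%N. Proof. by case/andP: hH. Qed.

Let bVstar : bmf (Vstar h.+1). Proof. by have [] := Vpi_bounds pi mdp hH'. Qed.

Let Vstar_bounds s : 0 <= Vstar h.+1 s <= N - 1.
Proof.
have [_ /(_ s)] := Vpi_bounds pi mdp hH'.
by rewrite subSS /N -natr1 addrK.
Qed.

Let P1 sa : P h sa setT = 1%E. Proof. exact: prob_kernel. Qed.

Let vstar sa := VarV P h (Vstar h.+1) sa.

Lemma sqr_sigma sa : sigma h sa ^+ 2 = Num.max 1 (vstar sa) + 1.
Proof.
rewrite /sigma /sigma_fun expr1n sqr_sqrtr // addr_ge0 //.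
by rewrite le_max ler01.
Qed.

Lemma vstar_bounds sa : 0 <= vstar sa <= (N - 1) ^+ 2.
Proof.
rewrite (var_ge0 (P1 sa) bVstar) /=; apply: (var_le_bound (P1 sa) bVstar) => s.
by have /andP[h0 h1] := Vstar_bounds s; rewrite ger0_norm.
Qed.

Lemma sqr_sigma_bounds sa : 2 <= sigma h sa ^+ 2 <= 2 * N ^+ 2.
Proof.
have /andP[v0 v1] := vstar_bounds sa; rewrite sqr_sigma; apply/andP; split.
  have : 1 <= Num.max 1 (vstar sa) by rewrite le_max lexx.
  lra.
have hN := N1; have : Num.max 1 (vstar sa) <= N ^+ 2 + (N ^+ 2 - 1).
  rewrite ge_max; apply/andP; split; first by nra.
  apply: le_trans v1 _; nra.
lra.
Qed.

Lemma bmf_sigmaV : bmf (fun sa => (sigma h sa) ^-2).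
Proof.
split; last first.
  exists 1 => sa; have /andP[h2 _] := sqr_sigma_bounds sa.
  rewrite ger0_norm ?invr_ge0 ?sqr_ge0 // invf_le1; lra.
have bv : bmf vstar.
  rewrite (_ : vstar = fun sa => dotv (phi sa) (muV mup mum h (fun s => Vstar h.+1 s ^+ 2))
                    - dotv (phi sa) (muV mup mum h (Vstar h.+1)) ^+ 2).
    by apply: bmfB; [|apply: bmfX]; exact: bmf_dotv_phi mdp _.
  by apply/funext => sa; rewrite /vstar /VarV !(PV_dotv mdp) //; exact: bmfX.
rewrite (_ : (fun _ => _) = (fun sa => (Num.max 1 (vstar sa) + 1)^-1)); last first.
  by apply/funext => sa; rewrite sqr_sigma.
by apply: measurable_invr; apply: measurable_funD => //; apply: measurable_maxr => //; case: bv.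
Qed.

Lemma weighted_quad (w : S * A -> R) x : bmf w ->
  dotv x ((\matrix_(i, j) Rintegral (nu h) setT (fun sa => w sa * phi sa i 0 * phi sa j 0)) *m x) =
  Rintegral (nu h) setT (fun sa => w sa * dotv (phi sa) x ^+ 2).
Proof.
move=> bw; have bphi := bmf_phi mdp.
have bij i j : bmf (fun sa => w sa * phi sa i 0 * phi sa j 0) by do 2![apply: bmfM => //].
transitivity (\sum_i \sum_j Rintegral (nu h) setT (fun sa => (x i 0 * x j 0) * (w sa * phi sa i 0 * phi sa j 0))).
  apply: eq_bigr => i _; rewrite mxE mulr_sumr; apply: eq_bigr => j _.
  by rewrite bmf_RintegralZ // !mxE; ring.
under eq_bigr => i _.
  rewrite -bmf_Rintegral_sum //; last by move=> j; apply: bmfZ.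
  over.
rewrite -bmf_Rintegral_sum //; last by move=> i; apply: bmf_sum => j; apply: bmfZ.
apply: eq_Rintegral => sa _; rewrite /dotv expr2 !mulr_sumr.
by apply: eq_bigr => i _; rewrite mulr_suml mulr_sumr; apply: eq_bigr => j _; ring.
Qed.

Lemma Sigma_quad x :
  dotv x (Sig *m x) = Rintegral (nu h) setT (fun sa => 1 * dotv (phi sa) x ^+ 2).
Proof.
rewrite -weighted_quad; last exact: bmf_cst.
congr (dotv _ (_ *m _)); apply/matrixP => i j; rewrite !mxE.
by apply: eq_Rintegral => sa _; rewrite mul1r.
Qed.

Lemma Lambda_quad x :
  dotv x (Lam *m x) = Rintegral (nu h) setT (fun sa => (sigma h sa) ^-2 * dotv (phi sa) x ^+ 2).
Proof. by rewrite -weighted_quad //; exact: bmf_sigmaV. Qed.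

Lemma Lambda_sym : Lam^T = Lam.
Proof.
by apply/matrixP => i j; rewrite !mxE; apply: eq_Rintegral => sa _; rewrite mulrAC.
Qed.

Lemma Sigma_sym : Sig^T = Sig.
Proof.
by apply/matrixP => i j; rewrite !mxE; apply: eq_Rintegral => sa _; rewrite mulrC.
Qed.

Lemma Lambda_ge x : iota * dotv x x <= dotv x (Lam *m x).
Proof. by have [] := lambda_minP Lambda_sym d0. Qed.

Lemma Sigma_ge x : kappa * dotv x x <= dotv x (Sig *m x).
Proof. by have [] := lambda_minP Sigma_sym d0. Qed.

Lemma bmf_sqr_dotv x : bmf (fun sa => dotv (phi sa) x ^+ 2).
Proof. by apply: bmfX; exact: bmf_dotv_phi mdp _. Qed.

Lemma sqr_dotv_phi_le sa x : dotv (phi sa) x ^+ 2 <= dotv x x.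
Proof.
apply: le_trans (cauchy_schwarz _ _) _; rewrite ler_piMl ?dotv_ge0 //.
by rewrite -sqr_vnorm expr_le1 ?vnorm_ge0 // (vnorm_phi_le1 mdp).
Qed.

Lemma Sigma_le x : dotv x (Sig *m x) <= dotv x x.
Proof.
rewrite Sigma_quad.
have /andP[//] : 0 <= Rintegral (nu h) setT (fun sa => 1 * dotv (phi sa) x ^+ 2) <= dotv x x.
apply: bmf_Rintegral_bounds => //; first by apply/bmfZ/bmf_sqr_dotv.
by move=> sa; rewrite mul1r sqr_ge0 sqr_dotv_phi_le.
Qed.

Lemma Lambda_le x : dotv x (Lam *m x) <= dotv x x / 2.
Proof.
rewrite Lambda_quad.
have /andP[//] : 0 <= Rintegral (nu h) setT (fun sa => (sigma h sa) ^-2 * dotv (phi sa) x ^+ 2) <= dotv x x / 2.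
apply: bmf_Rintegral_bounds => //; first by apply: bmfM; [exact: bmf_sigmaV|exact: bmf_sqr_dotv].
move=> sa; have /andP[h2 _] := sqr_sigma_bounds sa.
rewrite mulr_ge0 ?invr_ge0 ?sqr_ge0 //= mulrC ler_pM ?sqr_ge0 ?invr_ge0 ?sqr_ge0 ?sqr_dotv_phi_le //.
by rewrite lef_pV2 ?posrE //; lra.
Qed.

(** Pointwise sigma_h^2 <= 2 N^2, hence Lambda_h dominates Sigma_h / (2 N^2). *)
Lemma iota_ge_kappa : 0 < kappa -> kappa / (2 * N ^+ 2) <= iota.
Proof.
move=> k0; have N0 : 0 < N by rewrite (lt_le_trans ltr01).
have [_] := lambda_minP Lambda_sym d0; apply=> x.
apply: (@le_trans _ _ ((2 * N ^+ 2)^-1 * dotv x (Sig *m x))).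
  by rewrite mulrAC mulrC ler_wpM2l ?Sigma_ge // invr_ge0 mulr_ge0 ?sqr_ge0.
rewrite Sigma_quad Lambda_quad -bmf_RintegralZ //; last by apply/bmfZ/bmf_sqr_dotv.
apply: bmf_le_Rintegral => //; [by apply/bmfZ/bmfZ/bmf_sqr_dotv| |].
  by apply: bmfM; [exact: bmf_sigmaV|exact: bmf_sqr_dotv].
move=> sa; have /andP[h2 h3] := sqr_sigma_bounds sa.
rewrite mul1r ler_wpM2r ?sqr_ge0 // lef_pV2 ?posrE //; last lra.
by rewrite mulr_gt0 ?exprn_gt0.
Qed.

Lemma kappa_le1 : kappa <= 1.
Proof.
have [e e1] := exists_unit_vector R d0.
by have := le_trans (Sigma_ge e) (Sigma_le e); rewrite e1 mulr1.
Qed.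

Lemma iota_le_half : iota <= 1 / 2.
Proof.
have [e e1] := exists_unit_vector R d0.
by have := le_trans (Lambda_ge e) (Lambda_le e); rewrite e1 mulr1.
Qed.

Section good_stage.
Variables (V : S -> R) (zD zC : 'I_K -> sample).
Hypothesis mV : measurable_fun setT V.
Hypothesis V_bounds : forall s, -1 <= V s <= N.

Let bV : bmf V.
Proof.
split=> //; exists N => s; have /andP[? ?] := V_bounds s; have := N1.
by rewrite ler_norml; move=> ?; apply/andP; split; lra.
Qed.

Let V_le s : `|V s| <= N.
Proof.
have /andP[? ?] := V_bounds s; have := N1.
by rewrite ler_norml; move=> ?; apply/andP; split; lra.
Qed.

Let N0 : 0 < N. Proof. by apply: lt_le_trans N1. Qed.

Let w0 k : 0 <= wt h V zD zC k. Proof. by have /andP[] := wt_bounds h V zD zC k. Qed.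

(* The first four bounds control the ridge estimates in every coordinate; the
   last one is a Bernstein bound along the single direction [v], with [t] its
   exponent and [m] the level at which the weights are truncated. *)
Record stage_good (E t m l : R) (v : 'cV[R]_d) : Prop := StageGood {
  good_Sigma : forall i j,
    `|\sum_(k < K) 1 * phiC zC k i 0 * phiC zC k j 0 - K%:R * Sig i j| <= E;
  good_Lambda : forall i j,
    `|\sum_(k < K) (sigma h (zD k).1.1) ^-2 * phiD zD k i 0 * phiD zD k j 0 - K%:R * Lam i j| <= E;
  good_moment : forall p i, (1 <= p <= 2)%N ->
    `|\sum_(k < K) (V (zC k).2 ^+ p - PV P h (fun s => V s ^+ p) (zC k).1.1) * phiC zC k i 0|
      <= N ^+ p * E;
  good_noise : forall i,
    `|\sum_(k < K) wt h V zD zC k * xi h V zD k * phiD zD k i 0| <= N * E;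
  good_target :
    `|\sum_(k < K) t * clip (- m) m (lev h V zD zC v k) * xi h V zD k| <=
      2 * (\sum_(k < K) (t * clip (- m) m (lev h V zD zC v k)) ^+ 2 *
            (1 + VarV P h V (zD k).1.1)) + l
}.

Variables (E t m l : R) (v : 'cV[R]_d).
Hypothesis good : stage_good E t m l v.
Hypothesis V_close : forall s, `|Vstar h.+1 s - V s| <= 1.
Hypothesis K0 : (0 < K)%N.
Hypothesis kappa0 : 0 < kappa.
Hypothesis E0 : 0 <= E.
Hypothesis E_kappa : E * d%:R <= K%:R * kappa / 2.
Hypothesis E_iota : E * d%:R <= K%:R * iota / 2.
Hypothesis E_moment : (Num.sqrt d%:R + Num.sqrt d%:R * E) * N ^+ 2 * 6 <= K%:R * kappa.

Let K0' : 0 < K%:R :> R. Proof. by rewrite ltr0n. Qed.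

Let iota0 : 0 < iota.
Proof.
by apply: lt_le_trans (iota_ge_kappa kappa0); rewrite divr_gt0 ?mulr_gt0 ?exprn_gt0.
Qed.

Lemma gramC_ge x : K%:R * kappa / 2 * dotv x x <= dotv x (gram (phiC zC) (fun=> 1) *m x).
Proof.
rewrite gram_quad; have h1 := empirical_lower x (good_Sigma good) Sigma_ge E_kappa.
have h2 := ler_wpM2l (ltW K0') (Sigma_ge x).
have := dotv_ge0 x; lra.
Qed.

(** The bias is at most sqrt d N^p and the noise N^p E in each coordinate; [E_moment] turns this
    into 1/3 for p = 2 and 1/(3 N) for p = 1, the accuracies that [variance_estimate] asks for. *)
Lemma moment_hat_close p sa : (1 <= p <= 2)%N ->
  `|dotv (phi sa) (moment_hat V zC p) - PV P h (fun s => V s ^+ p) sa| <= N ^+ p / (3 * N ^+ 2).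
Proof.
move=> hp; have bVp := bmfX p bV; set th := muV mup mum h (fun s => V s ^+ p).
have m0 : 0 < K%:R * kappa / 2 by apply: divr_gt0 (mulr_gt0 K0' kappa0) _.
have Np0 : 0 < N ^+ p by rewrite exprn_gt0.
have e0 : 0 <= N ^+ p * E by rewrite mulr_ge0 // ltW.
have tha : vnorm th <= Num.sqrt d%:R * N ^+ p.
  apply: (vnorm_muV mdp hH) => //; first by case: bVp.
  by move=> s; rewrite normrX lerXn2r ?nnegrE // ltW.
have he i : `|\sum_(k < K) 1 * (V (zC k).2 ^+ p - dotv (phiC zC k) th) * phiC zC k i 0| <= N ^+ p * E.
  apply: le_trans (good_moment good i hp); apply: eq_ler.
  by congr `|_|; apply: eq_bigr => k _; rewrite mul1r (PV_dotv mdp).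
have := @ridge_pointwise _ _ _ (phiC zC) (fun=> 1) (fun=> ler01) (fun k => V (zC k).2 ^+ p)
  th (phi sa) _ _ _ m0 e0 gramC_ge he (vnorm_phi_le1 mdp sa) tha.
rewrite dotvBr -/(moment_hat V zC p) distrC -(PV_dotv mdp) // => /le_trans; apply.
rewrite ler_pdivrMr // mulrAC ler_pdivlMr ?mulr_gt0 ?exprn_gt0 //.
have := ler_wpM2l (ltW Np0) E_moment; lra.
Qed.

Lemma sig2_sandwich sa :
  1 + VarV P h V sa <= 2 * sig2 h V zC sa /\ sig2 h V zC sa <= 4 * sigma h sa ^+ 2.
Proof.
rewrite sqr_sigma; have p2 := P1 sa.
apply: (variance_sandwich (est := clip 0 (N ^+ 2) (dotv (phi sa) (moment_hat V zC 2))
             - clip 0 N (dotv (phi sa) (moment_hat V zC 1)) ^+ 2)).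
- have hb := moment_hat_close sa (isT : (1 <= 2 <= 2)%N).
  have hth := moment_hat_close sa (isT : (1 <= 1 <= 2)%N).
  have VE : (fun s => V s ^+ 1) = V by apply/funext => s; rewrite expr1.
  rewrite VE in hth; rewrite /VarV.
  apply: variance_estimate => //.
  + apply: (bmf_Rintegral_bounds p2 (bmfX 2 bV)) => s.
    by rewrite sqr_ge0 /= -(real_normK (num_real (V s))) lerXn2r ?nnegrE // ltW.
  + exact: (bmf_Rintegral_bounds p2 bV).
  + apply: le_trans hb _; apply: eq_ler.
    by field; rewrite gt_eqF.
  + apply: le_trans hth _; apply: eq_ler.
    by field; rewrite gt_eqF.
- exact: (var_ge0 p2 bV).
- by apply: (var_perturb p2 bV bVstar) => s; rewrite distrC.
Qed.

(** Half of the mean survives sampling, and a quarter of each weight survives replacing sigma by its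
    estimate, whence 1/8. *)
Lemma gramD_ge x : K%:R / 8 * dotv x (Lam *m x) <= dotv x (gram (phiD zD) (wt h V zD zC) *m x).
Proof.
rewrite gram_quad; have h1 := empirical_lower x (good_Lambda good) Lambda_ge E_iota.
have : \sum_(k < K) (sigma h (zD k).1.1) ^-2 * dotv (phiD zD k) x ^+ 2 <=
    4 * \sum_(k < K) wt h V zD zC k * dotv (phiD zD k) x ^+ 2.
  rewrite mulr_sumr; apply: ler_sum => k _; rewrite mulrA ler_wpM2r ?sqr_ge0 //.
  have [_ h4] := sig2_sandwich (zD k).1.1.
  have /andP[s2 _] := sqr_sigma_bounds (zD k).1.1.
  have g2 := sig2_ge2 h V zC (zD k).1.1.
  rewrite /wt ler_pdivlMr; last by lra.
  by rewrite mulrC ler_pdivrMr //; lra.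
have := dotv_ge0 x; lra.
Qed.

Lemma gramD_ge_iota x : K%:R * iota / 8 * dotv x x <= dotv x (gram (phiD zD) (wt h V zD zC) *m x).
Proof.
apply: le_trans (gramD_ge x); have := ler_wpM2l (ltW K0') (Lambda_ge x); lra.
Qed.

Let wbar := gam h + muV mup mum h V.

Let wbar_le : vnorm wbar <= 2 * (Num.sqrt d%:R * N).
Proof.
apply: le_trans (vnormD _ _) _.
have h1 := vnorm_muV mdp hH N0 mV V_le.
have h2 := vnorm_gam_le1 mdp hH.
have sd1 : 1 <= Num.sqrt d%:R :> R by rewrite -{1}sqrtr1 ler_sqrt ?ler1n.
have : 1 <= Num.sqrt d%:R * N by rewrite -[leLHS]mulr1 ler_pM.
lra.
Qed.

Let residual k : r h (zD k).1.1 + (zD k).1.2 + V (zD k).2 - dotv (phiD zD k) wbar = xi h V zD k.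
Proof. by rewrite /wbar dotvDr -(PV_dotv mdp) // /xi /phiD /r; ring. Qed.

Lemma stage_pointwise sa :
  `|dotv (phi sa) (wbar - w_hat h V zD zC)| <=
    (2 * (Num.sqrt d%:R * N) + Num.sqrt d%:R * (N * E)) / (K%:R * iota / 8).
Proof.
apply: ridge_pointwise => //.
- by rewrite divr_gt0 ?mulr_gt0.
- by rewrite mulr_ge0 // ltW.
- exact: gramD_ge_iota.
- by move=> i; under eq_bigr do rewrite residual; exact: good_noise good i.
- exact: vnorm_phi_le1 mdp sa.
Qed.

Let B := Mnorm (invmx Lam) v.

Let Mnorm_v : Mnorm (invmx (gram (phiD zD) (wt h V zD zC))) v <= B / Num.sqrt (K%:R / 8).
Proof.
apply: (Mnorm_inv_le v _ iota0 (gram_sym _ _) Lambda_sym Lambda_ge gramD_ge).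
by rewrite divr_gt0.
Qed.

Let Mnorm_iota x : Mnorm (invmx (gram (phiD zD) (wt h V zD zC))) x <= vnorm x / Num.sqrt (K%:R * iota / 8).
Proof.
apply: Mnorm_inv_vnorm; [|exact: gram_sym|exact: gramD_ge_iota].
by rewrite divr_gt0 ?mulr_gt0.
Qed.

Let B0 : 0 <= B. Proof. exact: Mnorm_ge0. Qed.

Let pG := psd_invgram (phiD zD) w0.

Let sqrt_prod : Num.sqrt (K%:R / 8) * Num.sqrt (K%:R * iota / 8) = K%:R * Num.sqrt iota / 8.
Proof.
rewrite -sqrtrM ?divr_ge0 // (_ : _ * _ = (K%:R / 8) ^+ 2 * iota); last by field.
rewrite sqrtrM ?sqr_ge0 // sqrtr_sqr ger0_norm ?divr_ge0 //; ring.
Qed.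

Let sqi0 : 0 < Num.sqrt iota. Proof. by rewrite sqrtr_gt0. Qed.

(** The direction v is measured sharply, in the norm of Lambda_h^-1; the other vector only through
    the smallest eigenvalue. *)
Let Mnorm_mul x : Mnorm (invmx (gram (phiD zD) (wt h V zD zC))) v *
   Mnorm (invmx (gram (phiD zD) (wt h V zD zC))) x <= 8 * B * vnorm x / (K%:R * Num.sqrt iota).
Proof.
apply: le_trans (ler_pM _ _ Mnorm_v (Mnorm_iota x)) _; rewrite ?Mnorm_ge0 //.
rewrite mulrACA -invfM sqrt_prod; apply: eq_ler.
by field; rewrite !gt_eqF.
Qed.

(** The factor 8 of [Mnorm_mul] is halved by the weight. This bound becomes the truncation level. *)
Lemma lev_bound k : `|lev h V zD zC v k| <= 4 * B / (K%:R * Num.sqrt iota).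
Proof.
have /andP[_ w1] := wt_bounds h V zD zC k.
rewrite /lev normrM (ger0_norm (w0 k)).
apply: (@le_trans _ _ (8 * B * 1 / (K%:R * Num.sqrt iota) * (1 / 2))).
  apply: ler_pM => //; apply: le_trans (ler_dotv_Mnorm _ _ pG) _.
  apply: le_trans (Mnorm_mul _) _.
  rewrite ler_wpM2r ?invr_ge0 ?mulr_ge0 ?sqrtr_ge0 // ler_wpM2l ?mulr_ge0 //.
  exact: vnorm_phi_le1 mdp _.
by apply: eq_ler; field; rewrite !gt_eqF.
Qed.

(** With a the leverage before weighting, the sandwich bounds a^2 wt^2 (1 + Var) by 2 a^2 wt, and
    the sum of a^2 wt is at most |v|^2 in the inverse Gram norm, itself at most 8 B^2 / K. *)
Lemma lev_variance : \sum_(k < K) lev h V zD zC v k ^+ 2 * (1 + VarV P h V (zD k).1.1) <=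
  16 * B ^+ 2 / K%:R.
Proof.
apply: (@le_trans _ _ (2 * Mnorm (invmx (gram (phiD zD) (wt h V zD zC))) v ^+ 2)).
  apply: le_trans (ler_wpM2l _ (sum_sqr_leverage (phiD zD) w0 v)); last by [].
  rewrite mulr_sumr; apply: ler_sum => k _.
  have [h2 _] := sig2_sandwich (zD k).1.1; have g2 := sig2_ge2 h V zC (zD k).1.1.
  have g0 : 0 < sig2 h V zC (zD k).1.1 by lra.
  set a := dotv v _.
  apply: (@le_trans _ _ (lev h V zD zC v k ^+ 2 * (2 * sig2 h V zC (zD k).1.1))).
    by rewrite ler_wpM2l ?sqr_ge0.
  apply: eq_ler.
  by rewrite /lev -/a /wt; field; rewrite gt_eqF.
apply: (@le_trans _ _ (2 * (B / Num.sqrt (K%:R / 8)) ^+ 2)).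
  by rewrite ler_pM2l // lerXn2r ?nnegrE ?Mnorm_ge0 ?divr_ge0 ?sqrtr_ge0.
have sK : Num.sqrt (K%:R / 8) ^+ 2 = K%:R / 8 :> R by apply: sqr_sqrtr; rewrite divr_ge0.
rewrite exprMn exprVn sK; apply: eq_ler.
by field; rewrite gt_eqF.
Qed.

(** Divided by t, the tail bound reads 2 t V0 + l / t; the choice of t makes this at most 3 q l + 2
    N m l with q l = 4 B sqrt (l / K), hence 12 and 8. The regularisation adds 16, as |wbar| <= 2
    sqrt d N. *)
Lemma stage_target : 1 <= l -> m = 4 * B / (K%:R * Num.sqrt iota) ->
  t = (Num.sqrt (16 * B ^+ 2 / K%:R / l) + 2 * N * m)^-1 ->
  `|dotv v (wbar - w_hat h V zD zC)| <=
    12 * B * Num.sqrt (l / K%:R) + 24 * (Num.sqrt d%:R * N) * B * l / (K%:R * Num.sqrt iota).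
Proof.
move=> l1 mE tE; have l0 : 0 < l by lra.
apply: le_trans (ridge_direction (phiD zD) w0 (fun k => r h (zD k).1.1 + (zD k).1.2 + V (zD k).2) wbar v) _.
have reg : Mnorm (invmx (gram (phiD zD) (wt h V zD zC))) v *
   Mnorm (invmx (gram (phiD zD) (wt h V zD zC))) wbar <=
   16 * (Num.sqrt d%:R * N) * B * l / (K%:R * Num.sqrt iota).
  apply: le_trans (Mnorm_mul _) _.
  rewrite ler_wpM2r ?invr_ge0 ?mulr_ge0 ?sqrtr_ge0 //.
  have h1 := ler_wpM2l (mulr_ge0 (ler0n R 8) B0) wbar_le.
  have h2 : 0 <= (Num.sqrt d%:R * N) * B * (l - 1).
    by rewrite !mulr_ge0 ?sqrtr_ge0 ?(ltW N0) // subr_ge0.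
  lra.
set X := \sum_(k < K) _.
have sd1 : 1 <= Num.sqrt d%:R :> R by rewrite -{1}sqrtr1 ler_sqrt ?ler1n.
suff mart : `|X| <= 12 * B * Num.sqrt (l / K%:R) + 8 * N * B * l / (K%:R * Num.sqrt iota).
  have h2 : 8 * N * B * l / (K%:R * Num.sqrt iota) <=
     8 * (Num.sqrt d%:R * N) * B * l / (K%:R * Num.sqrt iota).
    rewrite ler_wpM2r ?invr_ge0 ?mulr_ge0 ?sqrtr_ge0 //.
    have : 0 <= (Num.sqrt d%:R - 1) * N * B * l.
      by rewrite !mulr_ge0 ?(ltW N0) ?(ltW l0) // subr_ge0.
    lra.
  lra.
have XE : X = \sum_(k < K) lev h V zD zC v k * xi h V zD k.
  by apply: eq_bigr => k _; rewrite residual.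
have levC k : clip (- m) m (lev h V zD zC v k) = lev h V zD zC v k.
  by apply: clip_id; rewrite -ler_norml mE lev_bound.
have m0 : 0 <= m by rewrite mE !mulr_ge0 ?invr_ge0 ?mulr_ge0 ?sqrtr_ge0.
(* If B = 0 then t = 0^-1 = 0 and the tail bound is void, but all leverages vanish. *)
have [Bz|Bn0] := eqVneq B 0.
  rewrite XE big1 ?normr0; last first.
    move=> k _; have := lev_bound k; rewrite Bz mulr0 mul0r normr_le0 => /eqP ->.
    by rewrite mul0r.
  by rewrite Bz !(mulr0, mul0r) addr0.
have Bp : 0 < B by rewrite lt_neqAle eq_sym Bn0 B0.
set V0 := 16 * B ^+ 2 / K%:R.
have V00 : 0 < V0 by rewrite divr_gt0 ?mulr_gt0 ?exprn_gt0.
set q := Num.sqrt (V0 / l).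
have q0 : 0 < q by rewrite sqrtr_gt0 divr_gt0.
have q2 : q ^+ 2 * l = V0.
  have -> : q ^+ 2 = V0 / l by apply: sqr_sqrtr; rewrite divr_ge0 // ltW.
  by rewrite divfK // gt_eqF.
have s0 : 0 < q + 2 * N * m by rewrite ltr_pwDl // !mulr_ge0 ?(ltW N0).
have tp : 0 < t by rewrite tE invr_gt0.
have := good_target good; under eq_bigr do rewrite levC -mulrA.
under [in leRHS]eq_bigr do rewrite levC exprMn -mulrA.
rewrite -!mulr_sumr -XE normrM (gtr0_norm tp) => hX.
have hv := lev_variance; rewrite -/V0 in hv.
have h1 : t * `|X| <= 2 * (t ^+ 2 * V0) + l.
  by apply: le_trans hX _; rewrite lerD2r ler_pM2l // ler_pM2l ?exprn_gt0.
have h2 : `|X| <= 2 * (t * V0) + l / t.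
  rewrite -(ler_pM2l tp) (le_trans h1) //; apply: eq_ler.
  by field; rewrite gt_eqF.
have h3 : t * V0 <= q * l.
  rewrite tE -/V0 -/q mulrC ler_pdivrMr // -q2.
  have : 0 <= q * l * (2 * N * m) by rewrite !mulr_ge0 ?(ltW N0) ?(ltW q0) ?(ltW l0).
  lra.
have h4 : l / t = q * l + 2 * N * m * l by rewrite tE -/V0 -/q invrK; ring.
have h5 : q * l = 4 * (B * Num.sqrt (l / K%:R)).
  apply/eqP; rewrite -(@eqrXn2 _ 2) ?mulr_ge0 ?sqrtr_ge0 ?(ltW q0) ?(ltW l0) //; apply/eqP.
  rewrite !exprMn (_ : Num.sqrt (l / K%:R) ^+ 2 = l / K%:R); last by rewrite sqr_sqrtr // divr_ge0 // ltW.
  have -> : q ^+ 2 * l ^+ 2 = V0 * l by rewrite -q2; ring.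
  by rewrite /V0; ring.
have h6 : 2 * N * m * l = 8 * N * B * l / (K%:R * Num.sqrt iota) by rewrite mE; ring.
lra.
Qed.

End good_stage.

End analysis.

End Stage.

(** * High-probability events *)

Section HighProbability.
Context dO (Omega : measurableType dO) (R : realType) (Pr : probability Omega R).

(* [Q] need not be measurable: it only has to hold off a measurable set of
   probability at most [p]. *)
Definition whp (p : R) (Q : Omega -> Prop) :=
  exists U : set Omega, [/\ measurable U, (Pr U <= p%:E)%E & forall w, ~ U w -> Q w].

Lemma whp_weaken p p' (Q Q' : Omega -> Prop) : p <= p' ->
  (forall w, Q w -> Q' w) -> whp p Q -> whp p' Q'.
Proof.
move=> pp QQ [U [mU PU hU]]; exists U; split=> [//||w /hU /QQ //].
by apply: le_trans PU _; rewrite lee_fin.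
Qed.

Lemma whp_and p p' (Q Q' : Omega -> Prop) : whp p Q -> whp p' Q' ->
  whp (p + p') (fun w => Q w /\ Q' w).
Proof.
move=> [U [mU PU hU]] [U' [mU' PU' hU']]; exists (U `|` U'); split.
- exact: measurableU.
- by apply: le_trans (measureU2 _ _ _) _ => //; rewrite EFinD; exact: leeD.
- by move=> w h; split; [apply: hU|apply: hU'] => h'; apply: h; [left|right].
Qed.

Lemma whp_true (Q : Omega -> Prop) : (forall w, Q w) -> whp 0 Q.
Proof. by move=> h; exists set0; split=> //; rewrite measure0. Qed.

Lemma whp_seq (J : eqType) (js : seq J) (p : R) (Q : J -> Omega -> Prop) :
  (forall j, j \in js -> whp p (Q j)) ->
  whp ((size js)%:R * p) (fun w => forall j, j \in js -> Q j w).
Proof.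
elim: js => [|j js IH] h; first by rewrite mul0r; exact: whp_true.
have h1 := h j (mem_head _ _).
have h2 : forall j', j' \in js -> whp p (Q j') by move=> j' hj; apply: h; rewrite in_cons hj orbT.
apply: whp_weaken (whp_and h1 (IH h2)); first by rewrite /= -natr1 mulrDl mul1r addrC.
by move=> w [hj hjs] j'; rewrite in_cons => /orP[/eqP->//|]; exact: hjs.
Qed.

Lemma whp_fin (J : finType) (p : R) (Q : J -> Omega -> Prop) :
  (forall j, whp p (Q j)) -> whp (#|J|%:R * p) (fun w => forall j, Q j w).
Proof.
move=> h; rewrite cardE; apply: whp_weaken (whp_seq (js := enum J) (fun j _ => h j)) => //.
by move=> w hw j; apply: hw; rewrite mem_enum.
Qed.

Lemma whp_with_prob p delta (Q : Omega -> Prop) : p <= delta -> whp p Q ->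
  with_prob_at_least Pr (1 - delta) [set w | Q w].
Proof.
move=> pd [U [mU PU hU]]; exists (~` U); split=> [|w /= /hU //|]; first exact: measurableC.
rewrite probability_setC // EFinB leeB // (le_trans PU) // lee_fin //.
Qed.

End HighProbability.

(** * Measurability of matrix expressions *)

Section MatrixMeasurability.
Context dZ (Z : measurableType dZ) (R : realType).

Definition mxm m n (M : Z -> 'M[R]_(m, n)) :=
  forall i j, measurable_fun setT (fun z => M z i j).

Lemma measurable_prodr (J : Type) (js : seq J) (F : J -> Z -> R) :
  (forall j, measurable_fun setT (F j)) ->
  measurable_fun setT (fun z => \prod_(j <- js) F j z).
Proof.
move=> h; elim: js => [|j js IH]; first by under eq_fun do rewrite big_nil; exact: measurable_cst.
by under eq_fun do rewrite big_cons; exact: measurable_funM.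
Qed.

Lemma mxm_cst m n (M : 'M[R]_(m, n)) : mxm (fun=> M).
Proof. by move=> i j; exact: measurable_cst. Qed.

Lemma mxmD m n (M N : Z -> 'M[R]_(m, n)) : mxm M -> mxm N -> mxm (fun z => M z + N z).
Proof. by move=> hM hN i j; under eq_fun do rewrite mxE; exact: measurable_funD. Qed.

Lemma mxmZ m n (c : Z -> R) (M : Z -> 'M[R]_(m, n)) : measurable_fun setT c -> mxm M ->
  mxm (fun z => c z *: M z).
Proof. by move=> hc hM i j; under eq_fun do rewrite mxE; exact: measurable_funM. Qed.

Lemma mxm_sum m n (J : Type) (js : seq J) (F : J -> Z -> 'M[R]_(m, n)) :
  (forall j, mxm (F j)) -> mxm (fun z => \sum_(j <- js) F j z).
Proof.
by move=> h i j; under eq_fun do rewrite summxE; apply: measurable_sum => k; exact: h.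
Qed.

Lemma mxmM m n p (M : Z -> 'M[R]_(m, n)) (N : Z -> 'M[R]_(n, p)) : mxm M -> mxm N ->
  mxm (fun z => M z *m N z).
Proof.
move=> hM hN i j; under eq_fun do rewrite mxE.
by apply: measurable_sum => k; exact: measurable_funM.
Qed.

Lemma mxm_tr m n (M : Z -> 'M[R]_(m, n)) : mxm M -> mxm (fun z => (M z)^T).
Proof. by move=> hM i j; under eq_fun do rewrite mxE; exact: hM. Qed.

Lemma measurable_det n (M : Z -> 'M[R]_n) : mxm M -> measurable_fun setT (fun z => \det (M z)).
Proof.
move=> hM; apply: measurable_sum => s; apply: measurable_funM => //.
by apply: measurable_prodr => i; exact: hM.
Qed.

(** Cramer's formula: the determinant and the cofactors are polynomials in the entries. *)
Lemma mxm_invmx n (M : Z -> 'M[R]_n) : (forall z, M z \in unitmx) -> mxm M ->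
  mxm (fun z => invmx (M z)).
Proof.
move=> uM hM i j; under eq_fun do rewrite /invmx uM 2!mxE.
apply: measurable_funM; first exact/measurable_invr/measurable_det.
apply: measurable_funM => //; apply: measurable_det => a b.
by under eq_fun do rewrite !mxE; exact: hM.
Qed.

Lemma measurable_dotv n (x y : Z -> 'cV[R]_n) : mxm x -> mxm y ->
  measurable_fun setT (fun z => dotv (x z) (y z)).
Proof. by move=> hx hy; apply: measurable_sum => i; exact: measurable_funM. Qed.

Lemma mxm_gram n K (f : Z -> 'I_K -> 'cV[R]_n) (c : Z -> 'I_K -> R) :
  (forall k, mxm (fun z => f z k)) -> (forall k, measurable_fun setT (fun z => c z k)) ->
  mxm (fun z => gram (f z) (c z)).
Proof.
move=> hf hc; apply: mxmD; last exact: mxm_cst.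
by apply: mxm_sum => k; apply: mxmZ => //; apply: mxmM => //; exact: mxm_tr.
Qed.

Lemma mxm_ridge n K (f : Z -> 'I_K -> 'cV[R]_n) (c y : Z -> 'I_K -> R) :
  (forall z k, 0 <= c z k) ->
  (forall k, mxm (fun z => f z k)) -> (forall k, measurable_fun setT (fun z => c z k)) ->
  (forall k, measurable_fun setT (fun z => y z k)) ->
  mxm (fun z => invmx (gram (f z) (c z)) *m \sum_(k < K) ((c z k * y z k) *: f z k)).
Proof.
move=> c0 hf hc hy; apply: mxmM.
  by apply: mxm_invmx; [move=> z; exact: gram_unit|exact: mxm_gram].
by apply: mxm_sum => k; apply: mxmZ => //; exact: measurable_funM.
Qed.

End MatrixMeasurability.

Section ParametricIntegral.
Context dZ dS (Z : measurableType dZ) (S : measurableType dS) (R : realType).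

Lemma measurable_Rintegral_param (m : {finite_measure set S -> \bar R}) (V : Z -> S -> R) M :
  measurable_fun setT (fun zs : Z * S => V zs.1 zs.2) -> (forall z s, `|V z s| <= M) ->
  measurable_fun setT (fun z => Rintegral m setT (V z)).
Proof.
move=> mV hM.
have mVz z : measurable_fun setT (V z).
  have mp : measurable_fun setT (fun s : S => (z, s)).
    by apply/measurable_fun_pairP; split; [exact: measurable_cst|exact: measurable_id].
  exact: measurableT_comp mV mp.
have bV z : bmf (V z) by split=> //; exists M.
have bc := @bmf_cst _ S R M.
rewrite (_ : (fun z => _) = (fun z => fine (\int[m]_s (V z s + M)%:E)%E - Rintegral m setT (fun=> M))).
  apply: measurable_funB => //; apply: measurableT_comp => //.
  apply: (measurable_fun_fubini_tonelli_F (fun zs : Z * S => (V zs.1 zs.2 + M)%:E)).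
    by apply/measurable_EFinP; exact: measurable_funD.
  by move=> zs; have := hM zs.1 zs.2; rewrite ler_norml lee_fin; lra.
apply/funext => z; rewrite -[fine _]/(Rintegral m setT (fun s => V z s + M)).
by rewrite RintegralD ?addrK //; exact: fin_integrable.
Qed.

End ParametricIntegral.

(** * Measurability of the estimators in the data *)

Section StageMeasurability.
Variables (R : realType) (dS dA : measure_display).
Variables (S : measurableType dS) (A : measurableType dA).
Variables (d H : nat).
Variables (phi : S * A -> 'cV[R]_d) (gam : nat -> 'cV[R]_d).
Variable P : nat -> R.-pker (S * A)%type ~> S.
Variables (mup mum : nat -> 'I_d -> {finite_measure set S -> \bar R}).
Variable pi : nat -> R.-pker S ~> A.
Variable K : nat.
Let r h sa := dotv (phi sa) (gam h).
Local Notation sample := ((S * A) * R * S)%type.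
Hypothesis mdp : linear_mdp H phi gam P mup mum.

Context dZ (Z : measurableType dZ).

Lemma mxm_phi (sa : Z -> S * A) : measurable_fun setT sa -> mxm (fun z => phi (sa z)).
Proof.
move=> msa i j; rewrite (_ : j = 0); last by apply/ord1.
exact: measurableT_comp (measurable_phi mdp i) msa.
Qed.

Lemma mxm_phi_pol h (s : Z -> S) : measurable_fun setT s -> mxm (fun z => phi_pol phi pi h (s z)).
Proof.
move=> ms i j; rewrite (_ : j = 0); last by apply/ord1.
have [m1 _] := bmf_kernel (polk pi h) (bmf_phi mdp i).
rewrite (_ : (fun z => _) = (fun z => Rintegral (polk pi h (s z)) setT (fun sa => phi sa i 0))).
  exact: measurableT_comp m1 ms.
by apply/funext => z; rewrite mxE Rintegral_polk //; exact: bmf_phi mdp i.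
Qed.

Section stage.
Variables (h : nat) (V : Z -> S -> R) (zD zC : Z -> 'I_K -> sample).
Hypothesis mV : measurable_fun setT (fun zs : Z * S => V zs.1 zs.2).
Hypothesis mD : forall k, measurable_fun setT (fun z => zD z k).
Hypothesis mC : forall k, measurable_fun setT (fun z => zC z k).

Let msa (zz : Z -> 'I_K -> sample) k : measurable_fun setT (fun z => zz z k) ->
  measurable_fun setT (fun z => (zz z k).1.1).
Proof.
by move=> m; exact: measurableT_comp measurable_fst (measurableT_comp measurable_fst m).
Qed.

Let meps (zz : Z -> 'I_K -> sample) k : measurable_fun setT (fun z => zz z k) ->
  measurable_fun setT (fun z => (zz z k).1.2).
Proof.
by move=> m; exact: measurableT_comp measurable_snd (measurableT_comp measurable_fst m).
Qed.

Let mnext (zz : Z -> 'I_K -> sample) k : measurable_fun setT (fun z => zz z k) ->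
  measurable_fun setT (fun z => (zz z k).2).
Proof. by move=> m; exact: measurableT_comp measurable_snd m. Qed.

Lemma measurable_eval (s : Z -> S) : measurable_fun setT s ->
  measurable_fun setT (fun z => V z (s z)).
Proof.
move=> ms; have mp : measurable_fun setT (fun z => (z, s z)).
  by apply/measurable_fun_pairP; split=> //; exact: measurable_id.
exact: measurableT_comp mV mp.
Qed.

Lemma mxm_moment_hat p : mxm (fun z => moment_hat phi (V z) (zC z) p).
Proof.
apply: mxm_ridge => //; first by move=> k; apply/mxm_phi/msa.
by move=> k; apply/measurable_funX/measurable_eval/mnext.
Qed.

Lemma measurable_sig2 (sa : Z -> S * A) : measurable_fun setT sa ->
  measurable_fun setT (fun z => sig2 H phi h (V z) (zC z) (sa z)).
Proof.
move=> m; apply: measurable_funD => //; apply: measurable_maxr => //.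
apply: measurable_funB; first by apply/measurable_clip/measurable_dotv; [exact: mxm_phi|exact: mxm_moment_hat].
by apply/measurable_funX/measurable_clip/measurable_dotv; [exact: mxm_phi|exact: mxm_moment_hat].
Qed.

Lemma measurable_wt k : measurable_fun setT (fun z => wt H phi h (V z) (zD z) (zC z) k).
Proof. by apply/measurable_invr/measurable_sig2/msa. Qed.

Lemma measurable_lev v k : measurable_fun setT (fun z => lev H phi h (V z) (zD z) (zC z) v k).
Proof.
have mphiD j : mxm (fun z => phiD phi (zD z) j) by apply/mxm_phi/msa.
apply: measurable_funM; last exact: measurable_wt.
apply: measurable_dotv; first exact: mxm_cst.
apply: mxmM => //; apply: mxm_invmx.
  by move=> z; apply: gram_unit => j; have /andP[] := wt_bounds H phi h (V z) (zD z) (zC z) j.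
by apply: mxm_gram => // j; exact: measurable_wt.
Qed.

Lemma mxm_w_hat : mxm (fun z => w_hat H phi gam h (V z) (zD z) (zC z)).
Proof.
apply: mxm_ridge.
- by move=> z k; have /andP[] := wt_bounds H phi h (V z) (zD z) (zC z) k.
- by move=> k; apply/mxm_phi/msa.
- by move=> k; exact: measurable_wt.
- move=> k; apply: measurable_funD; last exact/measurable_eval/mnext.
  apply: measurable_funD; last exact: meps.
  by apply: measurable_dotv; [apply/mxm_phi/msa|exact: mxm_cst].
Qed.

(** Both the function and the pair vary with z; the linear structure separates them into features
    and integrals of W against fixed measures. *)
Lemma measurable_PV_param (W : Z -> S -> R) (sa : Z -> S * A) M : (1 <= h <= H)%N ->
  measurable_fun setT (fun zs : Z * S => W zs.1 zs.2) ->
  (forall z s, `|W z s| <= M) ->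
  measurable_fun setT sa -> measurable_fun setT (fun z => PV P h (W z) (sa z)).
Proof.
move=> hH mW hM ms.
have bW z : bmf (W z).
  have mp : measurable_fun setT (fun s : S => (z, s)).
    by apply/measurable_fun_pairP; split; [exact: measurable_cst|exact: measurable_id].
  by split; [exact: measurableT_comp mW mp|exists M].
rewrite (_ : (fun z => _) = (fun z => dotv (phi (sa z)) (muV mup mum h (W z)))); last first.
  by apply/funext => z; rewrite (PV_dotv mdp).
apply: measurable_dotv; first exact: mxm_phi.
by move=> i j; under eq_fun do rewrite mxE; apply: measurable_funB; exact: measurable_Rintegral_param hM.
Qed.

End stage.
End StageMeasurability.

(** * Tail bounds within one stage *)

Section Tails.
Variables (R : realType) (dS dA dO : measure_display).
Variables (S : measurableType dS) (A : measurableType dA) (Omega : measurableType dO).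
Variable P : nat -> R.-pker (S * A)%type ~> S.
Variables (H K : nat).
Variable nu : nat -> {measure set (S * A) -> \bar R}.
Variable noise : nat -> probability R R.
Variable Pr : probability Omega R.
Local Notation sample := ((S * A) * R * S)%type.
Variable X : bool -> nat -> 'I_K -> Omega -> sample.
Local Notation I := (bool * 'I_H * 'I_K)%type.
Hypothesis mX : forall b h k, measurable_fun setT (X b h k).
Hypothesis noiseP : forall h, (1 <= h <= H)%N ->
  (\int[noise h]_e e%:E = 0)%E /\ noise h [set e | 1 < `|e|] = 0%E.
Hypothesis lawX : forall b h k, (1 <= h <= H)%N ->
  forall B1 Be B2, measurable B1 -> measurable Be -> measurable B2 ->
    Pr (X b h k @^-1` [set z | B1 z.1.1 /\ Be z.1.2 /\ B2 z.2]) =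
    ((\int[nu h]_(sa in B1) P h sa B2) * noise h Be)%E.
Definition XI (t : I) := X t.1.1 (t.1.2).+1 t.2.
Hypothesis indX : mutual_indep Pr XI.

Definition sampleX (w : Omega) : arrays sample I := XI ^~ w.

Let mXI t : measurable_fun setT (XI t). Proof. exact: mX. Qed.

Section stage.
Variables (b : bool) (i : 'I_H).
Let h := i.+1.
Let hH : (1 <= h <= H)%N. Proof. exact: ltn_ord. Qed.
Let tk (k : 'I_K) : I := (b, i, k).

Lemma whp_sum_tail (rhoT : Type) (rho : sample -> rhoT) (y : 'I_K -> arrays sample I -> R) l :
  (forall k, measurable_fun setT (y k)) ->
  (forall j k x z z', j != k -> rho z = rho z' ->
    y j (upd x (tk k) z) = y j (upd x (tk k) z')) ->
  (forall k x (G : sample -> \bar R), measurable_fun setT G -> (forall z, (0 <= G z)%E) ->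
    (forall z z', rho z = rho z' -> G z = G z') ->
    (\int[Pr]_w ((expR (y k (upd x (tk k) (X b h k w))))%:E * G (X b h k w)) <=
     \int[Pr]_w G (X b h k w))%E) ->
  whp Pr (expR (- l)) (fun w => \sum_(k < K) y k (sampleX w) < l).
Proof.
(* The dependence restriction is imposed only inside the block of one dataset at one stage; all
   other samples may enter arbitrarily. *)
move=> my yp ymgf; pose J : {pred I} := [pred t | t.1 == (b, i)].
pose ts : seq I := [seq tk k | k <- enum 'I_K].
have uts : uniq ts by rewrite map_inj_uniq ?enum_uniq // => ? ? [].
have tsJ : {subset ts <= J} by move=> t /mapP[k _ ->]; rewrite inE.
have := @exp_sum_tail _ _ _ _ _ _ Pr XI mXI indX _ rho (fun t => y t.2)
  (fun t => my t.2) J _ _ ts l uts tsJ.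
have -> : [set w | l <= \sum_(t <- ts) y t.2 (XI ^~ w)] = [set w | l <= \sum_(k < K) y k (sampleX w)].
  apply/seteqP; split=> w /=; rewrite /ts big_map big_enum //.
move=> hU; exists [set w | l <= \sum_(k < K) y k (sampleX w)]; split.
- have mS : measurable_fun setT (fun w => \sum_(k < K) y k (sampleX w)).
    apply: measurable_sum => k; apply: measurableT_comp (my k) _.
    exact: measurable_arrays.
  rewrite -[X in measurable X]setTI -[X in _ `&` X]/((fun w => \sum_(k < K) y k (sampleX w)) @^-1` [set z | l <= z]).
  by rewrite -set_itvcy; exact: mS.
- apply: hU => [[[b1 i1] j] [[b2 i2] k] x z z'|[[b1 i1] k] x G].
    rewrite !inE /= => /eqP[-> ->] /eqP[-> ->] jk rz; apply: yp => //.
    by apply: contraNneq jk => ->.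
  by rewrite inE /= => /eqP[-> ->]; exact: ymgf.
- by move=> w /= /negP; rewrite -ltNge.
Qed.

(** Once the state-action pairs of the block are frozen, the weights [a], the variance bounds [v]
    and [f] no longer vary with its noise and next states, and each summand has mean zero before its
    variance term is subtracted. *)
Lemma whp_martingale (a v : 'I_K -> arrays sample I -> R) (f : arrays sample I -> S -> R) (c l : R) :
  (forall x, bmf (f x)) ->
  (forall k, measurable_fun setT (a k)) -> (forall k, measurable_fun setT (v k)) ->
  (forall k, measurable_fun setT (fun x : arrays sample I =>
     f x (x (tk k)).2 - PV P h (f x) (x (tk k)).1.1)) ->
  (forall k j x z z', z.1.1 = z'.1.1 ->
    [/\ a j (upd x (tk k) z) = a j (upd x (tk k) z'),
        v j (upd x (tk k) z) = v j (upd x (tk k) z') &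
        f (upd x (tk k) z) = f (upd x (tk k) z')]) ->
  (forall k x, `|a k x * c| <= 1) ->
  (forall k x s sa, `|a k x * (f x s - PV P h (f x) sa)| <= 1) ->
  (forall k x, VarV P h (f x) (x (tk k)).1.1 <= v k x) ->
  whp Pr (expR (- l)) (fun w => let x := sampleX w in
    \sum_(k < K) (a k x * (c * (x (tk k)).1.2 + (f x (x (tk k)).2 - PV P h (f x) (x (tk k)).1.1))
      - 2 * (a k x ^+ 2 * (c ^+ 2 + v k x))) < l).
Proof.
move=> bf ma mv mf pred hc hf hv.
pose y k (x : arrays sample I) := a k x * (c * (x (tk k)).1.2 + (f x (x (tk k)).2 - PV P h (f x) (x (tk k)).1.1))
      - 2 * (a k x ^+ 2 * (c ^+ 2 + v k x)).
have my k : measurable_fun setT (y k).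
  apply: measurable_funB.
    apply: measurable_funM => //; apply: measurable_funD => //.
    apply: measurable_funM => //.
    exact: measurableT_comp measurable_snd (measurableT_comp measurable_fst (measurable_coord (tk k))).
  by apply: measurable_funM => //; apply: measurable_funM; [exact: measurable_funX|exact: measurable_funD].
apply: (whp_sum_tail (rho := fun z => z.1.1) (y := y)) => //.
  move=> j k x z z' jk zz; have [ea ev ef] := pred k j x z z' zz.
  rewrite /y ea ev ef /upd (_ : (tk j == tk k) = false) //.
  by apply/eqP => -[] /eqP; rewrite (negbTE jk).
move=> k x G mG G0 Gz.
have [n0 n1] := noiseP hH.
apply: (@law_mgf _ _ _ _ _ _ _ Pr (nu h) (noise h) (P h) (X b h k) (mX b h k) (lawX b k hH)
  (fun z => y k (upd x (tk k) z)) G) => //.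
- by apply: measurableT_comp (my k) _; apply: measurable_upd.
- by move=> w e s e' s'; exact: Gz.
(* The noise and next state in [x0] are dummies: by [pred] the coefficients see only the pair. *)
move=> sa; pose x0 := upd x (tk k) ((sa, point), point).
have yE e s : y k (upd x (tk k) ((sa, e), s)) =
    a k x0 * (c * e + (f x0 s - Rintegral (P h sa) setT (f x0))) - 2 * (a k x0 ^+ 2 * (c ^+ 2 + v k x0)).
  have [ea ev ef] := pred k k x ((sa, e), s) ((sa, point), point) erefl.
  rewrite /y ea ev ef; have -> : upd x (tk k) ((sa, e), s) (tk k) = ((sa, e), s) by rewrite /upd eqxx.
  by [].
under eq_integral => e _.
  under eq_integral => s _ do rewrite yE.
  over.
apply: sample_mgf => //; first exact: prob_kernel.
- by move=> s; exact: hf.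
- by have := hv k x0; rewrite {2}/x0 /upd eqxx.
Qed.

Lemma whp_iid (g : S * A -> R) (a l : R) :
  bmf g -> (forall sa, `|a * (g sa - Rintegral (nu h) setT g)| <= 1) ->
  var (nu h) g <= 1 ->
  whp Pr (expR (- l)) (fun w =>
    \sum_(k < K) (a * (g (sampleX w (tk k)).1.1 - Rintegral (nu h) setT g) - 2 * a ^+ 2) < l).
Proof.
move=> bg hg vg.
pose y k (x : arrays sample I) := a * (g (x (tk k)).1.1 - Rintegral (nu h) setT g) - 2 * a ^+ 2.
have msa : measurable_fun setT (fun z : sample => z.1.1).
  exact: measurableT_comp measurable_fst measurable_fst.
have my k : measurable_fun setT (y k).
  apply: measurable_funB => //; apply: measurable_funM => //; apply: measurable_funB => //.
  apply: measurableT_comp bg.1 _.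
  exact: measurableT_comp msa (measurable_coord (tk k)).
(* Each summand depends on its own sample alone, so [rho] may forget everything and G is
   constant. *)
apply: (whp_sum_tail (rho := fun=> tt) (y := y)) => //.
  move=> j k x z z' jk zz; rewrite /y /upd (_ : (tk j == tk k) = false) //.
  by apply/eqP => -[] /eqP; rewrite (negbTE jk).
move=> k x G mG G0 Gz.
have nu1 : nu h setT = 1%E by exact: (law_mass1 (lawX b k hH)).
have yE z : y k (upd x (tk k) z) = a * (g z.1.1 - Rintegral (nu h) setT g) - 2 * a ^+ 2.
  by rewrite /y /upd eqxx.
pose F (z : sample) := (expR (a * (g z.1.1 - Rintegral (nu h) setT g) - 2 * a ^+ 2))%:E.
have mF : measurable_fun setT F.
  apply/measurable_EFinP; apply: measurableT_comp => //.
  apply: measurable_funB => //; apply: measurable_funM => //; apply: measurable_funB => //.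
  exact: measurableT_comp bg.1 msa.
have F0 z : (0 <= F z)%E by rewrite lee_fin expR_ge0.
have -> : (\int[Pr]_w G (X b h k w) = G point)%E.
  under eq_integral do rewrite (Gz _ point erefl).
  exact: (integral_mass1 _ (probability_setT Pr)).
under eq_integral do rewrite yE (Gz _ point erefl) muleC.
rewrite ge0_integralZl //; last exact: (measurableT_comp mF (mX b h k)).
rewrite -[leRHS]mule1 lee_wpmul2l //.
rewrite (integral_law (mX b h k) (lawX b k hH) mF F0).
rewrite (eq_integral (fun sa => (expR (- (2 * a ^+ 2)))%:E *
    (expR (a * (g sa - Rintegral (nu h) setT g)))%:E)%E); last first.
  move=> sa _; rewrite (integral_fiber _ _ _ mF F0) /F /= -EFinM -expRD [in RHS]addrC.
  transitivity (\int[noise h]__ (expR (a * (g sa - Rintegral (nu h) setT g) - 2 * a ^+ 2))%:E)%E.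
    by apply: eq_integral => e _; exact: (integral_mass1 _ (@prob_kernel _ _ _ _ _ (P h) sa)).
  exact: (integral_mass1 _ (probability_setT (noise h))).
have mE : measurable_fun setT (fun sa => (expR (a * (g sa - Rintegral (nu h) setT g)))%:E).
  apply/measurable_EFinP; apply: measurableT_comp => //.
  by apply: measurable_funM => //; apply: measurable_funB => //; case: bg.
rewrite ge0_integralZl_EFin ?expR_ge0 //.
apply: le_trans (lee_wpmul2l _ (centered_mgf nu1 bg hg vg)) _; first by rewrite lee_fin expR_ge0.
by rewrite -EFinM -expRD mulr1 addNr expR0.
Qed.

End stage.
End Tails.

(** * The algorithm as a function of the sample array *)

Section Algorithm.
Variables (R : realType) (dS dA dO : measure_display).
Variables (S : measurableType dS) (A : measurableType dA) (Omega : measurableType dO).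
Variables (d H K : nat).
Variables (phi : S * A -> 'cV[R]_d) (gam : nat -> 'cV[R]_d).
Variable P : nat -> R.-pker (S * A)%type ~> S.
Variables (mup mum : nat -> 'I_d -> {finite_measure set S -> \bar R}).
Variable pi : nat -> R.-pker S ~> A.
Variable nu : nat -> {measure set (S * A) -> \bar R}.
Variable noise : nat -> probability R R.
Variable Pr : probability Omega R.
Local Notation sample := ((S * A) * R * S)%type.
Variable X : bool -> nat -> 'I_K -> Omega -> sample.
Local Notation I := (bool * 'I_H * 'I_K)%type.
Let r h sa := dotv (phi sa) (gam h).
Hypothesis mdp : linear_mdp H phi gam P mup mum.
Hypothesis mX : forall b h k, measurable_fun setT (X b h k).
Hypothesis noiseP : forall h, (1 <= h <= H)%N ->
  (\int[noise h]_e e%:E = 0)%E /\ noise h [set e | 1 < `|e|] = 0%E.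
Hypothesis lawX : forall b h k, (1 <= h <= H)%N ->
  forall B1 Be B2, measurable B1 -> measurable Be -> measurable B2 ->
    Pr (X b h k @^-1` [set z | B1 z.1.1 /\ Be z.1.2 /\ B2 z.2]) =
    ((\int[nu h]_(sa in B1) P h sa B2) * noise h Be)%E.
Hypothesis indX : mutual_indep Pr (XI (H := H) X).

(* Stages are numbered from 1 in the algorithm and from 0 in ['I_H]; outside
   [1 .. H] the value is irrelevant. *)
Definition dsel (x : I -> sample) b h (k : 'I_K) : sample :=
  if insub h.-1 is Some j then x (b, j, k) else point.

Lemma dsel_ord x b (i : 'I_H) k : dsel x b i.+1 k = x (b, i, k).
Proof. by rewrite /dsel /= valK. Qed.

Definition dset x b : dataset R S A K :=
  fun h k => let z := dsel x b h k in (z.1.1, r h z.1.1 + z.1.2, z.2).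

Definition Vh (x : I -> sample) h : S -> R :=
  fqi_V H phi 1 (fun=> 1) 1 pi (dset x false) (dset x true) (H.+1 - h).

Lemma Vh_last x : Vh x H.+1 = fun=> 0.
Proof. by rewrite /Vh subnn. Qed.

Definition wh x h := w_hat H phi gam h (Vh x h.+1) (dsel x false h) (dsel x true h).

Lemma Vh_step x h : (1 <= h <= H)%N ->
  Vh x h = fun s => dotv (phi_pol phi pi h s) (wh x h).
Proof.
move=> /andP[h1 hH]; rewrite {1}/Vh subSn //= subKn //.
have <- : fqi_w H phi 1 (fun=> 1) 1 (dset x false) (dset x true) h (Vh x h.+1) = wh x h.
  exact: fqi_wE.
by [].
Qed.

(** The estimate at stage h reads only the stages from h on, so the samples of earlier stages are
    fresh for it. *)
Lemma Vh_ext x x' h : (1 <= h <= H.+1)%N ->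
  (forall b (j : 'I_H) k, (h <= j.+1)%N -> x (b, j, k) = x' (b, j, k)) -> Vh x h = Vh x' h.
Proof.
move=> /andP[h1 hH].
elim: {h}(H.+1 - h)%N {-2}h (erefl (H.+1 - h)%N) h1 hH => [|n IH] h hn h1 hH e.
  have -> : h = H.+1 by apply/eqP; rewrite eqn_leq hH -subn_eq0 hn.
  by rewrite !Vh_last.
have hH' : (h <= H)%N by rewrite -ltnS -subn_gt0 hn.
have hn' : (H.+1 - h.+1 = n)%N by rewrite subnS hn.
have hh : (1 <= h <= H)%N by rewrite h1.
have hP : (h.-1 < H)%N by rewrite prednK.
have eV : Vh x h.+1 = Vh x' h.+1.
  by apply: IH => // b j k hj; apply: e; exact: ltnW.
have ed b : dsel x b h = dsel x' b h.
  apply/funext => k; rewrite /dsel insubT; apply: e.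
  by rewrite /= prednK.
by rewrite !Vh_step // /wh eV !ed.
Qed.

Lemma measurable_dsel b h k : measurable_fun setT (fun x : arrays sample I => dsel x b h k).
Proof.
by rewrite /dsel; case: insubP => [j _ _|_]; [exact: measurable_coord|exact: measurable_cst].
Qed.

(** Joint measurability in data and state is needed because the estimate is evaluated at random next
    states. *)
Lemma measurable_Vh h : (1 <= h <= H.+1)%N ->
  measurable_fun setT (fun xs : arrays sample I * S => Vh xs.1 h xs.2).
Proof.
move=> /andP[h1 hH].
elim: {h}(H.+1 - h)%N {-2}h (erefl (H.+1 - h)%N) h1 hH => [|n IH] h hn h1 hH.
  have -> : h = H.+1 by apply/eqP; rewrite eqn_leq hH -subn_eq0 hn.
  by rewrite (_ : (fun _ => _) = cst 0) //; apply/funext => xs; rewrite Vh_last.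
have hH' : (h <= H)%N by rewrite -ltnS -subn_gt0 hn.
have hn' : (H.+1 - h.+1 = n)%N by rewrite subnS hn.
have hh : (1 <= h <= H)%N by rewrite h1.
have mV := IH h.+1 hn' isT hH'.
rewrite (_ : (fun _ => _) = (fun xs : arrays sample I * S => dotv (phi_pol phi pi h xs.2) (wh xs.1 h))); last first.
  by apply/funext => xs; rewrite Vh_step.
apply: measurable_dotv; first exact: (mxm_phi_pol pi mdp h measurable_snd).
have mw : mxm (fun x : arrays sample I => wh x h).
  apply: (mxm_w_hat mdp h (V := fun x : arrays sample I => Vh x h.+1)
    (zD := fun x : arrays sample I => dsel x false h)
    (zC := fun x : arrays sample I => dsel x true h)) => //; exact: measurable_dsel.
by move=> i j; exact: measurableT_comp (mw i j) measurable_fst.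
Qed.

Section stage.
Variable i : 'I_H.
Let h := i.+1.
Let hH : (1 <= h <= H)%N. Proof. exact: ltn_ord. Qed.
Let N : R := (H - h).+1%:R.
Let N1 : 1 <= N. Proof. by rewrite /N ler1n. Qed.
Let N0 : 0 < N. Proof. exact: lt_le_trans N1. Qed.
Let nu1 : (0 < K)%N -> nu h setT = 1%E.
Proof. by move=> K0; exact: (law_mass1 (lawX true (Ordinal K0) hH)). Qed.

(* The estimate of the next stage, clipped so that it is bounded on every sample
   path; on the good event the clipping is inactive. *)
Definition VT (x : I -> sample) (s : S) : R := clip (-1) N (Vh x h.+1 s).

Lemma VT_bounds x s : -1 <= VT x s <= N.
Proof. by apply: clip_bounds; have := N1; lra. Qed.

Lemma measurable_VT : measurable_fun setT (fun xs : arrays sample I * S => VT xs.1 xs.2).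
Proof. by apply: measurable_clip; apply: measurable_Vh. Qed.

Let norm_VT x s : `|VT x s| <= N.
Proof.
have /andP[? ?] := VT_bounds x s; have := N1.
by rewrite ler_norml => ?; apply/andP; split; lra.
Qed.

Let bVT x : bmf (VT x).
Proof.
split; last by exists N.
have mp : measurable_fun setT (fun s : S => (x : arrays sample I, s)).
  by apply/measurable_fun_pairP; split; [exact: measurable_cst|exact: measurable_id].
exact: measurableT_comp measurable_VT mp.
Qed.

(** [VT] is built from stages strictly after h = i + 1, so a sample of stage h may be replaced. *)
Let VT_upd b k (x : I -> sample) z : VT (upd x (b, i, k) z) = VT x.
Proof.
apply/funext => s; rewrite /VT; congr (clip _ _ (_ s)); apply: Vh_ext => //.
move=> b' j k' hj; rewrite /upd; case: eqP => // -[_ ji _].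
by move: hj; rewrite ji ltnn.
Qed.

Let P1 sa : P h sa setT = 1%E. Proof. exact: prob_kernel. Qed.

(** The exponent t = sqrt (l / K) gives (2 K t^2 + l) / t = 3 sqrt (K l); 4 l <= K keeps t below
    1/2, as the centred function may reach 2. *)
Lemma whp_iid_two_sided b (g : S * A -> R) l :
  (0 < K)%N -> 0 < l -> 4 * l <= K%:R -> bmf g -> (forall sa, `|g sa| <= 1) ->
  whp Pr (2 * expR (- l)) (fun w =>
    `|\sum_(k < K) g (sampleX X w (b, i, k)).1.1 - K%:R * Rintegral (nu h) setT g|
      <= 3 * Num.sqrt (K%:R * l)).
Proof.
move=> K0 l0 lK bg g1; have n1 := nu1 K0.
have K0' : 0 < K%:R :> R by rewrite ltr0n.
pose t := Num.sqrt (l / K%:R).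
have t0 : 0 < t by rewrite sqrtr_gt0 divr_gt0.
have t2 : t ^+ 2 = l / K%:R by rewrite sqr_sqrtr // divr_ge0 // ltW.
have t12 : t <= 1 / 2.
  by rewrite -ler_sqr ?nnegrE ?(ltW t0) // t2 ler_pdivrMr //; lra.
have mg : `|Rintegral (nu h) setT g| <= 1 by exact: bmf_norm_Rintegral.
have vg : var (nu h) g <= 1 by rewrite -(expr1n _ 2); exact: var_le_bound.
have ha s : `|s| = 1 -> forall sa, `|(s * t) * (g sa - Rintegral (nu h) setT g)| <= 1.
  move=> s1 sa; rewrite !normrM s1 mul1r (gtr0_norm t0).
  apply: (@le_trans _ _ (1 / 2 * 2)); last lra.
  apply: ler_pM; rewrite ?(ltW t0) //.
  apply: le_trans (ler_normB _ _) _; have := g1 sa; lra.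
have w1 := whp_iid mX lawX indX b (i := i) l bg (ha 1 (normr1 _)) vg.
have w2 := whp_iid mX lawX indX b (i := i) l bg (ha (-1) (normrN1 _)) vg.
apply: whp_weaken (whp_and w1 w2); first by lra.
move=> w []; set m := Rintegral _ _ _.
have sE s : \sum_(k < K) (s * t * (g (sampleX X w (b, i, k)).1.1 - m) - 2 * (s * t) ^+ 2) =
  s * t * (\sum_(k < K) g (sampleX X w (b, i, k)).1.1 - K%:R * m) - K%:R * (2 * (s * t) ^+ 2).
  rewrite sumrB -mulr_sumr sumrB !sumr_const card_ord -(mulr_natl m) -[X in _ - X = _](mulr_natl _ K).
  by [].
rewrite !sE; set Y := \sum_(k < K) _ - _ => h1 h2.
have kt : K%:R * t ^+ 2 = l by rewrite t2 mulrC divfK // gt_eqF.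
have key : `|t * Y| <= 3 * l.
  rewrite ler_norml; apply/andP; split; [move: h2|move: h1]; rewrite ?mul1r ?mulN1r ?sqrrN ?exprMn; lra.
have st : Num.sqrt (K%:R * l) * t = l.
  rewrite /t -sqrtrM ?mulr_ge0 ?(ltW l0) // (_ : K%:R * l * (l / K%:R) = l ^+ 2).
    by rewrite sqrtr_sqr gtr0_norm.
  by field; rewrite gt_eqF.
by rewrite -(ler_pM2l t0) -{1}(gtr0_norm t0) -normrM (le_trans key) // mulrCA (mulrC t) st.
Qed.

Lemma whp_martingale_two_sided b (a v : 'I_K -> arrays sample I -> R)
    (f : arrays sample I -> S -> R) (c l M : R) :
  (forall x, bmf (f x)) -> (forall x s, `|f x s| <= M) ->
  measurable_fun setT (fun xs : arrays sample I * S => f xs.1 xs.2) ->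
  (forall k, measurable_fun setT (a k)) -> (forall k, measurable_fun setT (v k)) ->
  (forall k j x z z', z.1.1 = z'.1.1 ->
    [/\ a j (upd x (b, i, k) z) = a j (upd x (b, i, k) z'),
        v j (upd x (b, i, k) z) = v j (upd x (b, i, k) z') &
        f (upd x (b, i, k) z) = f (upd x (b, i, k) z')]) ->
  (forall k x, `|a k x * c| <= 1) ->
  (forall k x, `|a k x| * (2 * M) <= 1) ->
  (forall k x, VarV P h (f x) (x (b, i, k)).1.1 <= v k x) ->
  whp Pr (2 * expR (- l)) (fun w => let x := sampleX X w in
    `|\sum_(k < K) a k x * (c * (x (b, i, k)).1.2 +
        (f x (x (b, i, k)).2 - PV P h (f x) (x (b, i, k)).1.1))| <=
      2 * \sum_(k < K) a k x ^+ 2 * (c ^+ 2 + v k x) + l).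
Proof.
move=> bf fM mf ma mv pred hc hM hv.
have mfP k : measurable_fun setT (fun x : arrays sample I =>
     f x (x (b, i, k)).2 - PV P h (f x) (x (b, i, k)).1.1).
  have mc := measurable_coord (b, i, k) : measurable_fun setT (fun x : arrays sample I => x (b, i, k)).
  apply: measurable_funB.
    exact: (measurable_eval mf (measurableT_comp measurable_snd mc)).
  apply: (measurable_PV_param mdp hH mf fM).
  exact: measurableT_comp measurable_fst (measurableT_comp measurable_fst mc).
have hf k x s sa : `|a k x * (f x s - PV P h (f x) sa)| <= 1.
  rewrite normrM; apply: le_trans (hM k x); rewrite ler_wpM2l //.
  apply: le_trans (ler_normB _ _) _.
  have := bmf_norm_Rintegral (P1 sa) (bf x) (fM x); have := fM x s; rewrite /PV; lra.
have w1 := whp_martingale mX noiseP lawX indX (b := b) (i := i) l bf ma mv mfP pred hc hf hv.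
have w2 : whp Pr (expR (- l)) (fun w => let x := sampleX X w in
    \sum_(k < K) ((- a k x) * (c * (x (b, i, k)).1.2 + (f x (x (b, i, k)).2 - PV P h (f x) (x (b, i, k)).1.1))
      - 2 * ((- a k x) ^+ 2 * (c ^+ 2 + v k x))) < l).
  apply: (whp_martingale mX noiseP lawX indX (b := b) (i := i) (a := fun k x => - a k x) l bf _ mv mfP).
  - by move=> k; apply: measurableT_comp.
  - by move=> k j x z z' zz; have [-> -> ->] := pred k j x z z' zz.
  - by move=> k x; rewrite mulNr normrN.
  - by move=> k x s sa; rewrite mulNr normrN.
  - exact: hv.
apply: whp_weaken (whp_and w1 w2); first by lra.
move=> w [] /=; set x := sampleX X w; rewrite !sumrB -!mulr_sumr.
under [X in _ -> X - _ < _ -> _]eq_bigr do rewrite mulNr.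
under [X in _ -> _ - 2 * X < _ -> _]eq_bigr do rewrite sqrrN.
rewrite sumrN => h1 h2; rewrite ler_norml; apply/andP; split; lra.
Qed.

(** The weights see the regression data through state-action pairs only, so the regression noise
    stays centred given the weights. *)
Lemma wt_ext (V : S -> R) (zD zD' zC : 'I_K -> sample) :
  (forall k, (zD k).1.1 = (zD' k).1.1) -> wt H phi h V zD zC = wt H phi h V zD' zC.
Proof. by move=> e; apply/funext => k; rewrite /wt e. Qed.

Lemma lev_ext (V : S -> R) (zD zD' zC : 'I_K -> sample) v :
  (forall k, (zD k).1.1 = (zD' k).1.1) -> lev H phi h V zD zC v = lev H phi h V zD' zC v.
Proof.
move=> e; have ep : phiD phi zD = phiD phi zD' by apply/funext => k; rewrite /phiD e.
by apply/funext => k; rewrite /lev (wt_ext V zC e) ep.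
Qed.

Let zD (x : I -> sample) k := x (false, i, k).
Let zC (x : I -> sample) k := x (true, i, k).

Let mzD k : measurable_fun setT (fun x : arrays sample I => zD x k).
Proof. exact: measurable_coord. Qed.

Let mzC k : measurable_fun setT (fun x : arrays sample I => zC x k).
Proof. exact: measurable_coord. Qed.

Let msa b k : measurable_fun setT (fun x : arrays sample I => (x (b, i, k)).1.1).
Proof. exact: measurableT_comp measurable_fst (measurableT_comp measurable_fst (measurable_coord _)). Qed.

Let mphi b k j : measurable_fun setT (fun x : arrays sample I => phi (x (b, i, k)).1.1 j 0).
Proof. exact: measurableT_comp (measurable_phi mdp j) (msa b k). Qed.

Let upd_sa b k (x : I -> sample) z z' b' k' : z.1.1 = z'.1.1 ->
  (upd x (b, i, k) z (b', i, k')).1.1 = (upd x (b, i, k) z' (b', i, k')).1.1.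
Proof. by move=> e; rewrite /upd; case: eqP. Qed.

Let zC_upd k (x : I -> sample) z : zC (upd x (false, i, k) z) = zC x.
Proof. by apply/funext => k'; rewrite /zC /upd; case: eqP. Qed.

Let phi_le1 sa j : `|phi sa j 0| <= 1.
Proof. exact: le_trans (ler_coord_vnorm _ _) (vnorm_phi_le1 mdp sa). Qed.

Let bphi := bmf_phi mdp.

Section good.
Variables (l l' T m : R) (v : 'cV[R]_d).
Hypothesis d0 : (0 < d)%N.
Hypothesis K0 : (0 < K)%N.
Hypothesis l0 : 0 < l.
Hypothesis lK : 4 * l <= K%:R.
Hypothesis T0 : 0 <= T.
Hypothesis m0 : 0 <= m.
Hypothesis TmN : T * m * (2 * N) <= 1.

Let K0' : 0 < K%:R :> R. Proof. by rewrite ltr0n. Qed.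
Let t := Num.sqrt (l / K%:R).
Let t0 : 0 < t. Proof. by rewrite sqrtr_gt0 divr_gt0. Qed.
Let t2 : K%:R * t ^+ 2 = l.
Proof. by rewrite sqr_sqrtr ?divr_ge0 ?(ltW l0) // mulrC divfK // gt_eqF. Qed.
Let t12 : 2 * t <= 1.
Proof.
have h2 : t ^+ 2 <= 1 / 4.
  by rewrite -(ler_pM2l K0') t2; have := lK; lra.
have : t <= 1 / 2 by rewrite -ler_sqr ?nnegrE ?(ltW t0) //; lra.
lra.
Qed.
Let E := 3 * Num.sqrt (K%:R * l).
Let tE : E * t = 3 * l.
Proof.
rewrite /E /t -mulrA -sqrtrM ?mulr_ge0 ?(ltW l0) // (_ : K%:R * l * (l / K%:R) = l ^+ 2).
  by rewrite sqrtr_sqr gtr0_norm.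
by field; rewrite gt_eqF.
Qed.

Let whp_Sigma : whp Pr ((d * d)%:R * (2 * expR (- l))) (fun w => forall ij : 'I_d * 'I_d,
  `|\sum_(k < K) 1 * phiC phi (zC (sampleX X w)) k ij.1 0 * phiC phi (zC (sampleX X w)) k ij.2 0
     - K%:R * Sigma_mat phi nu h ij.1 ij.2| <= E).
Proof.
have -> : (d * d)%N = #|{: 'I_d * 'I_d}| by rewrite card_prod card_ord.
apply: whp_fin => -[j1 j2] /=.
apply: whp_weaken (whp_iid_two_sided true (g := fun sa => phi sa j1 0 * phi sa j2 0) K0 l0 lK _ _) => //.
- move=> w; rewrite mxE; congr (`| _ - _ | <= _); apply: eq_bigr => k _; by rewrite mul1r.
- exact: bmfM.
- by move=> sa; rewrite normrM mulr_ile1.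
Qed.

Let sigma := sigma_fun H P r pi (fun=> 1) 1.

Let whp_Lambda : whp Pr ((d * d)%:R * (2 * expR (- l))) (fun w => forall ij : 'I_d * 'I_d,
  `|\sum_(k < K) (sigma h (zD (sampleX X w) k).1.1) ^-2 * phiD phi (zD (sampleX X w)) k ij.1 0
       * phiD phi (zD (sampleX X w)) k ij.2 0
     - K%:R * Lambda_mat phi nu sigma h ij.1 ij.2| <= E).
Proof.
have -> : (d * d)%N = #|{: 'I_d * 'I_d}| by rewrite card_prod card_ord.
apply: whp_fin => -[j1 j2] /=.
have bs := bmf_sigmaV pi mdp hH.
apply: whp_weaken (whp_iid_two_sided false
  (g := fun sa => (sigma h sa) ^-2 * phi sa j1 0 * phi sa j2 0) K0 l0 lK _ _) => //.
- by move=> w; rewrite mxE.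
- by do 2![apply: bmfM => //].
- move=> sa; have /andP[s2 _] := sqr_sigma_bounds pi mdp hH sa.
  rewrite -/sigma in s2.
  rewrite !normrM mulr_ile1 ?mulr_ge0 // mulr_ile1 //.
  rewrite ger0_norm ?invr_ge0 ?sqr_ge0 // invf_le1; lra.
Qed.

(** Dividing by N^p normalises the responses; c = 0 since no reward enters, and the crude variance
    bound N^(2 p) suffices. *)
Let whp_moment p : (1 <= p <= 2)%N -> whp Pr (d%:R * (2 * expR (- l))) (fun w => forall j : 'I_d,
  `|\sum_(k < K) (VT (sampleX X w) (zC (sampleX X w) k).2 ^+ p
       - PV P h (fun s => VT (sampleX X w) s ^+ p) (zC (sampleX X w) k).1.1)
      * phiC phi (zC (sampleX X w)) k j 0| <= N ^+ p * E).
Proof.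
move=> hp; rewrite -[X in X%:R * _]card_ord; apply: whp_fin => j.
have Np : 0 < N ^+ p by rewrite exprn_gt0.
pose a (k : 'I_K) (x : arrays sample I) := t / N ^+ p * phi (x (true, i, k)).1.1 j 0.
have VTp x s : `|VT x s ^+ p| <= N ^+ p by rewrite normrX lerXn2r ?nnegrE ?(ltW N0).
have bVTp x : bmf (fun s => VT x s ^+ p) by exact: bmfX.
apply: whp_weaken (whp_martingale_two_sided (b := true) (a := a) (v := fun _ _ => (N ^+ p) ^+ 2)
   (f := fun x s => VT x s ^+ p) (c := 0) l bVTp VTp _ _ _ _ _ _ _) => [//|||||||| ].
- move=> w /=; set x := sampleX X w => hx.
  have aE : \sum_(k < K) a k x * (0 * (x (true, i, k)).1.2 + (VT x (x (true, i, k)).2 ^+ p -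
      PV P h (fun s => VT x s ^+ p) (x (true, i, k)).1.1)) =
      t / N ^+ p * \sum_(k < K) (VT x (zC x k).2 ^+ p - PV P h (fun s => VT x s ^+ p) (zC x k).1.1)
      * phiC phi (zC x) k j 0.
    by rewrite mulr_sumr; apply: eq_bigr => k _; rewrite mul0r add0r /a /phiC /zC; ring.
  rewrite aE in hx; set Y := \sum_(k < K) _ in hx *.
  have h2 : \sum_(k < K) a k x ^+ 2 * (0 ^+ 2 + (N ^+ p) ^+ 2) <= l.
    apply: (@le_trans _ _ (\sum_(k < K) t ^+ 2)); last by rewrite sumr_const card_ord -mulr_natl t2.
    apply: ler_sum => k _; rewrite expr0n add0r /a.
    set u := phi _ _ _; have u1 : u ^+ 2 <= 1 by rewrite -(real_normK (num_real u)) expr_le1 // phi_le1.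
    have -> : (t / N ^+ p * u) ^+ 2 * (N ^+ p) ^+ 2 = t ^+ 2 * u ^+ 2 by field; rewrite gt_eqF.
    by rewrite ler_piMr ?sqr_ge0.
  have h3 : t / N ^+ p * `|Y| <= 3 * l.
    rewrite -{1}(gtr0_norm (divr_gt0 t0 Np)) -normrM; apply: le_trans hx _; lra.
  rewrite -(ler_pM2l (divr_gt0 t0 Np)) (le_trans h3) //; apply: eq_ler.
  by rewrite -tE; field; rewrite gt_eqF.
- by apply: measurable_funX; exact: measurable_VT.
- by move=> k; apply: measurable_funM.
- by move=> k; exact: measurable_cst.
- move=> k j' x z z' zz; split; [by rewrite /a (upd_sa _ _ _ _ _ zz)|exact: erefl|].
  by apply/funext => s; rewrite !VT_upd.
- by move=> k x; rewrite mulr0 normr0.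
- move=> k x; rewrite /a normrM (gtr0_norm (divr_gt0 t0 Np)).
  set u := phi _ _ _; have u1 : `|u| <= 1 by exact: phi_le1.
  apply: le_trans t12; rewrite (_ : t / N ^+ p * `|u| * (2 * N ^+ p) = 2 * t * `|u|); last by field; rewrite gt_eqF.
  by rewrite ler_piMr // mulr_ge0 // ltW.
- by move=> k x; exact: (var_le_bound (P1 _) (bVTp x) (VTp x)).
Qed.

(** The weights, at most 1/2, absorb the variance bound 1 + N^2 <= 2 N^2. *)
Let whp_noise : whp Pr (d%:R * (2 * expR (- l))) (fun w => let x := sampleX X w in forall j : 'I_d,
  `|\sum_(k < K) wt H phi h (VT x) (zD x) (zC x) k * xi P h (VT x) (zD x) k * phiD phi (zD x) k j 0| <= N * E).
Proof.
rewrite -[X in X%:R * _]card_ord; apply: whp_fin => j.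
pose a (k : 'I_K) (x : arrays sample I) :=
  t / N * (wt H phi h (VT x) (zD x) (zC x) k * phi (x (false, i, k)).1.1 j 0).
have a_le k x : `|a k x| <= t / N * (1 / 2).
  rewrite /a normrM (gtr0_norm (divr_gt0 t0 N0)) ler_wpM2l ?divr_ge0 ?(ltW t0) ?(ltW N0) //.
  have /andP[w0 w1] := wt_bounds H phi h (VT x) (zD x) (zC x) k.
  by rewrite normrM (ger0_norm w0) -[leRHS]mulr1 ler_pM.
apply: whp_weaken (whp_martingale_two_sided (b := false) (a := a) (v := fun _ _ => N ^+ 2)
   (f := VT) (c := 1) l bVT norm_VT _ _ _ _ _ _ _) => [//|||||||| ].
- move=> w /=; set x := sampleX X w => hx.
  have aE : \sum_(k < K) a k x * (1 * (x (false, i, k)).1.2 + (VT x (x (false, i, k)).2 -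
      PV P h (VT x) (x (false, i, k)).1.1)) =
      t / N * \sum_(k < K) wt H phi h (VT x) (zD x) (zC x) k * xi P h (VT x) (zD x) k * phiD phi (zD x) k j 0.
    by rewrite mulr_sumr; apply: eq_bigr => k _; rewrite mul1r /a /phiD /xi /zD; ring.
  rewrite aE in hx; set Y := \sum_(k < K) _ in hx *.
  have h2 : \sum_(k < K) a k x ^+ 2 * (1 ^+ 2 + N ^+ 2) <= l.
    apply: (@le_trans _ _ (\sum_(k < K) t ^+ 2)); last by rewrite sumr_const card_ord -mulr_natl t2.
    apply: ler_sum => k _; rewrite expr1n -(real_normK (num_real (a k x))).
    apply: (@le_trans _ _ ((t / N * (1 / 2)) ^+ 2 * (2 * N ^+ 2))).
      apply: ler_pM; rewrite ?sqr_ge0 ?addr_ge0 ?sqr_ge0 //.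
        have b0 : 0 <= t / N * (1 / 2) by rewrite mulr_ge0 // divr_ge0 // ltW.
        by apply: lerXn2r; rewrite ?nnegrE //; exact: a_le.
      have : 1 <= N ^+ 2 by rewrite expr_ge1 // ltW.
      lra.
    have -> : (t / N * (1 / 2)) ^+ 2 * (2 * N ^+ 2) = t ^+ 2 / 2 by field; rewrite gt_eqF.
    have := sqr_ge0 t; lra.
  have h3 : t / N * `|Y| <= 3 * l.
    rewrite -{1}(gtr0_norm (divr_gt0 t0 N0)) -normrM; apply: le_trans hx _; lra.
  rewrite -(ler_pM2l (divr_gt0 t0 N0)) (le_trans h3) //; apply: eq_ler.
  by rewrite -tE; field; rewrite gt_eqF.
- exact: measurable_VT.
- move=> k; apply: measurable_funM => //; apply: measurable_funM => //.
  exact: (measurable_wt mdp h measurable_VT mzD mzC k).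
- by move=> k; exact: measurable_cst.
- move=> k j' x z z' zz; split; [|exact: erefl|by rewrite !VT_upd].
  rewrite /a (upd_sa _ _ _ _ _ zz) !VT_upd !zC_upd.
  by rewrite (wt_ext (VT x) (zC x) (zD' := zD (upd x (false, i, k) z'))) // => k'; exact: upd_sa.
- move=> k x; rewrite mulr1; apply: le_trans (a_le k x) _.
  have : t / N <= t by rewrite ler_pdivrMr // ler_peMr // ltW.
  by set q := t / N; have := t12; lra.
- move=> k x; apply: (@le_trans _ _ (t / N * (1 / 2) * (2 * N))).
    by rewrite ler_wpM2r // mulr_ge0 // ltW.
  have -> : t / N * (1 / 2) * (2 * N) = t by field; rewrite gt_eqF.
  have := t12; have := t0; lra.
- by move=> k x; exact: (var_le_bound (P1 _) (bVT x) (norm_VT x)).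
Qed.

(** The actual conditional variance is kept here instead of a uniform bound: it later cancels
    against the weights and leaves the norm of Lambda_h^-1. *)
Let whp_target : whp Pr (2 * expR (- l')) (fun w => let x := sampleX X w in
  `|\sum_(k < K) T * clip (- m) m (lev H phi h (VT x) (zD x) (zC x) v k) * xi P h (VT x) (zD x) k| <=
      2 * (\sum_(k < K) (T * clip (- m) m (lev H phi h (VT x) (zD x) (zC x) v k)) ^+ 2 *
            (1 + VarV P h (VT x) (zD x k).1.1)) + l').
Proof.
pose a (k : 'I_K) (x : arrays sample I) := T * clip (- m) m (lev H phi h (VT x) (zD x) (zC x) v k).
have a_le k x : `|a k x| <= T * m.
  by rewrite /a normrM (ger0_norm T0) ler_wpM2l // norm_clip //; have := m0; lra.
have mVar k : measurable_fun setT (fun x : arrays sample I => VarV P h (VT x) (x (false, i, k)).1.1).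
  apply: measurable_funB; last apply: measurable_funX.
    apply: (measurable_PV_param (M := N ^+ 2) mdp hH (W := fun x : arrays sample I => fun s => VT x s ^+ 2)) => //.
      by apply: measurable_funX; exact: measurable_VT.
    by move=> x s; rewrite normrX lerXn2r ?nnegrE ?(ltW N0).
  exact: (measurable_PV_param (M := N) mdp hH measurable_VT).
apply: whp_weaken (whp_martingale_two_sided (b := false) (a := a)
   (v := fun k x => VarV P h (VT x) (x (false, i, k)).1.1)
   (f := VT) (c := 1) l' bVT norm_VT _ _ _ _ _ _ _) => [//|||||||| ].
- move=> w /=; set x := sampleX X w.
  under eq_bigr do rewrite mul1r.
  by under [in leRHS]eq_bigr do rewrite expr1n.
- exact: measurable_VT.
- move=> k; apply: measurable_funM => //; apply: measurable_clip.
  exact: (measurable_lev mdp h measurable_VT mzD mzC v k).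
- exact: mVar.
- move=> k j' x z z' zz; split; [|by rewrite !VT_upd (upd_sa _ _ _ _ _ zz)|by rewrite !VT_upd].
  rewrite /a !VT_upd !zC_upd.
    by rewrite (lev_ext (VT x) (zC x) v (zD' := zD (upd x (false, i, k) z'))) // => k'; exact: upd_sa.
- move=> k x; rewrite mulr1; apply: le_trans (a_le k x) _.
  have h1 : 0 <= T * m * (2 * N - 1).
    by rewrite mulr_ge0 ?mulr_ge0 //; have := N1; lra.
  have := TmN; lra.
- move=> k x; apply: le_trans TmN; rewrite ler_wpM2r // mulr_ge0 // ltW //.
- by move=> k x; exact: lexx.
Qed.

Lemma whp_stage_good : whp Pr (10 * d%:R ^+ 2 * expR (- l) + 2 * expR (- l')) (fun w =>
  let x := sampleX X w in
  stage_good H phi gam P pi nu h (VT x) (zD x) (zC x) E T m l' v).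
Proof.
have w1 := whp_and whp_Sigma whp_Lambda.
have w2 := whp_and (whp_moment (isT : (1 <= 1 <= 2)%N)) (whp_moment (isT : (1 <= 2 <= 2)%N)).
have w3 := whp_and whp_noise whp_target.
apply: whp_weaken (whp_and w1 (whp_and w2 w3)).
  (* The coordinate events fail with probability at most (4 d^2 + 6 d) exp (- l), which 10 d^2 exp
     (- l) dominates. *)
  have d1 : 1 <= d%:R :> R by rewrite ler1n.
  have e0 := expR_ge0 (- l).
  have : 0 <= (d%:R - 1) * (d%:R * expR (- l)) by rewrite mulr_ge0 ?subr_ge0 // mulr_ge0.
  rewrite natrM; lra.
move=> w [[g1 g2] [[g3 g4] [g5 g6]]]; split=> //.
- by move=> j1 j2; exact: (g1 (j1, j2)).
- by move=> j1 j2; exact: (g2 (j1, j2)).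
- by move=> [|[|[|p]]] j //.
Qed.

End good.

End stage.
End Algorithm.

(** * Sample size and conclusion *)

Section Numeric.
Variable R : realType.
Implicit Types f : nat -> R.

Lemma norm_stage_le H f h : (1 <= h <= H)%N -> `|f h| <= \sum_(1 <= i < H.+1) `|f i|.
Proof.
move=> hH; rewrite (bigD1_seq h) ?iota_uniq ?mem_index_iota //= lerDl.
exact: sumr_ge0.
Qed.

Lemma min_stage_le H f h : (1 <= h <= H)%N -> min_stage H f <= f h.
Proof.
move=> hH; apply: ge_inf; last by exists h.
exists (- \sum_(1 <= i < H.+1) `|f i|) => _ [i /= iH <-].
by have := norm_stage_le f iH; rewrite ler_norml => /andP[].
Qed.

Lemma max_stage_ge H f h : (1 <= h <= H)%N -> f h <= max_stage H f.
Proof.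
move=> hH; apply: ub_le_sup; last by exists h.
exists (\sum_(1 <= i < H.+1) `|f i|) => _ [i /= iH <-].
exact: le_trans (ler_norm _) (norm_stage_le f iH).
Qed.

Lemma ln2_ge_half : 1 / 2 <= ln 2 :> R.
Proof.
have : ln (1 + (- (1 / 2))) <= - (1 / 2) :> R by apply: le_ln1Dx; lra.
have -> : 1 + - (1 / 2) = 2^-1 :> R by field.
rewrite lnV ?posrE; lra.
Qed.

Lemma ln_ge1 (x : R) : 4 <= x -> 1 <= ln x.
Proof.
move=> x4; apply: (@le_trans _ _ (ln (2 * 2))).
  by rewrite lnM ?posrE //; have := ln2_ge_half; lra.
by rewrite ler_ln ?posrE; lra.
Qed.

Lemma sqrt_sample_le (q y k l : R) : 0 <= q -> 0 <= y -> 0 <= k -> 0 <= l ->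
  q ^+ 2 * l <= y ^+ 2 * k -> q * Num.sqrt (k * l) <= k * y.
Proof.
move=> q0 y0 k0 l0 h; rewrite -ler_sqr ?nnegrE ?mulr_ge0 ?sqrtr_ge0 //.
rewrite exprMn (_ : Num.sqrt _ ^+ 2 = k * l); last by rewrite sqr_sqrtr // mulr_ge0.
have := ler_wpM2l k0 h; lra.
Qed.

End Numeric.

(** * Consequences of the sample size assumption *)

Section SampleSize.
Variable R : realType.

(** K also occurs inside L, so the bounds are bootstrapped: K >= 2 gives L >= 1/2, then the
    assumption gives K >= 4, hence L >= 1, hence K >= 20 d, which makes the two logarithms
    comparable. *)
Lemma sample_size (d H K : nat) (kap delta C3 : R) :
  (0 < d)%N -> (0 < H)%N -> (1 < K)%N -> 0 < kap <= 1 -> 0 < delta < 1 ->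
  H%:R ^+ 4 / kap ^+ 2 <= C3 ->
  let L := ln (d%:R * H%:R ^+ 2 * K%:R / (kap * delta)) in
  160 ^+ 2 * C3 * d%:R ^+ 2 * L ^+ 2 <= K%:R ->
  1 <= L /\ ln (20 * d%:R ^+ 2 * H%:R / delta) <= L.
Proof.
move=> d0 H0 K1 /andP[k0 k1] /andP[e0 e1] hC3 L hK.
have d1 : 1 <= d%:R :> R by rewrite ler1n.
have H1 : 1 <= H%:R :> R by rewrite ler1n.
have K2 : 2 <= K%:R :> R by rewrite ler_nat.
have [dp Hp Kp] : [/\ 0 < d%:R :> R, 0 < H%:R :> R & 0 < K%:R :> R].
  by split; lra.
have ke0 : 0 < kap * delta by rewrite mulr_gt0.
have inv1 (y : R) : 0 < y -> y <= 1 -> 1 <= y^-1 by move=> y0 y1; rewrite invf_ge1.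
have C31 : 1 <= C3.
  apply: le_trans hC3; rewrite -[leLHS]mulr1; apply: ler_pM => //.
    by rewrite expr_ge1 // ltW.
  by rewrite inv1 ?exprn_gt0 // expr_le1 // ltW.
have H21 : 1 <= H%:R ^+ 2 :> R by rewrite expr_ge1 // ltW.
have Y0 : 0 < d%:R * H%:R ^+ 2 * K%:R / (kap * delta) :> R.
  by rewrite divr_gt0 // !mulr_gt0 ?exprn_gt0.
have LK : ln K%:R <= L.
  rewrite ler_ln ?posrE // ler_pdivlMr //.
  have a1 : kap * delta <= 1 by rewrite mulr_ile1 // ltW.
  have a2 : 1 <= d%:R * H%:R ^+ 2 :> R by rewrite -[leLHS]mulr1; apply: ler_pM.
  rewrite mulrC; apply: ler_pM => //; first exact: ltW.
  exact: le_trans a1 a2.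
have L12 : 1 / 2 <= L.
  by apply: le_trans LK; apply: le_trans (@ln2_ge_half R) _; rewrite ler_ln ?posrE //; lra.
have d21 : 1 <= d%:R ^+ 2 :> R by rewrite expr_ge1 // ltW.
have CL : 160 ^+ 2 * d%:R ^+ 2 * L ^+ 2 <= K%:R.
  apply: le_trans hK; have : 0 <= (C3 - 1) * (d%:R ^+ 2 * L ^+ 2).
    by rewrite mulr_ge0 ?subr_ge0 // mulr_ge0 ?sqr_ge0.
  lra.
have L2 : 1 / 4 <= L ^+ 2.
  by have := ler_pM (_ : 0 <= 1 / 2 :> R) (_ : 0 <= 1 / 2 :> R) L12 L12; rewrite -expr2; lra.
have K4 : 4 <= K%:R :> R.
  have : 0 <= (d%:R ^+ 2 - 1) * L ^+ 2 by rewrite mulr_ge0 ?sqr_ge0 ?subr_ge0.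
  lra.
have L1 : 1 <= L by apply: le_trans LK; exact: ln_ge1.
split=> //.
have K20 : 20 * d%:R <= K%:R :> R.
  have : 1 <= L ^+ 2 by rewrite expr_ge1 // (le_trans ler01).
  have : d%:R <= d%:R ^+ 2 :> R by rewrite expr2 ler_peMl // ltW.
  move=> a1 a2; have : 0 <= d%:R ^+ 2 * (L ^+ 2 - 1) by rewrite mulr_ge0 ?sqr_ge0 ?subr_ge0.
  lra.
rewrite ler_ln ?posrE //; last by rewrite divr_gt0 // !mulr_gt0 ?exprn_gt0.
rewrite (_ : _ / (kap * delta) = d%:R * H%:R ^+ 2 * K%:R / kap / delta); last first.
  by rewrite invfM mulrA.
rewrite ler_wpM2r ?invr_ge0 ?(ltW e0) //.
apply: (@le_trans _ _ (d%:R * H%:R ^+ 2 * K%:R)).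
  have a1 : 0 <= (K%:R - 20 * d%:R) * (d%:R * H%:R) :> R.
    by rewrite !mulr_ge0 // subr_ge0.
  have a2 : 0 <= (H%:R - 1) * (d%:R * H%:R * K%:R) :> R.
    by rewrite !mulr_ge0 // subr_ge0.
  lra.
rewrite ler_peMr ?inv1 // !mulr_ge0 ?sqr_ge0 //.
Qed.

(** For H >= 2 the argument of the logarithm is at least 2 even with K = 1, so L >= 1/2 and the left
    side would exceed 1. *)
Lemma single_sample (d H : nat) (kap delta C3 : R) :
  (0 < d)%N -> (0 < H)%N -> 0 < kap <= 1 -> 0 < delta < 1 ->
  H%:R ^+ 4 / kap ^+ 2 <= C3 ->
  160 ^+ 2 * C3 * d%:R ^+ 2 * ln (d%:R * H%:R ^+ 2 * 1 / (kap * delta)) ^+ 2 <= 1 ->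
  H = 1%N.
Proof.
move=> d0 H0 /andP[k0 k1] /andP[e0 e1] hC3; set L := ln _ => hK.
apply/eqP; rewrite eqn_leq H0 andbT leqNgt; apply/negP => H1.
have d1 : 1 <= d%:R :> R by rewrite ler1n.
have H2 : 2 <= H%:R :> R by rewrite ler_nat.
have [dp Hp] : 0 < d%:R :> R /\ 0 < H%:R :> R by split; lra.
have ke0 : 0 < kap * delta by rewrite mulr_gt0.
have H22 : 2 <= H%:R ^+ 2 :> R by rewrite expr2 -[leLHS]mulr1; apply: ler_pM => //; lra.
have C31 : 1 <= C3.
  apply: le_trans hC3; rewrite -[leLHS]mulr1; apply: ler_pM => //.
    by rewrite expr_ge1 //; lra.
  by rewrite invf_ge1 ?exprn_gt0 // expr_le1 // ltW.
have L12 : 1 / 2 <= L.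
  apply: le_trans (@ln2_ge_half R) _; rewrite ler_ln ?posrE //; last first.
    by rewrite divr_gt0 // !mulr_gt0 ?exprn_gt0.
  rewrite ler_pdivlMr // mulr1 mulrC; apply: ler_pM => //; first exact: ltW.
  by apply: le_trans d1; rewrite mulr_ile1 // ltW.
have L2 : 1 / 4 <= L ^+ 2.
  by have := ler_pM (_ : 0 <= 1 / 2 :> R) (_ : 0 <= 1 / 2 :> R) L12 L12; rewrite -expr2; lra.
have d21 : 1 <= d%:R ^+ 2 :> R by rewrite expr_ge1 // ltW.
have : 1 <= C3 * d%:R ^+ 2 by rewrite -[leLHS]mulr1; apply: ler_pM.
move=> c1; have : 1 * (1 / 4) <= C3 * d%:R ^+ 2 * L ^+ 2 by apply: ler_pM.
lra.
Qed.

Lemma sample_le (c D Hr L l a C3 K : R) : 0 <= c -> 0 <= a -> 1 <= L -> l <= L ->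
  Hr ^+ 4 <= a * C3 -> c * C3 * D ^+ 2 * L ^+ 2 <= K ->
  c * (D ^+ 2 * Hr ^+ 4) * l <= a * K.
Proof.
move=> c0 a0 L1 lL hC3 hK.
have H4 : 0 <= Hr ^+ 4 by rewrite (exprM Hr 2 2) sqr_ge0.
have lL2 : l <= L ^+ 2 by apply: le_trans lL _; rewrite expr2 ler_peMr // (le_trans ler01).
apply: (@le_trans _ _ (c * (D ^+ 2 * Hr ^+ 4) * L ^+ 2)).
  by rewrite ler_wpM2l // mulr_ge0 // mulr_ge0 ?sqr_ge0.
apply: le_trans (ler_wpM2l a0 hK).
have -> : a * (c * C3 * D ^+ 2 * L ^+ 2) = c * (D ^+ 2 * (a * C3)) * L ^+ 2 by ring.
by rewrite ler_wpM2r ?sqr_ge0 // ler_wpM2l // ler_wpM2l ?sqr_ge0.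
Qed.

Lemma sample_kappa_le (D Hr L l kap ka C3 K : R) : 0 < kap -> kap <= ka -> 1 <= L ->
  0 <= l -> l <= L -> Hr ^+ 4 / kap ^+ 2 <= C3 -> 160 ^+ 2 * C3 * D ^+ 2 * L ^+ 2 <= K ->
  1600 * (D ^+ 2 * Hr ^+ 4) * l <= ka ^+ 2 * K.
Proof.
move=> k0 kka L1 l0 lL hC3 hK.
have kp : 0 < kap ^+ 2 by rewrite exprn_gt0.
have kk : kap ^+ 2 <= ka ^+ 2 by rewrite ler_sqr ?nnegrE ?(le_trans _ kka) ?(ltW k0).
have H4 : 0 <= Hr ^+ 4 by rewrite (exprM Hr 2 2) sqr_ge0.
have C0 : 0 <= C3 by apply: le_trans hC3; rewrite divr_ge0 // ltW.
have h : Hr ^+ 4 <= ka ^+ 2 * C3.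
  apply: (@le_trans _ _ (kap ^+ 2 * C3)); last by rewrite ler_wpM2r.
  by rewrite mulrC -ler_pdivrMr.
have := sample_le (_ : 0 <= 160 ^+ 2) (sqr_ge0 ka) L1 lL h hK.
have : 0 <= D ^+ 2 * Hr ^+ 4 * l by rewrite mulr_ge0 // mulr_ge0 ?sqr_ge0.
move=> h1 /(_ (exprn_ge0 2 (ler0n R 160))); lra.
Qed.

(** 16 iota^2 times the last entry of the maximum is H^4 (2 N^2 iota / kappa^2), and 2 N^2 iota >=
    kappa >= kappa^2. *)
Lemma sample_iota_le (D Hr L l kap io N C3 K : R) : 0 < kap <= 1 -> 1 <= N ->
  kap / (2 * N ^+ 2) <= io -> 1 <= L -> l <= L ->
  Hr ^+ 2 / kap ^+ 2 * (Hr ^+ 2 / 2 / 2) * (N ^+ 2 / 2 / io) <= C3 ->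
  160 ^+ 2 * C3 * D ^+ 2 * L ^+ 2 <= K ->
  1600 * (D ^+ 2 * Hr ^+ 4) * l <= io ^+ 2 * K.
Proof.
move=> /andP[k0 k1] N1 hio L1 lL hC3 hK.
have N0 : 0 < N by exact: lt_le_trans N1.
have io0 : 0 < io by apply: lt_le_trans hio; rewrite divr_gt0 ?mulr_gt0 ?exprn_gt0.
have a0 : 0 <= 16 * io ^+ 2 by rewrite mulr_ge0 ?sqr_ge0.
have H4 : 0 <= Hr ^+ 4 by rewrite (exprM Hr 2 2) sqr_ge0.
have h : Hr ^+ 4 <= 16 * io ^+ 2 * C3.
  apply: le_trans (ler_wpM2l a0 hC3).
  have -> : 16 * io ^+ 2 * (Hr ^+ 2 / kap ^+ 2 * (Hr ^+ 2 / 2 / 2) * (N ^+ 2 / 2 / io)) =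
     Hr ^+ 4 * (2 * N ^+ 2 * io / kap ^+ 2) by field; rewrite !gt_eqF.
  rewrite ler_peMr // ler_pdivlMr ?exprn_gt0 // mul1r.
  apply: (@le_trans _ _ kap); first by rewrite expr2 ler_piMr // ltW.
  by rewrite mulrC -ler_pdivrMr ?mulr_gt0 ?exprn_gt0.
have := sample_le (exprn_ge0 2 (ler0n R 160)) a0 L1 lL h hK; lra.
Qed.

(** Keeping only N from [ch] and 1 from L under the root leaves sqrt d N / (2 sqrt iota); this half
    turns 24 into 48. *)
Lemma target_le (sd N i ch L B lp K : R) : 0 < i -> 1 <= L -> 0 <= N -> N <= ch ->
  0 <= B -> 0 <= lp -> 0 < K -> 0 <= sd ->
  24 * (sd * N) * B * lp / (K * Num.sqrt i) <=
    48 * (Num.sqrt (ch * (N * sd ^+ 2 / (4 * i)) * L) * B * lp / K).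
Proof.
move=> i0 L1 N0 hch B0 lp0 K0 sd0.
have L0 : 0 <= L by lra.
have si : Num.sqrt i ^+ 2 = i by apply: sqr_sqrtr; exact: ltW.
have si0 : 0 < Num.sqrt i by rewrite sqrtr_gt0.
set c := ch * (N * sd ^+ 2 / (4 * i)) * L.
have a0 : 0 <= N * sd ^+ 2 / (4 * i) by rewrite divr_ge0 ?mulr_ge0 ?sqr_ge0 // ltW.
have h1 : sd * N / (2 * Num.sqrt i) <= Num.sqrt c.
  have q0 : 0 <= sd * N / (2 * Num.sqrt i) by rewrite divr_ge0 ?mulr_ge0 // ltW.
  rewrite -(ger0_norm q0) -sqrtr_sqr ler_wsqrtr //.
  have -> : (sd * N / (2 * Num.sqrt i)) ^+ 2 = N * (N * sd ^+ 2 / (4 * i)).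
    by rewrite !exprMn exprVn exprMn si; field; rewrite gt_eqF.
  rewrite /c -[leRHS]mulrA; apply: ler_pM => //; rewrite ler_peMr //.
have -> : 24 * (sd * N) * B * lp / (K * Num.sqrt i) = 48 * (sd * N / (2 * Num.sqrt i)) * (B * lp / K).
  by field; rewrite !gt_eqF.
have b0 : 0 <= B * lp / K by rewrite divr_ge0 ?mulr_ge0 ?(ltW K0).
have -> : Num.sqrt c * B * lp / K = Num.sqrt c * (B * lp / K) by ring.
by rewrite -mulrA ler_pM2l // ler_wpM2r.
Qed.

End SampleSize.

(** * Accuracy of a run on the good event *)

Section Accuracy.
Variables (R : realType) (dS dA : measure_display).
Variables (S : measurableType dS) (A : measurableType dA).
Variables (d H K : nat).
Variables (phi : S * A -> 'cV[R]_d) (gam : nat -> 'cV[R]_d).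
Variable P : nat -> R.-pker (S * A)%type ~> S.
Variables (mup mum : nat -> 'I_d -> {finite_measure set S -> \bar R}).
Variable pi : nat -> R.-pker S ~> A.
Variable nu : nat -> {measure set (S * A) -> \bar R}.
Local Notation sample := ((S * A) * R * S)%type.
Local Notation I := (bool * 'I_H * 'I_K)%type.
Let r h sa := dotv (phi sa) (gam h).
Hypothesis mdp : linear_mdp H phi gam P mup mum.
Hypothesis nu1 : forall h, (1 <= h <= H)%N -> nu h setT = 1%E.
Hypothesis d0 : (0 < d)%N.
Hypothesis K0 : (0 < K)%N.

Let sigma := sigma_fun H P r pi (fun=> 1) 1.
Let Lam h := Lambda_mat phi nu sigma h.
Let iota h := lambda_min (Lam h).
Let kappa h := lambda_min (Sigma_mat phi nu h).
Let N h : R := (H - h).+1%:R.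

Variables (l l' : R) (v : nat -> 'cV[R]_d).
Let E := 3 * Num.sqrt (K%:R * l).
Let B h := Mnorm (invmx (Lam h)) (v h).

Definition lev_cap h := 4 * B h / (K%:R * Num.sqrt (iota h)).

(* The exponent that balances the conditional variance of the weighted noise
   against the largest value of a single summand. *)
Definition tilt h := (Num.sqrt (16 * B h ^+ 2 / K%:R / l') + 2 * N h * lev_cap h)^-1.

Hypothesis l1 : 1 <= l.
Hypothesis l'1 : 1 <= l'.
Hypothesis kappa0 : forall h, (1 <= h <= H)%N -> 0 < kappa h.
Hypothesis sample_kappa : forall h, (1 <= h <= H)%N ->
  1600 * (d%:R ^+ 2 * H%:R ^+ 4) * l <= kappa h ^+ 2 * K%:R.
Hypothesis sample_iota : forall h, (1 <= h <= H)%N ->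
  1600 * (d%:R ^+ 2 * H%:R ^+ 4) * l <= iota h ^+ 2 * K%:R.

Let K0' : 0 < K%:R :> R. Proof. by rewrite ltr0n. Qed.
Let l0 : 0 < l. Proof. exact: lt_le_trans l1. Qed.
Let d1 : 1 <= d%:R :> R. Proof. by rewrite ler1n. Qed.
Let sd1 : 1 <= Num.sqrt d%:R :> R.
Proof. by rewrite -{1}sqrtr1 ler_sqrt ?ler1n. Qed.
Let sdd : Num.sqrt d%:R ^+ 2 = d%:R :> R. Proof. by apply: sqr_sqrtr. Qed.

Let s : R := Num.sqrt (K%:R * l).
Let s1 : 1 <= s.
Proof.
rewrite /s -[leLHS]sqrtr1 ler_sqrt ?mulr_ge0 ?(ltW l0) // -[leLHS]mulr1.
by apply: ler_pM => //; rewrite ler1n.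
Qed.

Let N0 h : 0 <= N h. Proof. exact: ler0n. Qed.

Lemma lev_cap_ge0 h : 0 <= lev_cap h.
Proof. by rewrite /lev_cap divr_ge0 ?mulr_ge0 ?sqrtr_ge0 ?Mnorm_ge0. Qed.

Lemma tilt_ge0 h : 0 <= tilt h.
Proof.
rewrite /tilt invr_ge0; apply: addr_ge0; first exact: sqrtr_ge0.
by apply: mulr_ge0 (lev_cap_ge0 h); apply: mulr_ge0.
Qed.

(** The second summand of the inverted sum already ensures it; if both summands vanish, the inverse
    of 0 is 0. *)
Lemma tilt_lev_cap h : tilt h * lev_cap h * (2 * N h) <= 1.
Proof.
have m0 := lev_cap_ge0 h.
set q := Num.sqrt (16 * B h ^+ 2 / K%:R / l').
have q0 : 0 <= q by exact: sqrtr_ge0.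
have a0 : 0 <= 2 * N h * lev_cap h by apply: mulr_ge0 m0; apply: mulr_ge0.
rewrite /tilt -/q; set a := 2 * N h * lev_cap h in a0 *.
have -> : (q + a)^-1 * lev_cap h * (2 * N h) = a / (q + a) by rewrite /a; ring.
have := addr_ge0 q0 a0; rewrite le_eqVlt => /orP[/eqP<-|h0].
  by rewrite invr0 mulr0.
by rewrite ler_pdivrMr // mul1r lerDr.
Qed.

Section stage.
Variable h : nat.
Hypothesis hH : (1 <= h <= H)%N.

Let iota0 : 0 < iota h.
Proof.
apply: lt_le_trans (iota_ge_kappa pi mdp hH (nu1 hH) d0 (kappa0 hH)).
by rewrite divr_gt0 ?mulr_gt0 ?exprn_gt0 // kappa0.
Qed.

Let N1 : 1 <= N h. Proof. by rewrite /N ler1n. Qed.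

Let H1 : 1 <= H%:R :> R.
Proof. by case/andP: hH => h1 hH'; rewrite ler1n (leq_trans h1). Qed.

Let NH : N h <= H%:R.
Proof.
by rewrite /N ler_nat; case/andP: hH => h1 hH'; rewrite -subSn // leq_subLR -addn1 addnC leq_add2r.
Qed.

Let H0 : 0 <= H%:R :> R. Proof. exact: ler0n. Qed.

(* [q] ranges over the multiples of [sqrt (K l)] that a stage has to absorb. *)
Let absorb q y : 0 <= q -> 0 <= y -> q <= 40 * (d%:R * H%:R ^+ 2) ->
  1600 * (d%:R ^+ 2 * H%:R ^+ 4) * l <= y ^+ 2 * K%:R -> q * s <= K%:R * y.
Proof.
move=> q0 y0 qb hy; apply: sqrt_sample_le => //; first exact: ltW.
apply: le_trans hy; rewrite ler_wpM2r ?(ltW l0) //.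
have -> : 1600 * (d%:R ^+ 2 * H%:R ^+ 4) = (40 * (d%:R * H%:R ^+ 2)) ^+ 2 :> R by ring.
by rewrite ler_sqr ?nnegrE // ?mulr_ge0 ?sqr_ge0.
Qed.

Let H21 : 1 <= H%:R ^+ 2 :> R. Proof. by rewrite expr_ge1. Qed.

Let E_small y : 0 <= y ->  1600 * (d%:R ^+ 2 * H%:R ^+ 4) * l <= y ^+ 2 * K%:R ->
  E * d%:R <= K%:R * y / 2.
Proof.
move=> y0 hy.
have : 6 * d%:R * s <= K%:R * y.
  apply: absorb => //.
  have : 0 <= d%:R * (H%:R ^+ 2 - 1) :> R by rewrite mulr_ge0 // subr_ge0.
  have := d1; lra.
rewrite /E -/s; lra.
Qed.

Let sd_le_d : Num.sqrt d%:R <= d%:R :> R.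
Proof. by rewrite -{2}sdd expr2 ler_peMl // (le_trans ler01). Qed.

Let E_moment_small : (Num.sqrt d%:R + Num.sqrt d%:R * E) * N h ^+ 2 * 6 <= K%:R * kappa h.
Proof.
have sd0 : 0 <= Num.sqrt d%:R :> R by exact: sqrtr_ge0.
apply: (@le_trans _ _ (24 * (Num.sqrt d%:R * N h ^+ 2) * s)).
  have : 0 <= Num.sqrt d%:R * N h ^+ 2 * (s - 1).
    by rewrite !mulr_ge0 ?sqr_ge0 // subr_ge0.
  rewrite /E -/s; lra.
apply: absorb; rewrite ?sample_kappa ?(ltW (kappa0 _)) // ?mulr_ge0 ?sqr_ge0 //.
have h1 : Num.sqrt d%:R * N h ^+ 2 <= d%:R * H%:R ^+ 2.
  by apply: ler_pM; rewrite ?sqr_ge0 // ler_sqr ?nnegrE.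
have : 0 <= d%:R * H%:R ^+ 2 :> R by rewrite mulr_ge0 ?sqr_ge0.
lra.
Qed.

(** Each of the H stages may add 1/H. As s >= 1, the regularisation is merged into the noise, for a
    total of 5 sqrt d N s. *)
Let pointwise_small :
  (2 * (Num.sqrt d%:R * N h) + Num.sqrt d%:R * (N h * E)) / (K%:R * iota h / 8) <= H%:R^-1.
Proof.
have sd0 : 0 <= Num.sqrt d%:R :> R by exact: sqrtr_ge0.
have H0' : 0 < H%:R :> R by apply: lt_le_trans H1.
rewrite ler_pdivrMr ?divr_gt0 ?mulr_gt0 // (mulrC H%:R^-1) ler_pdivlMr //.
have a0 : 0 <= Num.sqrt d%:R * N h * H%:R by rewrite !mulr_ge0.
have h1 : 40 * (Num.sqrt d%:R * N h * H%:R) * s <= K%:R * iota h.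
  apply: absorb; rewrite ?sample_iota ?(ltW iota0) // ?mulr_ge0 //.
  have : Num.sqrt d%:R * N h * H%:R <= d%:R * H%:R ^+ 2.
    rewrite -mulrA; apply: ler_pM; rewrite ?mulr_ge0 // expr2.
    exact: ler_pM.
  lra.
have h2 : 0 <= Num.sqrt d%:R * N h * H%:R * (s - 1) by rewrite mulr_ge0 // subr_ge0.
rewrite /E -/s; lra.
Qed.

Variables (V : S -> R) (zD zC : 'I_K -> sample).
Hypothesis mV : measurable_fun setT V.
Hypothesis V_bounds : forall s, -1 <= V s <= N h.
Hypothesis V_close : forall s, `|Vpi H P r pi h.+1 s - V s| <= 1.
Hypothesis good :
  stage_good H phi gam P pi nu h V zD zC E (tilt h) (lev_cap h) l' (v h).

Let E0 : 0 <= E. Proof. by rewrite mulr_ge0 ?sqrtr_ge0. Qed.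

Let Ekappa := E_small (ltW (kappa0 hH)) (sample_kappa hH).
Let Eiota := E_small (ltW iota0) (sample_iota hH).

Lemma good_pointwise sa :
  `|dotv (phi sa) (gam h + muV mup mum h V - w_hat H phi gam h V zD zC)| <= H%:R^-1.
Proof.
apply: le_trans pointwise_small.
exact: (stage_pointwise mdp hH (nu1 hH) d0 mV V_bounds good V_close K0 (kappa0 hH) E0
  Ekappa Eiota E_moment_small).
Qed.

Lemma good_direction :
  `|dotv (v h) (gam h + muV mup mum h V - w_hat H phi gam h V zD zC)| <=
    12 * B h * Num.sqrt (l' / K%:R)
    + 24 * (Num.sqrt d%:R * N h) * B h * l' / (K%:R * Num.sqrt (iota h)).
Proof.
exact: (stage_target mdp hH (nu1 hH) d0 mV V_bounds good V_close K0 (kappa0 hH) E0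
  Ekappa Eiota E_moment_small l'1 erefl erefl).
Qed.

End stage.

Section run.
Variable x : I -> sample.
Hypothesis good : forall i : 'I_H,
  stage_good H phi gam P pi nu i.+1 (VT phi gam pi i x)
    (fun k => x (false, i, k)) (fun k => x (true, i, k))
    E (tilt i.+1) (lev_cap i.+1) l' (v i.+1).

Let stage_ord (i : 'I_H) : (1 <= i.+1 <= H)%N. Proof. exact: ltn_ord. Qed.
Let Vx := Vh phi gam pi x.
Let wx := wh phi gam pi x.
Let Vx_last : Vx H.+1 = fun=> 0. Proof. exact: Vh_last. Qed.
Let Vx_step h (hH : (1 <= h <= H)%N) : Vx h = fun s => dotv (phi_pol phi pi h s) (wx h).
Proof. exact: Vh_step. Qed.

Let close h := forall s, `|Vpi H P r pi h s - Vx h s| <= 1.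

(** The true value of the next stage lies in [0, N - 1], so an error of at most 1 stays inside
    [-1, N]. *)
Let VT_id (i : 'I_H) : close i.+2 -> VT phi gam pi i x = Vx i.+2.
Proof.
move=> hc; apply/funext => u; apply: clip_id.
have iH : (1 <= i.+2 <= H.+1)%N by rewrite /= ltnS; exact: ltn_ord.
have [_ /(_ u)] := Vpi_bounds pi mdp iH.
rewrite subSS -[(H - i.+1).+1%:R]natr1; have := hc u; rewrite ler_norml -/Vx -/r.
by move=> /andP[a b] /andP[e f]; apply/andP; split; lra.
Qed.

Let werrE (i : 'I_H) : close i.+2 ->
  werr gam mup mum Vx wx i.+1 = gam i.+1 + muV mup mum i.+1 (VT phi gam pi i x)
     - w_hat H phi gam i.+1 (VT phi gam pi i x) (fun k => x (false, i, k)) (fun k => x (true, i, k)).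
Proof.
move=> hc; have e b : dsel x b i.+1 = fun k => x (b, i, k).
  by apply/funext => k; rewrite dsel_ord.
by rewrite /werr /wx /wh !e -/Vx (VT_id hc).
Qed.

Let VT_good (i : 'I_H) (hc : close i.+2) :
  [/\ measurable_fun setT (VT phi gam pi i x),
      forall u, -1 <= VT phi gam pi i x u <= N i.+1 &
      forall u, `|Vpi H P r pi i.+2 u - VT phi gam pi i x u| <= 1].
Proof.
split; [|by move=> u; exact: VT_bounds|by rewrite (VT_id hc)].
rewrite (VT_id hc).
have iH : (1 <= i.+2 <= H.+1)%N by rewrite /= ltnS; exact: ltn_ord.
by have [] := bmf_Vhat mdp Vx_last Vx_step iH.
Qed.

(** The hypothesis at stage h + 1 serves twice, to make the clipping inactive and to validate the
    variance estimates; stage h then adds 1/H. *)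
Lemma run_close h : (1 <= h <= H.+1)%N ->
  forall u, `|Vpi H P r pi h u - Vx h u| <= (H.+1 - h)%:R / H%:R.
Proof.
move=> /andP[h1 hH].
elim: {h}(H.+1 - h)%N {-2}h (erefl (H.+1 - h)%N) h1 hH => [|n IH] h hn h1 hH u.
  have -> : h = H.+1 by apply/eqP; rewrite eqn_leq hH -subn_eq0 hn.
  by rewrite Vpi_last Vx_last subr0 normr0 divr_ge0.
have hH' : (h <= H)%N by rewrite -ltnS -subn_gt0 hn.
have hn' : (H.+1 - h.+1 = n)%N by rewrite subnS hn.
have hh : (1 <= h <= H)%N by rewrite h1.
have hP : (h.-1 < H)%N by rewrite prednK.
have hE : h = (Ordinal hP).+1 by rewrite /= prednK.
have H0 : 0 < H%:R :> R by rewrite ltr0n (leq_trans h1).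
have next := IH h.+1 hn' isT hH'.
have hc : close (Ordinal hP).+2.
  move=> u'; rewrite -hE; apply: le_trans (next u') _.
  by rewrite ler_pdivrMr // mul1r ler_nat subSS leq_subr.
have [a1 a2 a3] := VT_good hc.
rewrite hn' in next; rewrite hn -[n.+1%:R]natr1 mulrDl [leRHS]addrC div1r.
apply: (Delta_sup mdp Vx_last Vx_step hh _ next) => sa.
rewrite hE (werrE hc).
exact: (good_pointwise (stage_ord (Ordinal hP)) a1 a2 a3 (good _)).
Qed.

Lemma run_direction h : (1 <= h <= H)%N ->
  `|dotv (v h) (werr gam mup mum Vx wx h)| <=
    12 * B h * Num.sqrt (l' / K%:R)
    + 24 * (Num.sqrt d%:R * N h) * B h * l' / (K%:R * Num.sqrt (iota h)).
Proof.
move=> hH; have /andP[h1 hH'] := hH.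
have hP : (h.-1 < H)%N by rewrite prednK.
have hE : h = (Ordinal hP).+1 by rewrite /= prednK.
have hc : close (Ordinal hP).+2.
  move=> u'; rewrite -hE; apply: le_trans (@run_close h.+1 _ u') _ => //.
  rewrite ler_pdivrMr ?ltr0n ?(leq_trans h1) // mul1r ler_nat subSS leq_subr //.
have [a1 a2 a3] := VT_good hc.
rewrite hE (werrE hc); exact: (good_direction (stage_ord (Ordinal hP)) a1 a2 a3 (good _)).
Qed.

End run.
End Accuracy.

(** * The actual execution, and the case of a single sample *)

Section Execution.
Variables (R : realType) (dS dA dO : measure_display).
Variables (S : measurableType dS) (A : measurableType dA) (Omega : measurableType dO).
Variables (d H K : nat).
Variables (phi : S * A -> 'cV[R]_d) (gam : nat -> 'cV[R]_d).
Variable P : nat -> R.-pker (S * A)%type ~> S.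
Variables (mup mum : nat -> 'I_d -> {finite_measure set S -> \bar R}).
Variable pi : nat -> R.-pker S ~> A.
Variable nu : nat -> {measure set (S * A) -> \bar R}.
Variable noise : nat -> probability R R.
Variable Pr : probability Omega R.
Local Notation sample := ((S * A) * R * S)%type.
Variable X : bool -> nat -> 'I_K -> Omega -> sample.
Let r h sa := dotv (phi sa) (gam h).

Lemma fqi_V_ext (D D' Dc Dc' : dataset R S A K) n : (n <= H)%N ->
  (forall h, (1 <= h <= H)%N -> D h = D' h /\ Dc h = Dc' h) ->
  fqi_V H phi 1 (fun=> 1) 1 pi D Dc n = fqi_V H phi 1 (fun=> 1) 1 pi D' Dc' n.
Proof.
elim: n => // n IH nH e; rewrite /= (IH (ltnW nH) e).
have [e1 e2] : D (H - n)%N = D' (H - n)%N /\ Dc (H - n)%N = Dc' (H - n)%N.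
  by apply: e; rewrite subn_gt0 nH leq_subr.
by apply/funext => s; rewrite /fqi_w e1 e2.
Qed.

(** Only the stages 1 to H of the data are read, and these are what the array indexed by ['I_H]
    records. *)
Lemma fqi_output_Vh (xi1 : probability S R) w :
  let data b : dataset R S A K :=
    fun h k => let z := X b h k w in (z.1.1, r h z.1.1 + z.1.2, z.2) in
  fqi_output H phi 1 (fun=> 1) 1 pi (data false) (data true) xi1 =
  Rintegral xi1 setT (Vh phi gam pi (sampleX (H := H) X w) 1).
Proof.
move=> data; rewrite /fqi_output /Vh subSS subn0; congr (Rintegral _ _ _).
have e b h : (1 <= h <= H)%N -> data b h = dset phi gam (sampleX (H := H) X w) b h.
  move=> /andP[h1 hH]; have hP : (h.-1 < H)%N by rewrite prednK.
  apply/funext => k; rewrite /data /dset /dsel insubT /sampleX /XI /=.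
  by rewrite prednK.
by apply: fqi_V_ext => // h hH; split; exact: e.
Qed.

Hypothesis mdp : linear_mdp H phi gam P mup mum.
Hypothesis mX : forall b h k, measurable_fun setT (X b h k).
Hypothesis noiseP : forall h, (1 <= h <= H)%N ->
  (\int[noise h]_e e%:E = 0)%E /\ noise h [set e | 1 < `|e|] = 0%E.
Hypothesis lawX : forall b h k, (1 <= h <= H)%N ->
  forall B1 Be B2, measurable B1 -> measurable Be -> measurable B2 ->
    Pr (X b h k @^-1` [set z | B1 z.1.1 /\ Be z.1.2 /\ B2 z.2]) =
    ((\int[nu h]_(sa in B1) P h sa B2) * noise h Be)%E.

Lemma whp_noise_le1 b h : (1 <= h <= H)%N ->
  whp Pr 0 (fun w => forall k, `|(X b h k w).1.2| <= 1).
Proof.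
move=> hH; have mL := @measurable_norm_gt1 R.
rewrite -[0](mulr0 #|'I_K|%:R); apply: whp_fin => k.
exists (X b h k @^-1` [set z | setT z.1.1 /\ 1 < `|z.1.2| /\ setT z.2]); split.
- rewrite -[X in measurable X]setTI; apply: mX => //.
  rewrite (_ : [set _ | _] = (fun z : sample => z.1.2) @^-1` [set e | 1 < `|e|]); last first.
    by apply/seteqP; split=> z /=; [case=> _ []|].
  rewrite -[X in measurable X]setTI.
  exact: (measurableT_comp measurable_snd measurable_fst) measurableT _ mL.
- have -> := lawX b k hH measurableT mL measurableT.
  by have [_ ->] := noiseP hH; rewrite mule0.
- by move=> w h1; rewrite leNgt; apply/negP => h2; apply: h1; split.
Qed.

(** With a zero next value nothing has to concentrate: the Gram matrix dominates the identity, the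
    weights are at most 1/2 and each noise at most 1. *)
Lemma last_stage_direction (zD zC : 'I_K -> sample) v h : (1 <= h <= H)%N ->
  (forall k, `|(zD k).1.2| <= 1) ->
  `|dotv v (gam h + muV mup mum h (fun=> 0) - w_hat H phi gam h (fun=> 0) zD zC)| <=
    (1 + K%:R / 2) * vnorm v.
Proof.
move=> hH e1; rewrite muV0 addr0.
have w0 k : 0 <= wt H phi h (fun=> 0) zD zC k.
  by have /andP[] := wt_bounds H phi h (fun=> 0) zD zC k.
apply: le_trans (ridge_direction (phiD phi zD) w0
  (fun k => dotv (phi (zD k).1.1) (gam h) + (zD k).1.2 + 0) (gam h) v) _.
set G := gram _ _.
have gG := gram_ge1 (phiD phi zD) w0.
have Gv z : Mnorm (invmx G) z <= vnorm z.
  have := Mnorm_inv_vnorm z ltr01 (gram_sym _ _) gG; by rewrite sqrtr1 divr1.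
have pG := psd_invgram (phiD phi zD) w0.
have v0 := vnorm_ge0 v.
rewrite mulrDl mul1r; apply: lerD.
  rewrite -[leRHS]mulr1; apply: ler_pM; rewrite ?Mnorm_ge0 //.
  exact: le_trans (Gv _) (vnorm_gam_le1 mdp hH).
apply: le_trans (ler_norm_sum _ _ _) _.
apply: (@le_trans _ _ (\sum_(k < K) vnorm v / 2)); last first.
  by rewrite sumr_const card_ord -mulr_natl; lra.
apply: ler_sum => k _; rewrite !normrM addr0 /phiD [_ + (zD k).1.2]addrC addrK.
have /andP[_ w12] := wt_bounds H phi h (fun=> 0) zD zC k.
rewrite -[leRHS]mulr1; apply: ler_pM; rewrite ?mulr_ge0 //.
rewrite (ger0_norm (w0 k)) -[2^-1]mul1r; apply: ler_pM => //.
apply: le_trans (ler_dotv_Mnorm _ _ pG) _.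
rewrite -[leRHS]mulr1; apply: ler_pM; rewrite ?Mnorm_ge0 //.
exact: le_trans (Gv _) (vnorm_phi_le1 mdp _).
Qed.

Hypothesis indX : mutual_indep Pr (XI (H := H) X).

Lemma whp_all_good (l l' : R) (v : nat -> 'cV[R]_d) :
  (0 < d)%N -> (0 < K)%N -> 0 < l -> 4 * l <= K%:R ->
  whp Pr (H%:R * (10 * d%:R ^+ 2 * expR (- l) + 2 * expR (- l'))) (fun w => forall i : 'I_H,
    stage_good H phi gam P pi nu i.+1 (VT phi gam pi i (sampleX X w))
      (fun k => sampleX X w (false, i, k)) (fun k => sampleX X w (true, i, k))
      (3 * Num.sqrt (K%:R * l)) (tilt H K phi gam P pi nu l' v i.+1)
      (lev_cap H K phi gam P pi nu v i.+1) l' (v i.+1)).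
Proof.
move=> d0 K0 l0 lK; rewrite -[X in X%:R * _](card_ord H); apply: whp_fin => i.
exact: (whp_stage_good pi mdp mX noiseP lawX indX l' (v i.+1) d0 K0 l0 lK
  (tilt_ge0 _ _ _ _ _ _ _ _ _ _) (lev_cap_ge0 _ _ _ _ _ _ _ _ _)
  (tilt_lev_cap _ _ _ _ _ _ _ _ _ _)).
Qed.

End Execution.

Unset Implicit Arguments.
Set Strict Implicit.
Set Printing Implicit Defensive.

Theorem theorem1 (R : realType) :
  exists C : R, 0 < C /\
  forall (dS dA dO : measure_display)
    (S : measurableType dS) (A : measurableType dA) (Omega : measurableType dO)
    (d H K : nat)
    (phi : S * A -> 'cV[R]_d) (gam : nat -> 'cV[R]_d)
    (P : nat -> R.-pker (S * A) ~> S)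
    (noise : nat -> probability R R)
    (xi1 : probability S R)
    (pi pib : nat -> R.-pker S ~> A)
    (nu nupi : nat -> {measure set (S * A) -> \bar R})
    (Pr : probability Omega R)
    (X : bool -> nat -> 'I_K -> Omega -> ((S * A) * R * S)%type)
    (delta : R),
  (* dimensions *)
  (0 < d)%N -> (0 < H)%N -> (0 < K)%N ->
  (* feature map *)
  (forall i, measurable_fun setT (fun sa => phi sa i 0)) ->
  (forall sa, vnorm (phi sa) <= 1) ->
  (* linear rewards *)
  (forall h, (1 <= h <= H)%N -> vnorm (gam h) <= 1) ->
  (forall h, (1 <= h <= H)%N -> forall sa,
     0 <= dotv (phi sa) (gam h) <= 1) ->
  (* linear transitions: P_h(.|s,a) = <phi(s,a), mu_h(.)>, mu_h a d-vector of
     signed measures, written as differences of finite measures *)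
  (forall h, (1 <= h <= H)%N ->
     exists mup mum : 'I_d -> {finite_measure set S -> \bar R},
       (forall sa B, measurable B ->
          P h sa B = (\sum_(j < d) phi sa j 0 *
                        (fine (mup j B) - fine (mum j B)))%:E) /\
       (forall f : S -> R, measurable_fun setT f -> (forall s, `|f s| <= 1) ->
          Num.sqrt (\sum_(j < d)
            (Rintegral (mup j) setT f - Rintegral (mum j) setT f) ^+ 2)
          <= Num.sqrt d%:R)) ->
  (* reward noise: zero mean, |eps| <= 1, r_h(s,a) + eps <= 1 a.s. *)
  (forall h, (1 <= h <= H)%N ->
     [/\ (\int[noise h]_e e%:E = 0)%E,
         noise h [set e | 1 < `|e|] = 0%E &
         forall sa, noise h [set e | 1 < dotv (phi sa) (gam h) + e] = 0%E]) ->
  (* occupancy measures of the behavior and target policies *)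
  is_occupancy H P xi1 pib nu ->
  is_occupancy H P xi1 pi nupi ->
  (* coverage: kappa > 0 *)
  0 < min_stage H (fun h => lambda_min (Sigma_mat phi nu h)) ->
  (* data: X b h k = ((s_{k,h}, a_{k,h}), eps_{k,h}, s'_{k,h}) for dataset
     D (b = false) and check-D (b = true); all mutually independent *)
  (forall b h k, measurable_fun setT (X b h k)) ->
  (forall b h k, (1 <= h <= H)%N ->
     forall B1 Be B2, measurable B1 -> measurable Be -> measurable B2 ->
       Pr (X b h k @^-1` [set z | B1 z.1.1 /\ Be z.1.2 /\ B2 z.2]) =
       ((\int[nu h]_(sa in B1) P h sa B2) * noise h Be)%E) ->
  mutual_indep Pr
    (fun t : bool * 'I_H * 'I_K => X t.1.1 (t.1.2).+1 t.2) ->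
  0 < delta < 1 ->
  let r h sa := dotv (phi sa) (gam h) in
  let data b w : dataset R S A K :=
    fun h k => let z := X b h k w in (z.1.1, r h z.1.1 + z.1.2, z.2) in
  let sigma := sigma_fun H P r pi (fun _ => 1) 1 in
  let Lam h := Lambda_mat phi nu sigma h in
  let iota h := lambda_min (Lam h) in
  let kappa := min_stage H (fun h => lambda_min (Sigma_mat phi nu h)) in
  let vpi h := vpi_vec phi nupi h in
  let v1 := Rintegral xi1 setT (Vpi H P r pi 1) in
  let vhat w := fqi_output H phi 1 (fun _ => 1) 1 pi (data false w) (data true w) xi1 in
  let Ch2 h := \sum_(h <= i < H.+1) (H - i).+1%:R / Num.sqrt (2 * iota i) in
  let Ch3 h := (H - h).+1%:R ^+ 2 / 2 in
  let Ch4 h := Num.sqrt (opnorm (Lam h) * opnorm (invmx (Lam h))) in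
  let L := ln (d%:R * H%:R ^+ 2 * K%:R / (kappa * delta)) in
  let C3 := Num.max (max_stage H (fun h => Ch3 h * Ch2 h ^+ 2 / (8 * iota h ^+ 2)))
           (Num.max (H%:R ^+ 4 / kappa ^+ 2)
              (H%:R ^+ 2 / kappa ^+ 2 * max_stage H (fun h => Ch3 h / 2)
                 * max_stage H (fun h => Ch3 h / iota h))) in
  let C4 := \sum_(1 <= h < H.+1)
     Num.sqrt (Ch4 h * Ch2 h * ((H - h).+1%:R * d%:R / (4 * iota h)) * L)
       * Mnorm (invmx (Lam h)) (vpi h) in
  let L' := ln (16 * H%:R / delta) in
  C * C3 * d%:R ^+ 2 * L ^+ 2 <= K%:R ->
  with_prob_at_least Pr (1 - delta)
    [set w | `|v1 - vhat w| <=
       C * (\sum_(1 <= h < H.+1) Mnorm (invmx (Lam h)) (vpi h)) * Num.sqrt (L' / K%:R)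
       + C * C4 * L' * ((powR K%:R (3 / 4))^-1 + K%:R^-1)].
Proof.
exists (160 ^+ 2); split; first by rewrite exprn_gt0.
move=> dS dA dO S A Omega d H K phi gam P noise xi1 pi pib nu nupi Pr X delta.
move=> d0 H0 K0 mphi phi1 gam1 rew tr noiseH _ occ kap0 mX lawX indX del01.
have [del0 del1] := andP del01.
move=> r data sigma Lam iota kappa vpi v1 vhat Ch2 Ch3 Ch4 L C3 C4 L' hK.
have H01 : (1 <= 1 <= H)%N by [].
have [mup [mum mdp]] : exists mup mum, linear_mdp H phi gam P mup mum.
  have [mp1 [mm1 _]] := tr 1%N H01.
  (* The measures are given stage by stage; outside 1 .. H those of stage 1 serve as a default. *)
  have /choice[mu muP] h : exists m : ('I_d -> {finite_measure set S -> \bar R}) *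
      ('I_d -> {finite_measure set S -> \bar R}), (1 <= h <= H)%N ->
      (forall sa B, measurable B ->
          P h sa B = (\sum_(j < d) phi sa j 0 * (fine (m.1 j B) - fine (m.2 j B)))%:E) /\
      (forall f : S -> R, measurable_fun setT f -> (forall s, `|f s| <= 1) ->
          Num.sqrt (\sum_(j < d)
            (Rintegral (m.1 j) setT f - Rintegral (m.2 j) setT f) ^+ 2) <= Num.sqrt d%:R).
    have [hH|hH] := boolP (1 <= h <= H)%N; last by exists (mp1, mm1).
    by have [mp [mm hm]] := tr h hH; exists (mp, mm).
  exists (fun h => (mu h).1), (fun h => (mu h).2); split=> //.
  - by move=> h hH; have [] := muP h hH.
  - by move=> h hH; have [] := muP h hH.
have noiseP h : (1 <= h <= H)%N ->
    (\int[noise h]_e e%:E = 0)%E /\ noise h [set e | 1 < `|e|] = 0%E.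
  by move=> /noiseH[].
have nu1 h (hH : (1 <= h <= H)%N) : nu h setT = 1%E := law_mass1 (lawX true h (Ordinal K0) hH).
have kapH h (hH : (1 <= h <= H)%N) : kappa <= lambda_min (Sigma_mat phi nu h).
  exact: (min_stage_le (fun h => lambda_min (Sigma_mat phi nu h)) hH).
have kappaH h (hH : (1 <= h <= H)%N) := lt_le_trans kap0 (kapH h hH).
have kap01 : 0 < kappa <= 1.
  by rewrite kap0 (le_trans (kapH 1%N H01)) // (kappa_le1 mdp (nu1 _ H01)).
have iotaH h (hH : (1 <= h <= H)%N) : kappa / (2 * (H - h).+1%:R ^+ 2) <= iota h.
  apply: le_trans (iota_ge_kappa pi mdp hH (nu1 _ hH) d0 (kappaH h hH)).
  by rewrite ler_wpM2r ?invr_ge0 ?mulr_ge0 ?sqr_ge0 // kapH.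
have iota0 h (hH : (1 <= h <= H)%N) : 0 < iota h.
  by apply: lt_le_trans (iotaH h hH); rewrite divr_gt0 ?mulr_gt0 ?exprn_gt0.
have iota12 h (hH : (1 <= h <= H)%N) : iota h <= 1 / 2.
  exact: (iota_le_half pi mdp hH (nu1 _ hH) d0).
have C31 : H%:R ^+ 4 / kappa ^+ 2 <= C3 by rewrite !le_max lexx orbT.
have C32 h (hH : (1 <= h <= H)%N) : H%:R ^+ 2 / kappa ^+ 2 * (H%:R ^+ 2 / 2 / 2)
    * ((H - h).+1%:R ^+ 2 / 2 / iota h) <= C3.
  rewrite !le_max; apply/orP; right; apply/orP; right; apply: ler_pM.
  - by rewrite !mulr_ge0 ?invr_ge0 ?sqr_ge0.
  - by rewrite !mulr_ge0 ?invr_ge0 ?sqr_ge0 ?(ltW (iota0 h hH)).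
  (* The maximum is bounded below by its first stage, where C_{h,3} = H^2 / 2. *)
  - rewrite ler_wpM2l ?divr_ge0 ?sqr_ge0 //.
    have := max_stage_ge (fun h => Ch3 h / 2) H01.
    by rewrite /Ch3 subn1 prednK.
  - exact: (max_stage_ge (fun h => Ch3 h / iota h) hH).
pose B h := Mnorm (invmx (Lam h)) (vpi h).
have B0 h : 0 <= B h by exact: Mnorm_ge0.
have l'1 : 1 <= L'.
  apply: ln_ge1; rewrite ler_pdivlMr //.
  have : 1 <= H%:R :> R by rewrite ler1n.
  move: del1; clear; lra.
have l'0 : 0 <= L' by exact: le_trans l'1.
have K0' : 0 < K%:R :> R by rewrite ltr0n.
have C40 : 0 <= C4 by apply: sumr_ge0 => h _; rewrite mulr_ge0 ?sqrtr_ge0 ?B0.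
have vhatE w : vhat w = Rintegral xi1 setT (Vh phi gam pi (sampleX (H := H) X w) 1).
  exact: (fqi_output_Vh H phi gam pi X xi1 w).
pose err w h := dotv (vpi h) (werr gam mup mum (Vh phi gam pi (sampleX (H := H) X w))
    (wh phi gam pi (sampleX (H := H) X w)) h).
have errE w : v1 - vhat w = \sum_(1 <= h < H.+1) err w h.
  rewrite vhatE; apply: (value_error mdp _ _ occ H0); first exact: Vh_last.
  by move=> h hH; exact: Vh_step.
pose bound := 160 ^+ 2 * (\sum_(1 <= h < H.+1) B h) * Num.sqrt (L' / K%:R)
    + 160 ^+ 2 * C4 * L' * ((powR K%:R (3 / 4))^-1 + K%:R^-1).
(* The remainder will be of order 1/K, and the other power of K is nonnegative. *)
have boundE : 160 ^+ 2 * (\sum_(1 <= h < H.+1) B h) * Num.sqrt (L' / K%:R)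
    + 160 ^+ 2 * C4 * L' / K%:R <= bound.
  rewrite /bound lerD2l ler_wpM2l ?mulr_ge0 //.
  by rewrite lerDr invr_ge0 powR_ge0.
case: (ltngtP K 1) => [|K1|K1]; first by case: (K) K0.
- have [L1 lL] := sample_size d0 H0 K1 kap01 del01 C31 hK.
  (* Level of the coordinate events. The bound along the direction v uses L' instead, which keeps
     the dimension out of the leading term. *)
  set l := ln (20 * d%:R ^+ 2 * H%:R / delta) in lL.
  have dH0 : 0 < 20 * d%:R ^+ 2 * H%:R :> R by rewrite !mulr_gt0 ?exprn_gt0 ?ltr0n.
  have l1 : 1 <= l.
    apply: ln_ge1; rewrite ler_pdivlMr //.
    have a1 : 1 <= d%:R ^+ 2 :> R by rewrite expr_ge1 ?ler1n.
    have a2 : 1 <= d%:R ^+ 2 * H%:R :> R by rewrite -[leLHS]mulr1; apply: ler_pM; rewrite ?ler1n.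
    move: del1 a2; clear; lra.
  have l0 : 0 < l by exact: lt_le_trans l1.
  have sk h (hH : (1 <= h <= H)%N) := sample_kappa_le kap0 (kapH h hH) L1 (ltW l0) lL C31 hK.
  have si h (hH : (1 <= h <= H)%N) : 1600 * (d%:R ^+ 2 * H%:R ^+ 4) * l <= iota h ^+ 2 * K%:R.
    by apply: (sample_iota_le kap01 _ (iotaH h hH) L1 lL (C32 h hH) hK); rewrite ler1n.
  have lK : 4 * l <= K%:R.
    have a1 : iota 1%N ^+ 2 * K%:R <= K%:R.
      rewrite ler_piMl ?(ltW K0') // expr_le1 ?(ltW (iota0 _ H01)) //.
      by apply: le_trans (iota12 _ H01) _; lra.
    apply: le_trans a1; apply: le_trans (si _ H01); rewrite ler_pM2r //.
    have a2 : 1 <= d%:R ^+ 2 :> R by rewrite expr_ge1 ?ler1n.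
    have a3 : 1 <= H%:R ^+ 4 :> R by rewrite expr_ge1 ?ler1n.
    have : 1 * 1 <= d%:R ^+ 2 * H%:R ^+ 4 :> R by apply: ler_pM.
    by clear; lra.
  have w1 := whp_all_good pi mdp mX noiseP lawX indX L' vpi d0 K0 l0 lK.
  apply: (whp_with_prob _ (whp_weaken (lexx _) _ w1)).
    (* Failure budget: delta / 2 for the coordinates and delta / 8 for the directions. *)
    have -> : expR (- l) = delta / (20 * d%:R ^+ 2 * H%:R).
      by rewrite expRN lnK ?posrE ?divr_gt0 // invf_div.
    have -> : expR (- L') = delta / (16 * H%:R).
      by rewrite expRN lnK ?posrE ?divr_gt0 ?mulr_gt0 ?ltr0n // invf_div.
    have -> : H%:R * (10 * d%:R ^+ 2 * (delta / (20 * d%:R ^+ 2 * H%:R))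
        + 2 * (delta / (16 * H%:R))) = 5 / 8 * delta.
      by field; rewrite !gt_eqF ?ltr0n.
    by move: del0; clear; lra.
  move=> w good /=; apply: le_trans boundE; rewrite errE.
  apply: le_trans (ler_norm_sum _ _ _) _.
  have -> : 160 ^+ 2 * (\sum_(1 <= h < H.+1) B h) * Num.sqrt (L' / K%:R)
    + 160 ^+ 2 * C4 * L' / K%:R = \sum_(1 <= h < H.+1) (160 ^+ 2 * (B h * Num.sqrt (L' / K%:R)) +
      160 ^+ 2 * (Num.sqrt (Ch4 h * Ch2 h * ((H - h).+1%:R * d%:R / (4 * iota h)) * L)
       * B h * L' / K%:R)).
    rewrite big_split /= -!mulr_sumr -!mulr_suml -/C4.
    by congr (_ + _); ring.
  apply: ler_sum_nat => h hH; rewrite ltnS in hH.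
  apply: le_trans (run_direction mdp nu1 d0 K0 l1 l'1 kappaH sk si good hH) _.
  have N0 : 0 <= (H - h).+1%:R :> R by exact: ler0n.
  (* C_{h,4} is at least 1 as the root of a condition number, and the first term of C_{h,2} is at
     least H - h + 1 since 2 iota_h <= 1. *)
  have ch : (H - h).+1%:R <= Ch4 h * Ch2 h.
    have Ch41 : 1 <= Ch4 h.
      rewrite /Ch4 -[leLHS]sqrtr1 ler_wsqrtr //; apply: (opnorm_condition d0).
      exact: (posdef_unitmx (iota0 h hH) (Lambda_ge H phi gam P pi nu h d0)).
    have Ch2N : (H - h).+1%:R <= Ch2 h.
      rewrite /Ch2; have /andP[_ hH'] := hH; rewrite big_ltn ?ltnS //.
      rewrite -[leLHS]addr0; apply: lerD; last first.
        by apply: sumr_ge0 => i _; rewrite divr_ge0 ?sqrtr_ge0.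
      rewrite ler_pdivlMr ?sqrtr_gt0 ?mulr_gt0 ?iota0 // ler_piMr //.
      rewrite -[leRHS]sqrtr1 ler_wsqrtr //; have := iota12 h hH; clear; lra.
    by rewrite -[leLHS]mul1r; apply: ler_pM.
  have sdd : Num.sqrt d%:R ^+ 2 = d%:R :> R by apply: sqr_sqrtr.
  have := target_le (iota0 h hH) L1 N0 ch (B0 h) l'0 K0' (sqrtr_ge0 d%:R).
  rewrite sdd -/(B h) => t1; apply: lerD.
    rewrite -mulrA ler_wpM2r ?mulr_ge0 ?sqrtr_ge0 //; clear; lra.
  apply: le_trans t1 _; rewrite ler_wpM2r ?divr_ge0 ?mulr_ge0 ?sqrtr_ge0 //; clear; lra.
(* For K = 1 the logarithm L can be close to 0, so the failure level l is no longer below it. *)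
- have HE : H = 1%N.
    by move: hK; rewrite /L K1; exact: (single_sample d0 H0 kap01 del01 C31).
  have w1 := whp_noise_le1 mX noiseP lawX false H01.
  apply: (whp_with_prob (ltW del0) (whp_weaken (lexx _) _ w1)).
  move=> w eps1 /=; apply: le_trans boundE; rewrite errE HE !big_nat1.
  have hB : vnorm (vpi 1%N) <= B 1%N.
    apply: (Mnorm_inv_ge_vnorm _ (iota0 _ H01) (Lambda_sym _ _ _ _ _ _ _)).
      exact: Lambda_ge.
    move=> y; apply: le_trans (Lambda_le pi mdp H01 (nu1 _ H01) y) _.
    have := dotv_ge0 y; lra.
  have hz k : dsel (sampleX (H := H) X w) false 1 k = X false 1%N k w.
    exact: (dsel_ord (sampleX (H := H) X w) false (Ordinal H0) k).
  have V2 : Vh phi gam pi (sampleX (H := H) X w) 2 = fun=> 0.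
    by have := Vh_last phi gam pi (sampleX (H := H) X w); rewrite HE.
  have e1 : `|err w 1%N| <= (1 + K%:R / 2) * vnorm (vpi 1%N).
    rewrite /err /werr /wh V2; apply: (last_stage_direction mdp _ _ H01) => k.
    by rewrite hz.
  apply: le_trans e1 _; rewrite K1 !divr1.
  (* Since L' >= 1, the leading term is at least 160^2 B, above the error (3/2) B. *)
  have q1 : 1 <= Num.sqrt L' by rewrite -[leLHS]sqrtr1 ler_wsqrtr.
  have c0 : 0 <= 160 ^+ 2 * C4 * L' by rewrite !mulr_ge0.
  have b1 : 0 <= B 1%N * (Num.sqrt L' - 1) by rewrite mulr_ge0 ?subr_ge0.
  by move: hB c0 b1 (B0 1%N); clear; lra.
Qed.
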